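(* Let $\mu>0$, $2<p<6$ and $\ell>0$, and let $\mathcal G$ be the metric graph consisting of two half-lines and one bounded edge of length $\ell$, joined at their initial point. Then $$\inf_{u\in H^1_\mu(\mathcal G)} E(u,\mathcal G)\ <\ \min_{\phi\in H^1_\mu(\mathbb R)} E(\phi,\mathbb R)=E(\phi_\mu,\mathbb R),$$ and the infimum on the left-hand side is achieved.
   Context: The graph $\mathcal G$ has three edges: two half-lines $[0,+\infty)$ and one bounded interval $[0,\ell]$ (the pendant), whose points with coordinate $0$ are glued into a single point. A function $u:\mathcal G\to\mathbb R$ is identified with the family $(u_e)$ of its restrictions to the three edges $I_e$. $\|u\|_{L^r(\mathcal G)}^r=\sum_e\|u_e\|_{L^r(I_e)}^r$; $H^1(\mathcal G)$ is the set of $u$ continuous on $\mathcal G$ with $u_e\in H^1(I_e)$ for all edges $e$; $H^1_\mu(\mathcal G)=\{u\in H^1(\mathcal G):\|u\|_{L^2(\mathcal G)}^2=\mu\}$. The NLS energy is $$E(u,\mathcal G)=\tfrac12\|u'\|_{L^2(\mathcal G)}^2-\tfrac1p\|u\|_{L^p(\mathcal G)}^p=\tfrac12\sum_e\int_{I_e}|u_e'|^2\,dx_e-\tfrac1p\sum_e\int_{I_e}|u_e|^p\,dx_e .$$ The same notation is used with $\mathcal G$ replaced by $\mathbb R$. Soliton: $\phi_\mu$ denotes the unique positive and even minimizer of $E(\cdot,\mathbb R)$ over $H^1_\mu(\mathbb R)$ (the dependence on $p$ is understood). It is given by $\phi_\mu(x)=\mu^\alpha\phi_1(\mu^\beta x)$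 with $\alpha=\frac{2}{6-p}$, $\beta=\frac{p-2}{6-p}$ and $\phi_1(x)=C_p\,\mathrm{sech}(c_p x)^{\alpha/\beta}$ for suitable constants $C_p,c_p>0$. *)

(* Defs.v *)
From mathcomp Require Import all_boot all_order all_algebra.
From mathcomp Require Import all_classical all_reals all_analysis.
Set Implicit Arguments.
Unset Strict Implicit.
Unset Printing Implicit Defensive.
Import Order.TTheory GRing.Theory Num.Theory.
Import numFieldNormedType.Exports.
Local Open Scope ring_scope.
Local Open Scope classical_set_scope.

Section sobolev_on_an_interval.
Context {R : realType}.
Local Notation leb := (@lebesgue_measure R).
Implicit Types (I : set R) (u v phi : R -> R) (r : R).

(* [normX r I u] is the r-th power of the norm of u in L^r(I). *)
Definition normX r I u : \bar R := \int[leb]_(x in I) (`|u x| `^ r)%:E.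

Definition L2 I u : Prop := measurable_fun I u /\ (normX 2 I u < +oo)%E.

(* C^1 functions with compact support in the interior of I. *)
Definition test_function I phi : Prop :=
  [/\ forall x, derivable phi x 1,
      continuous (derive1 phi)
    & exists K, [/\ compact K, K `<=` interior I
                  & forall x, ~ K x -> phi x = 0]].

(* v in L^2(I) is the weak derivative of u on I.  Test functions are C^1_c, as
   usual for Sobolev spaces in dimension one (Brezis, Functional Analysis,
   Sobolev Spaces and PDEs, Section 8.2). *)
Definition weak_derivative I u v : Prop :=
  L2 I v /\
  forall phi, test_function I phi ->
    \int[leb]_(x in I) (u x * derive1 phi x) = - \int[leb]_(x in I) (v x * phi x).

Definition H1 I u : Prop := L2 I u /\ exists v, weak_derivative I u v.

(* A representative of the weak derivative, which is unique up to a null set;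
   it is only used under integrals over I. *)
Definition wderiv I u : R -> R := get [set v | weak_derivative I u v].

End sobolev_on_an_interval.

Section real_line.
Context {R : realType}.
Implicit Types (mu p : R) (u phi : R -> R).

Definition H1_line u : Prop := continuous u /\ H1 setT u.

Definition H1mu_line mu u : Prop := H1_line u /\ normX 2 setT u = mu%:E.

Definition energy_line p u : \bar R :=
  ((2^-1)%:E * normX 2 setT (wderiv setT u) - (p^-1)%:E * normX p setT u)%E.

Definition minimizer_line p mu phi : Prop :=
  H1mu_line mu phi /\
  forall u, H1mu_line mu u -> (energy_line p phi <= energy_line p u)%E.

Definition soliton p mu phi : Prop :=
  [/\ minimizer_line p mu phi,
      forall x, 0 < phi x
    & forall x, phi (- x) = phi x].

End real_line.

(* [None] is the pendant, [Some b] are the two half-lines. *)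
Definition edge : finType := option bool.

Section graph.
Context {R : realType}.
Implicit Types (l mu p : R) (u : edge -> R -> R).

Definition edge_set l (e : edge) : set R :=
  if e is None then `[0, l] else `[0, +oo[.

(* The points of coordinate 0 of the edges are identified, so that a function
   on the graph is a family (u e) whose values at 0 agree; the values of u e
   outside [edge_set l e] play no role. *)
Definition continuous_graph l u : Prop :=
  (forall e, {within edge_set l e, continuous (u e)}) /\
  (forall e e', u e 0 = u e' 0).

Definition H1_graph l u : Prop :=
  continuous_graph l u /\ forall e, H1 (edge_set l e) (u e).

Definition H1mu_graph l mu u : Prop :=
  H1_graph l u /\ (\sum_(e : edge) normX 2 (edge_set l e) (u e))%E = mu%:E.

Definition energy_graph p l u : \bar R :=
  ((2^-1)%:E * (\sum_(e : edge)
      normX 2 (edge_set l e) (wderiv (edge_set l e) (u e)))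
   - (p^-1)%:E * (\sum_(e : edge) normX p (edge_set l e) (u e)))%E.

End graph.

(* Main.v *)
(** A function in H1 is a pair (u, v) such that the increments of u are the
    integrals of v and both are square integrable.

    Lower bounds come from a calibration.  If |u| has supremum N, adding
    N^(p-2) / p times the mass density to the energy density makes it a sum of
    two squares, hence at least a constant times the derivative of an
    increasing function [action] of u / N, up to sign.  On the line, or on the
    graph when |u| is largest on a half-line, u / N passes at least twice
    between 1 and 0, which gives E >= [lower mu N]; by the virial identity the
    energy of the soliton is the minimum of this function of N.

    Strictness: stretch the part of the soliton above [-l/2, l/2] over the
    pendant, folded at its maximum, and put the two remaining tails on the
    half-lines.  The masses and potentials agree with those of the soliton and
    the kinetic energy strictly decreases.

    Existence: let m be the infimum of E and k = - m / mu.  By scaling, the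
    functional E + k mass is nonnegative on functions of mass at most mu and
    vanishes only at mass 0 or mu.  A minimizing sequence is bounded in H1 and
    converges, along an ultrafilter, locally uniformly to some u.  By
    calibration and the strict inequality m < E(soliton), the contribution of
    the tail of a half-line beyond a point where u is small is nonnegative, so
    E + k mass is at most 0 at u.  If u had mass 0, the sequence would be
    uniformly small on the pendant, and its energies would be bounded below
    by the energy of the soliton or by a number close to 0. *)

Require Import Defs.
From mathcomp Require Import all_boot all_order all_algebra.
From mathcomp Require Import all_classical all_reals all_analysis.
From mathcomp Require Import measurable_realfun zify ring lra.
Import Order.TTheory GRing.Theory Num.Theory.
Import numFieldNormedType.Exports.
Set Implicit Arguments.
Unset Strict Implicit.
Unset Printing Implicit Defensive.
Local Open Scope ring_scope.
Local Open Scope classical_set_scope.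

Local Notation leb := (@lebesgue_measure _).
Local Notation "D .-int f" := (leb.-integrable D (EFin \o f)) (at level 2, format "D .-int  f").

(** * Integrals and primitives *)

Section integrals.
Context {R : realType}.
Implicit Types (D A B : set R) (f g u v w z : R -> R) (a b c x y r e : R).

(** The calibration takes the place of rearrangement and of the Euler-Lagrange equation. For a
    profile [w] of maximum 1, [slope w] is the square root of w^2 - |w|^p, the first integral of the
    soliton equation, so the soliton is the profile whose two squares are equal. The two terms of
    [lower mu N] grow like N^((p + 2) / 2) and N^(p - 2), and p < 6 says that the first exponent is
    the larger: this gives both coercivity and the minimum. On the graph a maximum inside the
    pendant guarantees only one passage to 0, too weak for a comparison with the soliton but enough
    for a bound from below.

    The obstacle to existence is mass escaping along the half-lines, which takes the limit out of
    the constraint set. Adding k times the mass removes the constraint: the sum tends to 0 along a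
    minimizing sequence, and a limit of smaller positive mass could be improved by a factor s > 1,
    since the potential grows like s^p and the kinetic term like s^2. One ultrafilter yields all
    limits at once, of values and of integrals and on all edges, without diagonal subsequences. *)

Lemma integrable_itv_sub f a b c d : a <= c -> d <= b ->
  (`[a, b]).-int f -> (`[c, d]).-int f.
Proof.
move=> ac db; apply: integrableS => //; apply: subset_itv; by rewrite bnd_simp.
Qed.

Lemma Rintegral_itv_cat f a b c : a <= b -> b <= c -> (`[a, c]).-int f ->
  \int[leb]_(t in `[a, c]) f t =
  \int[leb]_(t in `[a, b]) f t + \int[leb]_(t in `[b, c]) f t.
Proof.
move=> ab bc fi.
rewrite -(Rintegral_itv_obnd_cbnd (r := b)); last first.
  apply: integrableS fi => //; apply: subset_itv; by rewrite bnd_simp.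
rewrite -(Rintegral_itvB (a := BLeft a) (b := BRight c) fi) ?bnd_simp//.
by rewrite addrC subrK.
Qed.

Lemma Rintegral_itv_cst a b c : a <= b ->
  \int[leb]_(t in `[a, b]) c = c * (b - a).
Proof.
move=> ab; rewrite Rintegral_cst//= lebesgue_measure_itv/= lte_fin.
by case: ltP => // ba; rewrite (_ : b - a = 0)//; apply/eqP; rewrite subr_eq0 eq_le ab ba.
Qed.

Lemma integrable_cst_itv a b c : (`[a, b]).-int (cst c).
Proof.
apply: continuous_compact_integrable; first exact: segment_compact.
by apply: continuous_subspaceT => x; exact: cvg_cst.
Qed.

Lemma le_Rint_norm D f c g : measurable D -> D.-int f -> D.-int g ->
  (forall x, D x -> `|f x| <= c * g x) ->
  `|\int[leb]_(t in D) f t| <= c * \int[leb]_(t in D) g t.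
Proof.
move=> mD fi gi fg; rewrite -RintegralZl//.
apply: le_trans (le_normr_Rintegral _ _) _ => //.
apply: le_Rintegral => //; first exact: integrable_norm.
exact: (integrableZl _ c gi).
Qed.

(* The set of b for which the estimate holds on [a, b] is closed and open. *)
Lemma eq_increment_Rintegral (G f g : R -> R) a b : a <= b ->
  (`[a, b]).-int f -> (`[a, b]).-int g ->
  (forall e t, 0 < e -> a <= t <= b -> exists2 d : R, 0 < d &
    forall x y, a <= x -> x <= y -> y <= b -> x = t \/ y = t -> y - x < d ->
    `|G y - G x - \int[leb]_(r in `[x, y]) f r|
      <= e * \int[leb]_(r in `[x, y]) g r) ->
  G b - G a = \int[leb]_(r in `[a, b]) f r.
Proof.
move=> ab fi gi loc.
(* With a fixed factor [e] the estimate is additive over adjacent intervals, so it can be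
   propagated; [e] tends to 0 only at the end. *)
suff H e : 0 < e -> `|G b - G a - \int[leb]_(r in `[a, b]) f r|
      <= e * \int[leb]_(r in `[a, b]) g r.
  apply/eqP; rewrite -subr_eq0 -normr_le0.
  set I := \int[leb]_(r in `[a, b]) g r in H *.
  apply/ler_addgt0Pl => e e0; rewrite addr0.
  have I0 : 0 <= `|I| by [].
  have e1 : 0 < e / (`|I| + 1) by rewrite divr_gt0// ltr_wpDl.
  apply: le_trans (H _ e1) _.
  rewrite -mulrA ler_piMr//; first exact: ltW.
  rewrite mulrC ler_pdivrMr ?mul1r; last by rewrite ltr_wpDl.
  by apply: le_trans (ler_norm _) _; rewrite lerDl.
move=> e0.
pose P x y := `|G y - G x - \int[leb]_(r in `[x, y]) f r|
      <= e * \int[leb]_(r in `[x, y]) g r.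
have Pcat x y (z : R) : a <= x -> x <= y -> y <= z -> z <= b -> P x y -> P y z -> P x z.
  move=> ax xy yz zb Pxy Pyz; rewrite /P.
  rewrite (@Rintegral_itv_cat f x y z)//; last exact: integrable_itv_sub fi.
  rewrite (@Rintegral_itv_cat g x y z)//; last exact: integrable_itv_sub gi.
  rewrite mulrDr; apply: le_trans (lerD Pxy Pyz).
  apply: le_trans (ler_normD _ _); rewrite le_eqVlt; apply/orP; left; apply/eqP.
  by congr (`| _ |); ring.
have Paa : P a a.
  by rewrite /P set_itv1 !Rintegral_set1 !subrr normr0 mulr0.
pose S := [set x | a <= x <= b /\ P a x].
have Sa : S a by split=> //; rewrite lexx.
have supS : has_sup S.
  by split; [exists a | exists b => x [] /andP[]].
(* Intervals ending at [s] show that [s] itself satisfies the estimate, and intervals starting at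
   [s] would carry it further; this is why the hypothesis allows [t] as either endpoint. *)
set s := sup S.
have as_ : a <= s by apply: ub_le_sup => //; exact: supS.2.
have sb : s <= b by apply: sup_le_ub; [exists a | move=> x [] /andP[]].
have [d d0 Hd] := loc e s e0 (introT andP (conj as_ sb)).
have Ps : P a s.
  have [x Sx xs] := sup_adherent d0 supS.
  have xles : x <= s by apply: ub_le_sup => //; exact: supS.2.
  case: Sx => /andP[ax xb] Pax.
  apply: (Pcat _ x) => //; apply: Hd => //; first by right.
  by rewrite ltrBlDr -ltrBlDl.
have [bs|sltb] := leP b s.
  by have <- : s = b by apply/eqP; rewrite eq_le sb.
pose y := Num.min b (s + d / 2).
have sy : s < y by rewrite lt_min sltb ltrDl divr_gt0.
have yb : y <= b by rewrite ge_min lexx.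
have Py : P a y.
  apply: (Pcat _ s) => //; first exact: ltW.
  apply: Hd => //; [exact: ltW|by left|].
  rewrite ltrBlDl; apply: (@le_lt_trans _ _ (s + d / 2)).
    by rewrite ge_min lexx orbT.
  by rewrite ltrD2l ltr_pdivrMr// ltr_pMr// ltr1n.
have : y <= s.
  apply: ub_le_sup; first exact: supS.2.
  by split => //; rewrite yb (le_trans as_ (ltW sy)).
by rewrite leNgt sy.
Qed.

(** Continuity relative to [D], by [econtP], with explicit moduli that can be halved and
    combined. *)
Definition econt D f := forall t, D t -> forall e, 0 < e ->
  exists2 d : R, 0 < d & forall y, D y -> `|y - t| < d -> `|f y - f t| <= e.

Lemma econtP D f : {within D, continuous f} <-> econt D f.
Proof.
rewrite subspace_continuousP; split.
  move=> cf t Dt e e0.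
  have /cvgrPdist_le/(_ e e0) := cf t Dt.
  rewrite near_withinE => -[d /= d0 Hd].
  exists d => // y Dy yt; rewrite distrC; apply: Hd => //=.
  by rewrite distrC.
move=> ef t Dt; apply/cvgrPdist_le => e e0.
have [d d0 Hd] := ef t Dt e e0.
rewrite near_withinE; exists d => //= y yt Dy; rewrite distrC; apply: Hd => //.
by rewrite distrC.
Qed.

Lemma econtS D A f : A `<=` D -> econt D f -> econt A f.
Proof.
move=> AD ef t /AD Dt e e0; have [d d0 Hd] := ef t Dt e e0.
by exists d => // y /AD; exact: Hd.
Qed.

Lemma econt_integrable a b f : econt `[a, b] f -> (`[a, b]).-int f.
Proof.
move=> /econtP cf; apply: continuous_compact_integrable => //.
exact: segment_compact.
Qed.

Lemma econt_measurable D f : is_interval D -> econt D f -> measurable_fun D f.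
Proof.
move=> iD /econtP cf; apply: subspace_continuous_measurable_fun => //.
exact: is_interval_measurable.
Qed.

(** Absolute continuity in integrated form. As [v] is merely integrable on compact intervals, the
    product and chain rules are derived from [eq_increment_Rintegral] instead of pointwise
    derivatives. *)
Definition primitive_on D u v :=
  forall a b, D a -> D b -> a <= b ->
  (`[a, b]).-int v /\ u b - u a = \int[leb]_(t in `[a, b]) v t.

Lemma primitive_onS D A u v : A `<=` D -> primitive_on D u v -> primitive_on A u v.
Proof. by move=> AD pr a b /AD Da /AD Db; exact: pr. Qed.

Lemma primitive_on_itv_econt a b u v : primitive_on `[a, b] u v -> econt `[a, b] u.
Proof.
move=> pr; have [ba|ab] := ltP b a.
  by rewrite set_itv_ge ?bnd_simp -?ltNge// => t.
have Ha : `[a, b] a by rewrite /= in_itv /= lexx.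
have Hb : `[a, b] b by rewrite /= in_itv /= lexx ab.
have [vi _] := pr a b Ha Hb ab.
have /econtP ci := parameterized_integral_continuous ab vi.
move=> t Dt e e0; have [d d0 Hd] := ci t Dt e e0.
exists d => // y Dy yt; have := Hd y Dy yt.
have [/andP[at_ tb] /andP[ay yb]] : a <= t <= b /\ a <= y <= b.
  by move: Dt Dy; rewrite /= !in_itv.
rewrite /parameterized_integral -(pr a y _ _ _).2// -(pr a t _ _ _).2//.
by rewrite opprB addrA subrK.
Qed.

Lemma is_interval_sub_itv D a b : is_interval D -> D a -> D b -> `[a, b] `<=` D.
Proof. by move=> iD Da Db x /=; rewrite in_itv/= => /(iD _ _ Da Db). Qed.

Lemma intD D f g : measurable D -> D.-int f -> D.-int g -> D.-int (fun x => f x + g x).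
Proof. by move=> mD fi gi; exact: (@integrableD _ _ _ leb D mD (EFin \o f) (EFin \o g) fi gi). Qed.

Lemma intB D f g : measurable D -> D.-int f -> D.-int g -> D.-int (fun x => f x - g x).
Proof. by move=> mD fi gi; exact: (@integrableB _ _ _ leb D mD (EFin \o f) (EFin \o g) fi gi). Qed.

Lemma intZ D f c : measurable D -> D.-int f -> D.-int (fun x => c * f x).
Proof. by move=> mD fi; exact: (@integrableZl _ _ _ leb D mD c (EFin \o f) fi). Qed.

Lemma int_norm D f : measurable D -> D.-int f -> D.-int (fun x => `|f x|).
Proof. by move=> mD fi; exact: (integrable_norm fi). Qed.

Lemma int_le D f g : measurable D -> measurable_fun D f ->
  (forall x, D x -> `|f x| <= g x) -> D.-int g -> D.-int f.
Proof.
move=> mD mf fg; apply: le_integrable => //; first exact/measurable_EFinP.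
by move=> x Dx; rewrite /= lee_fin (le_trans (fg _ Dx))// ler_norm.
Qed.

Lemma int_measurable D f : D.-int f -> measurable_fun D f.
Proof. by move=> /integrableP[/measurable_EFinP]. Qed.

Lemma econt_bounded a b u : econt `[a, b] u ->
  exists2 K, 0 <= K & forall x, `[a, b] x -> `|u x| <= K.
Proof.
have [ba|ab] := ltP b a.
  by rewrite set_itv_ge ?bnd_simp -?ltNge// => _; exists 0.
move=> /econtP cu.
have [c cab Hc] := EVT_max ab cu; have [d dab Hd] := EVT_min ab cu.
exists (`|u c| + `|u d|) => [|x xab]; first by rewrite addr_ge0.
have := Hc x xab; have := Hd x xab; rewrite ler_norml => dx xc.
have := ler_norm (u c); have := ler_norm (- u d).
have := normr_ge0 (u c); have := normr_ge0 (u d).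
by rewrite normrN; lra.
Qed.

Lemma int_econtM a b u z : econt `[a, b] u -> (`[a, b]).-int z ->
  (`[a, b]).-int (fun x => u x * z x).
Proof.
move=> cu zi; have [K K0 uK] := econt_bounded cu.
apply: (@int_le _ _ (fun x => K * `|z x|)) => //.
- apply: measurable_funM; last exact: int_measurable.
  by apply: econt_measurable => //; exact: interval_is_interval.
- by move=> x /uK ux; rewrite normrM ler_wpM2r.
- by apply: intZ => //; exact: int_norm.
Qed.

(** The increment of the product over [x, y] is [u y * (w y - w x) + w x * (u y - u x)]; as an
    integral, its integrand differs from [u * z + w * v] by at most the oscillation of [u] and [w]
    times [|z| + |v|]. *)
Lemma primitive_onM D u v w z : is_interval D ->
  primitive_on D u v -> primitive_on D w z ->
  primitive_on D (fun t => u t * w t) (fun t => u t * z t + w t * v t).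
Proof.
move=> iD pu pw a b Da Db ab.
have sD := is_interval_sub_itv iD Da Db.
have [vi _] := pu a b Da Db ab; have [zi _] := pw a b Da Db ab.
have cu := primitive_on_itv_econt (primitive_onS sD pu).
have cw := primitive_on_itv_econt (primitive_onS sD pw).
have uzi := int_econtM cu zi; have wvi := int_econtM cw vi.
split; first exact: intD.
have gi : (`[a, b]).-int (fun r => `|z r| + `|v r|).
  by apply: intD => //; exact: int_norm.
apply: (@eq_increment_Rintegral (fun t => u t * w t) _ _ _ _ ab _ gi).
  exact: intD.
move=> e t e0 tab; have e2 : 0 < e / 2 by rewrite divr_gt0.
have [d1 d10 H1] := cu t tab _ e2; have [d2 d20 H2] := cw t tab _ e2.
exists (Num.min d1 d2); first by rewrite lt_min d10.
move=> x y ax xy yb xyt; rewrite lt_min => /andP[xyd1 xyd2].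
have sxy : `[x, y] `<=` `[a, b] by apply: subset_itv; rewrite bnd_simp.
have xi f : (`[a, b]).-int f -> (`[x, y]).-int f by exact: integrable_itv_sub.
have Dx : D x by apply: sD; rewrite /= in_itv/= ax (le_trans xy yb).
have Dy : D y by apply: sD; rewrite /= in_itv/= yb (le_trans ax xy).
have near r d : `[x, y] r -> y - x < d -> `|r - t| < d.
  rewrite /= in_itv/= => /andP[xr ry] yxd; rewrite ltr_norml.
  by case: xyt => <-; apply/andP; split; lra.
have Hr r s : `[x, y] r -> `[x, y] s -> `|u s - u r| <= e /\ `|w s - w r| <= e.
  move=> xyr xys.
  have := H1 r (sxy _ xyr) (near _ _ xyr xyd1); rewrite ler_norml => /andP[? ?].
  have := H2 r (sxy _ xyr) (near _ _ xyr xyd2); rewrite ler_norml => /andP[? ?].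
  have := H1 s (sxy _ xys) (near _ _ xys xyd1); rewrite ler_norml => /andP[? ?].
  have := H2 s (sxy _ xys) (near _ _ xys xyd2); rewrite ler_norml => /andP[? ?].
  by split; rewrite ler_norml; apply/andP; split; lra.
have -> : u y * w y - u x * w x = u y * (w y - w x) + w x * (u y - u x) by ring.
rewrite (pu x y Dx Dy xy).2 (pw x y Dx Dy xy).2.
have xz := xi _ zi; have xv := xi _ vi.
have xuz := xi _ uzi; have xwv := xi _ wvi.
have mxy : measurable `[x, y] by [].
have sz := intZ (u y) mxy xz.
have sv := intZ (w x) mxy xv.
rewrite -(RintegralZl (u y) _ xz)// -(RintegralZl (w x) _ xv)//.
rewrite -(RintegralD _ sz sv)// -RintegralB//; [|exact: intD|exact: intD].
apply: le_Rint_norm => //.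
- by apply: intB => //; exact: intD.
- exact: xi.
move=> r xyr.
have -> : u y * z r + w x * v r - (u r * z r + w r * v r)
   = (u y - u r) * z r + (w x - w r) * v r by ring.
have xyy : `[x, y] y by rewrite /= in_itv/= lexx xy.
have xyx : `[x, y] x by rewrite /= in_itv/= lexx xy.
apply: le_trans (ler_normD _ _) _; rewrite mulrDr !normrM.
by apply: lerD; apply: ler_wpM2r => //; have [] := Hr r y xyr xyy; have [] := Hr r x xyr xyx.
Qed.

(** Used with [F = action] to integrate along an edge, and with an affine [u] as a change of
    variables. *)
Lemma primitive_on_comp D F h u v : is_interval D ->
  primitive_on setT F h -> econt setT h -> primitive_on D u v ->
  primitive_on D (F \o u) (fun t => h (u t) * v t).
Proof.
move=> iD pF ch pu a b Da Db ab.
have sD := is_interval_sub_itv iD Da Db.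
have [vi _] := pu a b Da Db ab.
have cu := primitive_on_itv_econt (primitive_onS sD pu).
have chu : econt `[a, b] (h \o u).
  move=> t tab e e0; have [d d0 H] := ch (u t) I e e0.
  have d2 : 0 < d / 2 by rewrite divr_gt0.
  have [d' d'0 H'] := cu t tab _ d2; exists d' => // y yab yt /=.
  by apply: H => //; apply: le_lt_trans (H' _ yab yt) _; lra.
have hvi := int_econtM chu vi.
split => //.
have gi : (`[a, b]).-int (fun r => `|v r|) by exact: int_norm.
apply: (@eq_increment_Rintegral (F \o u) _ _ _ _ ab hvi gi).
move=> e t e0 tab; have e4 : 0 < e / 4 by rewrite divr_gt0.
have [d0 d00 H0] := ch (u t) I _ e4.
have d04 : 0 < d0 / 4 by rewrite divr_gt0.
have [d d_gt0 H1] := cu t tab _ d04.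
exists d => // x y ax xy yb xyt xyd.
have sxy : `[x, y] `<=` `[a, b] by apply: subset_itv; rewrite bnd_simp.
have xi f : (`[a, b]).-int f -> (`[x, y]).-int f by exact: integrable_itv_sub.
have Dx : D x by apply: sD; rewrite /= in_itv/= ax (le_trans xy yb).
have Dy : D y by apply: sD; rewrite /= in_itv/= yb (le_trans ax xy).
have near r : `[x, y] r -> `|r - t| < d.
  rewrite /= in_itv/= => /andP[xr ry]; rewrite ltr_norml.
  by case: xyt => <-; apply/andP; split; lra.
have xyy : `[x, y] y by rewrite /= in_itv/= lexx xy.
have xyx : `[x, y] x by rewrite /= in_itv/= lexx xy.
have nu r : `[x, y] r -> `|u r - u t| <= d0 / 4.
  by move=> xyr; exact: H1 (sxy _ xyr) (near _ xyr).
(* Both primitives are compared with their linearisation at u t. *)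
have HF : `|F (u y) - F (u x) - h (u t) * (u y - u x)| <= e / 4 * `|u y - u x|.
  have main (p q : R) : p <= q -> `|p - u t| <= d0 / 4 -> `|q - u t| <= d0 / 4 ->
      `|F q - F p - h (u t) * (q - p)| <= e / 4 * (q - p).
    move=> pq /[1!ler_norml]/andP[? ?] /[1!ler_norml]/andP[? ?].
    have [hi ->] := pF p q I I pq.
    rewrite -(Rintegral_itv_cst (h (u t)) pq) -RintegralB//; last exact: integrable_cst_itv.
    rewrite -[X in _ <= _ * X]mul1r -(Rintegral_itv_cst 1 pq).
    apply: (@le_Rint_norm `[p, q] (fun r => h r - h (u t)) (e / 4) (fun=> 1)) => //.
    - by apply: intB => //; exact: integrable_cst_itv.
    - exact: integrable_cst_itv.
    - move=> r /=; rewrite in_itv /= => /andP[? ?]; rewrite mulr1.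
      apply: H0 => //; rewrite ltr_norml; apply/andP; split; lra.
  have [uxy|/ltW uyx] := leP (u x) (u y).
    by rewrite [in leRHS]ger0_norm ?subr_ge0// main// nu.
  rewrite [in leRHS]ler0_norm ?subr_le0// opprB -normrN.
  have -> : - (F (u y) - F (u x) - h (u t) * (u y - u x)) =
    F (u x) - F (u y) - h (u t) * (u x - u y) by ring.
  by rewrite main// nu.
have [vi' Ev] := pu x y Dx Dy xy.
have Iabs : `|u y - u x| <= \int[leb]_(r in `[x, y]) `|v r|.
  by rewrite Ev; exact: le_normr_Rintegral.
have -> : (F \o u) y - (F \o u) x - \int[leb]_(r in `[x, y]) (h (u r) * v r) =
  (F (u y) - F (u x) - h (u t) * (u y - u x)) +
  \int[leb]_(r in `[x, y]) (h (u t) * v r - h (u r) * v r).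
  rewrite RintegralB//; [|by apply: intZ|exact: xi].
  by rewrite RintegralZl// -Ev /=; ring.
apply: le_trans (ler_normD _ _) _.
have H2 : `|\int[leb]_(r in `[x, y]) (h (u t) * v r - h (u r) * v r)| <=
   e / 4 * \int[leb]_(r in `[x, y]) `|v r|.
  apply: le_Rint_norm => //.
  - by apply: intB => //; [exact: intZ|exact: xi].
  - exact: xi.
  - move=> r xyr; rewrite -mulrBl normrM ler_wpM2r// distrC H0//.
    by apply: le_lt_trans (nu _ xyr) _; lra.
have I0 : 0 <= \int[leb]_(r in `[x, y]) `|v r| by exact: Rintegral_ge0.
apply: le_trans (lerD HF H2) _.
apply: (@le_trans _ _ ((e / 4 + e / 4) * \int[leb]_(r in `[x, y]) `|v r|)).
  by rewrite mulrDl lerD2r ler_wpM2l// ltW.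
by rewrite ler_wpM2r//; lra.
Qed.

End integrals.

(** * Test functions and integration by parts *)

Section test_functions.
Context {R : realType}.
Implicit Types (D A B : set R) (f g u v w z : R -> R) (a b c x y r e : R).

Lemma continuous_econt D f : continuous f -> econt D f.
Proof. by move=> cf; apply/econtP; exact: continuous_subspaceT. Qed.

Lemma int_sq_itv a b f : measurable_fun `[a, b] f ->
  (`[a, b]).-int (fun x => f x ^+ 2) -> (`[a, b]).-int f.
Proof.
move=> mf fi; apply: (@int_le _ _ _ (fun x => f x ^+ 2 + 1)) => //.
- by move=> x _; rewrite -(real_normK (num_real (f x))); have := normr_ge0 (f x); have := sqr_ge0 (`|f x| - 1); nra.
- by apply: intD => //; exact: integrable_cst_itv.
Qed.

Lemma Rint_support A D f : A `<=` D -> (forall x, D x -> ~ A x -> f x = 0) ->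
  \int[leb]_(x in D) f x = \int[leb]_(x in A) f x.
Proof.
move=> AD f0; rewrite Rintegral_mkcond [RHS]Rintegral_mkcond; congr Rintegral.
apply/funext => x; rewrite !patchE.
case: ifPn => [/set_mem Dx|/negP nDx]; case: ifPn => [/set_mem Ax|/negP nAx] //.
- by apply: f0 => // Ax; apply: nAx; apply/mem_set.
- by exfalso; apply: nDx; apply/mem_set; exact: AD.
Qed.

Lemma primitive_on_is_derive f g : (forall x, is_derive x 1 f (g x)) ->
  continuous g -> primitive_on setT f g.
Proof.
move=> df cg a b _ _ ab; split.
  by apply: econt_integrable; exact: continuous_econt.
move: ab; rewrite le_eqVlt => /predU1P[->|ab].
  by rewrite set_itv1 Rintegral_set1 subrr.
have cf x : {for x, continuous f}.
  by apply: differentiable_continuous; apply/derivable1_diffP; have [] := df x.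
rewrite /Rintegral (@continuous_FTC2 _ g f)//.
- exact: continuous_subspaceT.
- split; [by move=> x _; have [] := df x|apply: cvg_at_right_filter; exact: cf|apply: cvg_at_left_filter; exact: cf].
- by move=> x _; rewrite derive1E; have [] := df x.
Qed.

(** One estimate handles both affine maps, with [K = 0], and [pos t ^+ 2], whose second derivative
    jumps. *)
Lemma is_derive_quadratic_error f c K x :
  (forall t, `|f (x + t) - f x - c * t| <= K * t ^+ 2) -> is_derive x 1 f c.
Proof.
move=> H.
have cvgq : h^-1 *: ((f \o shift x) (h *: 1) - f x) @[h --> 0^'] --> c.
  apply/cvgrPdist_le => e e0; near=> h.
  have h0 : h != 0 by near: h; exact: nbhs_dnbhs_neq.
  have He : `|h| * (`|K| + 1) <= e.
    rewrite -ler_pdivlMr ?ltr_wpDl//; near: h.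
    apply: dnbhs0_le; by rewrite divr_gt0// ltr_wpDl.
  rewrite /= /GRing.scale /= mulr1 (addrC h).
  have -> : c - h^-1 * (f (x + h) - f x) = - h^-1 * (f (x + h) - f x - c * h).
    by field.
  rewrite normrM normrN normfV ler_pdivrMl ?normr_gt0//.
  apply: le_trans (H h) _; apply: le_trans (_ : `|h| * (`|h| * (`|K| + 1)) <= _).
    rewrite mulrA -expr2 real_normK ?num_real// mulrC ler_wpM2l ?sqr_ge0//.
    by apply: le_trans (ler_norm _) _; rewrite lerDl.
  by rewrite ler_wpM2l.
split; first by apply/cvg_ex; exists c.
exact: cvg_lim.
Unshelve. all: by end_near. Qed.

Definition pos (t : R) := Num.max 0 t.

Lemma is_derive_pos2 x : is_derive x 1 (fun t => pos t ^+ 2) (2 * pos x).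
Proof.
apply: (@is_derive_quadratic_error _ _ 1) => t; rewrite /pos.
rewrite ler_norml; case: (leP 0 x) => x0; case: (leP 0 (x + t)) => xt0;
  by apply/andP; split; nra.
Qed.

Lemma continuous_pos : continuous pos.
Proof. by move=> x; apply: (@continuous_max _ _ (cst 0) id) => //; exact: cvg_cst. Qed.

(** A piecewise quadratic step from 0 to 1 over [0, 1], regular enough because test functions are
    only C^1; its derivative is the hat function [tent], of height 2. *)
Definition smoothstep (t : R) :=
  2 * pos t ^+ 2 - 4 * pos (t - 2^-1) ^+ 2 + 2 * pos (t - 1) ^+ 2.

Definition tent (t : R) := 4 * pos t - 8 * pos (t - 2^-1) + 4 * pos (t - 1).

Lemma smoothstep0 t : t <= 0 -> smoothstep t = 0.
Proof.
move=> t0; rewrite /smoothstep /pos.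
have -> : Num.max 0 t = 0 by apply/max_idPl.
have -> : Num.max 0 (t - 2^-1) = 0 by apply/max_idPl; lra.
have -> : Num.max 0 (t - 1) = 0 by apply/max_idPl; lra.
by ring.
Qed.

Lemma smoothstep1 t : 1 <= t -> smoothstep t = 1.
Proof.
move=> t1; rewrite /smoothstep /pos.
have -> : Num.max 0 t = t by apply/max_idPr; lra.
have -> : Num.max 0 (t - 2^-1) = t - 2^-1 by apply/max_idPr; lra.
have -> : Num.max 0 (t - 1) = t - 1 by apply/max_idPr; lra.
by field.
Qed.

Lemma tent_out t : ~ 0 <= t <= 1 -> tent t = 0.
Proof.
move=> /negP; rewrite negb_and -!ltNge /tent /pos => /orP[t0|t1].
- have -> : Num.max 0 t = 0 by apply/max_idPl; lra.
  have -> : Num.max 0 (t - 2^-1) = 0 by apply/max_idPl; lra.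
  have -> : Num.max 0 (t - 1) = 0 by apply/max_idPl; lra.
  by ring.
- have -> : Num.max 0 t = t by apply/max_idPr; lra.
  have -> : Num.max 0 (t - 2^-1) = t - 2^-1 by apply/max_idPr; lra.
  have -> : Num.max 0 (t - 1) = t - 1 by apply/max_idPr; lra.
  by field.
Qed.

Lemma tent_ge0 t : 0 <= tent t.
Proof. rewrite /tent /pos; case: (leP 0 t) => ?; case: (leP 0 (t - 2^-1)) => ?;
by case: (leP 0 (t - 1)) => ?; lra. Qed.

Lemma is_derive_smoothstep (c d : R) x : d != 0 ->
  is_derive x 1 (fun t => smoothstep ((t - c) / d)) (tent ((x - c) / d) / d).
Proof.
move=> d0.
have dlin k : is_derive x 1 (fun t : R => (t - c) / d - k) d^-1.
  apply: (@is_derive_quadratic_error _ _ 0) => t; rewrite mul0r.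
  by rewrite (_ : _ - _ = 0) ?normr0//; field.
have dp k : is_derive x 1 (fun t => pos ((t - c) / d - k) ^+ 2) (d^-1 * (2 * pos ((x - c) / d - k))).
  rewrite -[X in is_derive _ _ _ X]mulrC.
  exact: (@is_derive1_comp _ (fun t => pos t ^+ 2) (fun t => (t - c) / d - k) x _ _ (is_derive_pos2 _) (dlin k)).
rewrite /smoothstep.
have dp0 := dp 0; rewrite subr0 in dp0.
have -> : (fun t => 2 * pos ((t - c) / d) ^+ 2 - 4 * pos ((t - c) / d - 2^-1) ^+ 2 +
   2 * pos ((t - c) / d - 1) ^+ 2) =
   (fun t => 2 * pos ((t - c) / d - 0) ^+ 2 - 4 * pos ((t - c) / d - 2^-1) ^+ 2 +
   2 * pos ((t - c) / d - 1) ^+ 2) by apply/funext => t; rewrite subr0.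
apply: is_derive_eq.
rewrite /tent /GRing.scale/=; ring.
Qed.

Lemma primitive_on_weak D u v (psi : R -> R) : is_interval D ->
  primitive_on D u v -> test_function D psi ->
  \int[leb]_(x in D) (u x * derive1 psi x) = - \int[leb]_(x in D) (v x * psi x).
Proof.
move=> iD pu [dpsi cpsi [K [cK KD K0]]].
have ppsi : primitive_on setT psi (derive1 psi).
  apply: primitive_on_is_derive => // x.
  by rewrite derive1E; exact/derivableP.
have clK : closed K by exact: (compact_closed (@Rhausdorff R)).
have dK0 x : ~ K x -> derive1 psi x = 0.
  move=> nKx; rewrite derive1E.
  have : \forall y \near x, psi y = cst 0 y.
    have : nbhs x (~` K) by apply: open_nbhs_nbhs; split => //; rewrite openC.
    by apply: filterS => y; exact: K0.
  by move=> /near_eq_derive ->; rewrite derive_cst.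
have [K00|/set0P K_neq0] := eqVneq K set0.
  rewrite (@eq_Rintegral _ _ _ leb D (cst 0)) => [|x _]; last by rewrite dK0 ?mulr0// K00.
  rewrite [in RHS](@eq_Rintegral _ _ _ leb D (cst 0)) => [|x _]; last by rewrite K0 ?mulr0// K00.
  by rewrite /Rintegral integral0 oppr0.
have cid : {within K, continuous (@id R)} by apply: continuous_subspaceT => x; exact: cvg_id.
have [m /set_mem Km Hm] := compact_EVT_min K_neq0 cK cid.
have [M /set_mem KM HM] := compact_EVT_max K_neq0 cK cid.
(* The support [K] lies in the interior of [D], so its extremes can be passed while staying in [D];
   [psi] then vanishes at both ends of [[a, b]] and the boundary terms disappear. *)
have [a am Da] : exists2 a, a < m & D a.
  have /nbhs_ballP[e /= e0 eD] := KD _ Km.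
  exists (m - e / 2); first by rewrite ltrBlDr ltrDl divr_gt0.
  by apply: eD; rewrite /ball/= opprB addrC subrK gtr0_norm ?divr_gt0// gtr_pMr// invf_lt1// ltr1n.
have [b bM Db] : exists2 b, M < b & D b.
  have /nbhs_ballP[e /= e0 eD] := KD _ KM.
  exists (M + e / 2); first by rewrite ltrDl divr_gt0.
  by apply: eD; rewrite /ball/= opprD addNKr normrN gtr0_norm ?divr_gt0// gtr_pMr// invf_lt1// ltr1n.
have sD := is_interval_sub_itv iD Da Db.
have Kab x : ~ `[a, b] x -> ~ K x.
  move=> nab Kx; apply: nab; rewrite /= in_itv/= (ltW (lt_le_trans am _)) ?(ltW (le_lt_trans _ bM))//.
  - exact: HM (mem_set Kx).
  - exact: Hm (mem_set Kx).
have psia : psi a = 0.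
  by apply: K0 => /mem_set/Hm; rewrite leNgt am.
have psib : psi b = 0.
  by apply: K0 => /mem_set/HM; rewrite leNgt bM.
have ab : a <= b by apply: ltW (lt_trans am (le_lt_trans _ bM)); exact: Hm (mem_set KM).
rewrite (Rint_support sD) => [|x _ /Kab/dK0 ->]; last by rewrite mulr0.
rewrite (Rint_support sD) => [|x _ /Kab/K0 ->]; last by rewrite mulr0.
have iab : is_interval `[a, b] by exact: interval_is_interval.
have pu' := primitive_onS sD pu.
have pp' := primitive_onS (@subsetT _ `[a, b]) ppsi.
have Ia : `[a, b] a by rewrite /= in_itv/= lexx.
have Ib : `[a, b] b by rewrite /= in_itv/= lexx andbT.
have [_] := primitive_onM iab pu' pp' Ia Ib ab.
have cu := primitive_on_itv_econt pu'.
have cp := primitive_on_itv_econt pp'.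
have [vi _] := pu' _ _ Ia Ib ab.
have [pi _] := pp' _ _ Ia Ib ab.
rewrite psia psib !mulr0 subrr RintegralD//; [|exact: int_econtM|exact: int_econtM].
move=> /esym/eqP; rewrite addr_eq0 => /eqP ->.
by congr (- _); apply: eq_Rintegral => x _; rewrite mulrC.
Qed.

(* Testing against the difference of two narrow bumps placed near a and b. *)
Lemma weakly_constant a b z : a < b -> econt `[a, b] z ->
  (forall psi, test_function `[a, b] psi ->
     \int[leb]_(x in `[a, b]) (z x * derive1 psi x) = 0) -> z a = z b.
Proof.
move=> ab cz0 weak0.
(* The other inequality is this one applied to [- z]. *)
suff main w : econt `[a, b] w -> (forall psi, test_function `[a, b] psi ->
     \int[leb]_(x in `[a, b]) (w x * derive1 psi x) = 0) -> w b <= w a.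
  apply/eqP; rewrite eq_le main// andbT -lerN2.
  apply: (main (fun x => - z x)).
  - move=> t tab e e0; have [d d0 H] := cz0 t tab e e0.
    by exists d => // y yab yt; rewrite -opprD normrN; exact: H.
  - move=> psi tpsi; have := weak0 psi tpsi => W.
    have [dpsi cpsi _] := tpsi.
    rewrite (@eq_Rintegral _ _ _ leb _ (fun x => -1 * (z x * derive1 psi x))); last first.
      by move=> x _; ring.
    rewrite RintegralZl ?W ?mulr0//; apply: int_econtM => //.
    by apply: econt_integrable; exact: continuous_econt.
move=> {z cz0 weak0} cz weak0; rename w into z.
rewrite leNgt; apply/negP => zab.
have Ia : `[a, b] a by rewrite /= in_itv/= lexx ltW.
have Ib : `[a, b] b by rewrite /= in_itv/= lexx andbT ltW.
pose c := (z a + z b) / 2; pose n := (z b - z a) / 4.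
have n0 : 0 < n by rewrite divr_gt0// subr_gt0.
have [d1 d10 H1] := cz a Ia n n0.
have [d2 d20 H2] := cz b Ib n n0.
(* The two bumps of [psi'] live on [a + d, a + 2d] and [b - 2d, b - d]. They are disjoint as 5d <= b
   - a, and lie within 3d of the endpoints, where [z] differs from its end values by at most [n], a
   quarter of the jump, hence stays at distance at least [n] from the mid-value [c]. *)
pose d := Num.min (Num.min d1 d2 / 3) ((b - a) / 5).
have d0 : 0 < d by rewrite lt_min !divr_gt0 ?lt_min ?d10 ?subr_gt0.
have dd : d <= Num.min d1 d2 / 3 by rewrite ge_min lexx.
have dab : d <= (b - a) / 5 by rewrite ge_min lexx orbT.
have dd1 : 3 * d <= d1.
  have : Num.min d1 d2 <= d1 by rewrite ge_min lexx.
  by lra.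
have dd2 : 3 * d <= d2.
  have : Num.min d1 d2 <= d2 by rewrite ge_min lexx orbT.
  by lra.
have dn0 : d != 0 by rewrite gt_eqF.
pose psi t := smoothstep ((t - (a + d)) / d) - smoothstep ((t - (b - 2 * d)) / d).
pose psi' t := tent ((t - (a + d)) / d) / d - tent ((t - (b - 2 * d)) / d) / d.
have ipsi x : is_derive x 1 psi (psi' x).
  have i1 := is_derive_smoothstep (a + d) x dn0.
  have i2 := is_derive_smoothstep (b - 2 * d) x dn0.
  exact: is_deriveB.
have dpsiE : derive1 psi = psi'.
  by apply/funext => x; rewrite derive1E; have [] := ipsi x.
have ctent : continuous tent.
  have cp (k : R) : continuous (fun t : R => pos (t - k)).
    move=> x; apply: (@continuous_comp _ _ _ (fun t : R => t - k) pos).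
      by apply: cvgB; [exact: cvg_id|exact: cvg_cst].
    exact: continuous_pos.
  move=> x; apply: cvgD; first apply: cvgB.
  - by apply: cvgM; [exact: cvg_cst|exact: continuous_pos].
  - by apply: cvgM; [exact: cvg_cst|exact: cp].
  - by apply: cvgM; [exact: cvg_cst|exact: cp].
have cpsi' : continuous psi'.
  have cl (k : R) : continuous (fun t : R => tent ((t - k) / d) / d).
    move=> x; apply: cvgM; last exact: cvg_cst.
    apply: (@continuous_comp _ _ _ (fun t : R => (t - k) / d) tent); last exact: ctent.
    by apply: cvgM; [apply: cvgB; [exact: cvg_id|exact: cvg_cst]|exact: cvg_cst].
  by move=> x; apply: cvgB; exact: cl.
have tpsi : test_function `[a, b] psi.
  split; [by move=> x; have [] := ipsi x|by rewrite dpsiE|].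
  exists `[a + d, b - d]; split; first exact: segment_compact.
    move=> x /=; rewrite in_itv/= => /andP[xa xb].
    have x1 : a < x by lra. have x2 : x < b by lra.
    rewrite /interior; apply: (@filterS _ _ _ `]a, b[).
      exact: subset_itv_oo_cc.
    by apply: near_in_itvoo; rewrite in_itv/= x1.
  move=> x /negP; rewrite /= in_itv/= negb_and -!ltNge => /orP[xa|xb]; rewrite /psi.
  - rewrite !smoothstep0 ?subrr// ler_pdivrMr// mul0r; lra.
  - rewrite !smoothstep1 ?subrr// ler_pdivlMr// mul1r; lra.
have ppsi : primitive_on setT psi psi' by exact: primitive_on_is_derive.
have psi'i : (`[a, b]).-int psi' by apply: econt_integrable; exact: continuous_econt.
have zpsi'i : (`[a, b]).-int (fun x => z x * psi' x) by exact: int_econtM.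
have S0 t : t <= a + d -> psi t = 0.
  by move=> ta; rewrite /psi !smoothstep0 ?subrr// ler_pdivrMr// mul0r; lra.
have S1 t : b - d <= t -> psi t = 0.
  by move=> tb; rewrite /psi !smoothstep1 ?subrr// ler_pdivlMr// mul1r; lra.
have Smid : psi (a + 2 * d) = 1.
  rewrite /psi smoothstep1 ?smoothstep0 ?subr0//.
  - rewrite ler_pdivrMr// mul0r; lra.
  - rewrite ler_pdivlMr// mul1r; lra.
have E0 : \int[leb]_(x in `[a, b]) psi' x = 0.
  have [_ <-] := ppsi a b I I (ltW ab); rewrite (S0 a) ?(S1 b) ?subrr//; lra.
have E1 : \int[leb]_(x in `[a, b]) (z x * psi' x) = 0.
  by rewrite -dpsiE; exact: weak0.
have E2 : 1 <= \int[leb]_(x in `[a, b]) `|psi' x|.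
  have adb : a + 2 * d <= b by lra.
  have aad : a <= a + 2 * d by lra.
  have [i1 e1] := ppsi a (a + 2 * d) I I aad.
  have nn x y : a <= x -> y <= b -> (`[x, y]).-int (fun t => `|psi' t|).
    by move=> ax yb; apply: (@integrable_itv_sub _ _ a b) => //; exact: int_norm.
  rewrite (@Rintegral_itv_cat _ _ a (a + 2 * d) b)//; last exact: nn.
  rewrite [leLHS](_ : 1 = psi (a + 2 * d) - psi a); last by rewrite Smid (S0 a) ?subr0//; lra.
  rewrite e1; apply: le_trans (ler_norm _) _.
  apply: le_trans (le_normr_Rintegral _ i1) _ => //.
  by rewrite lerDl Rintegral_ge0.
(* Both [psi'] and [z * psi'] have zero integral, whereas [(z - c) * psi' <= - n * |psi'|]: [z] is
   below [c] on the positive bump and above [c] on the negative one. *)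
have : 0 <= - n * \int[leb]_(x in `[a, b]) `|psi' x|.
  rewrite -RintegralZl//; last exact: int_norm.
  have -> : 0 = \int[leb]_(x in `[a, b]) (z x * psi' x - c * psi' x).
    by rewrite RintegralB// ?RintegralZl// ?E0 ?E1 ?mulr0 ?subrr//; exact: intZ.
  apply: le_Rintegral => //.
  - by apply: intB => //; exact: intZ.
  - by apply: intZ => //; exact: int_norm.
  move=> x /=; rewrite in_itv/= => /andP[ax xb]; rewrite -mulrBl.
  have [x1|x1] := boolP (0 <= (x - (a + d)) / d <= 1).
    have t2 : tent ((x - (b - 2 * d)) / d) = 0.
      apply: tent_out; apply/negP; rewrite negb_and -!ltNge; apply/orP; left.
      move: x1; rewrite ler_pdivrMr// => /andP[_ x1]; rewrite ltr_pdivrMr// mul0r; lra.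
    rewrite /psi' t2 mul0r subr0 ger0_norm; last by rewrite divr_ge0 ?tent_ge0// ltW.
    rewrite ler_wpM2r ?divr_ge0 ?tent_ge0 ?(ltW d0)//.
    move: x1; rewrite ler_pdivrMr// => /andP[_ x1].
    have : `[a, b] x by rewrite /= in_itv/= ax xb.
    move=> /H1; rewrite ger0_norm; last lra.
    have -> : (x - a < d1) by lra.
    move=> /(_ isT); rewrite ler_norml => /andP[_].
    by rewrite /n /c; lra.
  have t1 : tent ((x - (a + d)) / d) = 0 by apply: tent_out; exact/negP.
  rewrite /psi' t1 mul0r sub0r normrN.
  have [x2|x2] := boolP (0 <= (x - (b - 2 * d)) / d <= 1); last first.
    have -> : tent ((x - (b - 2 * d)) / d) = 0 by apply: tent_out; exact/negP.
    by rewrite mul0r oppr0 normr0 !mulr0.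
  rewrite ger0_norm; last by rewrite divr_ge0 ?tent_ge0// ltW.
  rewrite mulrN -mulNr ler_wpM2r ?divr_ge0 ?tent_ge0 ?(ltW d0)//.
  move: x2; rewrite ler_pdivlMr// mul0r => /andP[x2 _].
  have : `[a, b] x by rewrite /= in_itv/= ax xb.
  move=> /H2; rewrite ler0_norm; last lra.
  have -> : (- (x - b) < d2) by lra.
  move=> /(_ isT); rewrite ler_norml => /andP[+ _].
  by rewrite /n /c; lra.
by rewrite mulNr oppr_ge0 leNgt pmulr_rgt0// (lt_le_trans _ E2).
Qed.

End test_functions.

(** * Weak limits in L2 *)

Section l2_completeness.
Context {R : realType}.
Implicit Types (D A B : set R) (f g u v w z : R -> R) (a b c x y r e : R).

Lemma Rint_fin D f : measurable D -> D.-int f ->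
  (\int[leb]_(x in D) (f x)%:E)%E = (\int[leb]_(x in D) f x)%:E.
Proof. by move=> mD fi; rewrite /Rintegral fineK//; exact: integrable_fin_num. Qed.

Lemma int_nneg D f : measurable D -> measurable_fun D f -> (forall x, D x -> 0 <= f x) ->
  (\int[leb]_(x in D) (f x)%:E < +oo)%E -> D.-int f.
Proof.
move=> mD mf f0 fi; apply/integrableP; split; first exact/measurable_EFinP.
apply: le_lt_trans fi; apply: ge0_le_integral => //.
all: try exact/measurable_EFinP.
all: try (by move=> x Dx; rewrite ?lee_fin /= ?ger0_norm ?f0).
by apply: measurableT_comp => //; exact/measurable_EFinP.
Qed.

Lemma Rint_fatou D (f : nat -> R -> R) g e : measurable D ->
  (forall n, D.-int (f n)) -> (forall n x, D x -> 0 <= f n x) ->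
  (forall n, \int[leb]_(x in D) f n x <= e) ->
  measurable_fun D g -> {ae leb, forall x, D x -> f ^~ x @ \oo --> g x} ->
  (forall x, D x -> 0 <= g x) ->
  D.-int g /\ \int[leb]_(x in D) g x <= e.
Proof.
move=> mD fi f0 fe mg fg g0.
have mf n : measurable_fun D (EFin \o f n) by case/integrableP : (fi n).
have H : (\int[leb]_(x in D) (g x)%:E <= e%:E)%E.
  apply: (@le_trans _ _ (\int[leb]_(x in D) limn_einf (fun n => (f n x)%:E))%E).
    apply: ae_ge0_le_integral => //.
    - exact/measurable_EFinP.
    - move=> x Dx; rewrite limn_einf_lim; apply: lime_ge; first exact: is_cvg_einfs.
      by near=> n; apply: le_ereal_inf_tmp => _ /= [k _ <-]; rewrite lee_fin f0.
    - have ml : measurable_fun D (fun x => limn_esup (fun n => (- (f n x)%:E)%E)).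
        apply: measurable_fun_limn_esup => n.
        exact: (measurableT_comp (@oppe_measurable _ setT) (mf n)).
      exact: (measurableT_comp (@oppe_measurable _ setT) ml).
    - move: fg; apply: filterS; first exact: (ae_filter_ringOfSetsType leb).
      move=> x fgx Dx.
      have Hc : D x -> (f n x)%:E @[n --> \oo] --> (g x)%:E.
        by move=> /fgx; apply: cvg_EFin; exact: nearW.
      rewrite is_cvg_limn_einfE.
        by rewrite (cvg_lim _ (Hc Dx)).
      by apply/cvg_ex; exists (g x)%:E; exact: Hc.
  have ff0 n x : D x -> (0 <= (f n x)%:E)%E by move=> Dx; rewrite lee_fin f0.
  apply: le_trans (@fatou _ _ _ leb D mD (fun n x => (f n x)%:E) mf ff0) _.
  rewrite limn_einf_lim; apply: lime_le; first exact: is_cvg_einfs.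
  apply: nearW => n; apply: (@le_trans _ _ (\int[leb]_(x in D) (f n x)%:E)%E).
    by apply: ereal_inf_lbound; exists n => /=.
  by rewrite Rint_fin// lee_fin.
have gi : D.-int g.
  by apply: int_nneg => //; apply: le_lt_trans H _; rewrite ltry.
by split => //; rewrite -lee_fin -Rint_fin.
Unshelve. all: by end_near. Qed.

(** Each term is at most the sum of the series, which has finite integral by monotone convergence.
    [E] is returned as a measurable set so that functions can be restricted to it. *)
Lemma Rint_nneseries_ae_fin D (d : nat -> R -> R) : measurable D ->
  (forall k, D.-int (d k)) -> (forall k x, D x -> 0 <= d k x) ->
  (forall k, \int[leb]_(x in D) d k x <= 2^-1 ^+ k) ->
  exists2 E : set R, measurable E /\ E `<=` D &
    {ae leb, forall x, D x -> E x} /\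
    forall x, E x -> exists2 M, 0 <= M & forall k, d k x <= M.
Proof.
move=> mD di d0 dle.
pose g x := (\sum_(0 <= k <oo) (d k x)%:E)%E.
have md k : measurable_fun D (fun x => (d k x)%:E) by case/integrableP : (di k).
have dE0 k x : D x -> (0 <= (d k x)%:E)%E by move=> Dx; rewrite lee_fin d0.
have mg : measurable_fun D g.
  by apply: ge0_emeasurable_sum => [k x Dx _|k _]; [exact: dE0|exact: md].
have g0 x : D x -> (0 <= g x)%E.
  by move=> Dx; apply: nneseries_ge0 => k _ _; exact: dE0.
have gi : leb.-integrable D g.
  apply/integrableP; split => //.
  rewrite (_ : (\int[leb]_(x in D) _)%E = (\int[leb]_(x in D) g x)%E); last first.
    by apply: eq_integral => x /set_mem Dx; rewrite gee0_abs// g0.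
  rewrite /g integral_nneseries//.
  apply: (@le_lt_trans _ _ 2%:E); last by rewrite ltry.
  apply: lime_le.
    by apply: is_cvg_nneseries => k _ _; apply: integral_ge0 => x; exact: dE0.
  apply: nearW => n /=.
  apply: (@le_trans _ _ (\sum_(0 <= k < n) (2^-1 ^+ k)%:E)%E).
    by apply: lee_sum => k _; rewrite Rint_fin// lee_fin.
  rewrite sumEFin lee_fin.
  have -> : \sum_(0 <= i < n) (2^-1 : R) ^+ i = series (geometric 1 2^-1) n.
    by rewrite /series/=; apply: eq_bigr => i _; rewrite mul1r.
  rewrite geometric_seriesE ?lt_eqF ?invf_lt1 ?ltr1n//=.
  have : 0 <= (2^-1 : R) ^+ n by rewrite exprn_ge0.
  by rewrite (_ : 1 - 2^-1 = 2^-1 :> R) ?invrK; [lra|field].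
exists (D `&` [set x | (g x < +oo)%E]).
  by split; [exact: emeasurable_fun_infty_o|move=> x []].
split.
  have : {ae leb, forall x, D x -> g x \is a fin_num} by exact: (@integrable_ae _ _ _ leb D mD g gi).
  apply: filterS; first exact: (ae_filter_ringOfSetsType leb).
  by move=> x gx Dx; split => //=; rewrite -ge0_fin_numE ?g0// gx.
move=> x [Dx /= gx]; exists (fine (g x)); first by rewrite fine_ge0// g0.
move=> k; rewrite -lee_fin fineK ?ge0_fin_numE ?g0//.
apply: le_trans (nneseries_lim_ge k.+1 _); last by move=> n _ _; exact: dE0.
rewrite big_nat_recr//= leeDr//; apply: sume_ge0 => i _; exact: dE0.
Qed.

Lemma cvg_geometric_increments (s : nat -> R) M :
  (forall k, 4 ^+ k * (s k.+1 - s k) ^+ 2 <= M) -> cvgn s.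
Proof.
move=> sM.
have M0 : 0 <= M by apply: le_trans (sM 0%N); rewrite mulr_ge0 ?sqr_ge0.
have -> : s = (fun n => s 0%N + series (telescope s) n).
  by apply/funext => n; rewrite -eq_sum_telescope.
apply: is_cvgD; first exact: is_cvg_cst.
apply: normed_cvg; apply: (@series_le_cvg _ _ (geometric (M + 1) 2^-1)).
- by move=> n /=.
- by move=> n; rewrite geometric_ge0// addr_ge0.
- move=> k; rewrite /telescope /=.
  set a := `|_|; have p0 : 0 < (2 : R) ^+ k by rewrite exprn_gt0.
  rewrite exprVn ler_pdivlMr//.
  have H : (a * 2 ^+ k) ^+ 2 <= M.
    apply: le_trans (sM k); rewrite exprMn mulrC -exprM mulnC exprM.
    by rewrite /a real_normK ?num_real// (_ : 2 ^+ 2 = 4 :> R)//; ring.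
  have := sqr_ge0 (a * 2 ^+ k - 1); nra.
- by apply: is_cvg_geometric_series; rewrite ger0_norm// invf_lt1// ltr1n.
Qed.

(** Riesz-Fischer: a fast subsequence converges almost everywhere, and Fatou's lemma turns the
    Cauchy estimate into convergence to its limit. *)
Lemma L2_complete D (w : nat -> R -> R) : measurable D ->
  (forall n, measurable_fun D (w n)) -> (forall n, D.-int (fun x => w n x ^+ 2)) ->
  (forall e, 0 < e -> exists N, forall m n, (N <= m)%N -> (N <= n)%N ->
     \int[leb]_(x in D) (w m x - w n x) ^+ 2 <= e) ->
  exists v, [/\ measurable_fun D v, D.-int (fun x => v x ^+ 2) &
    forall e, 0 < e -> exists N, forall n, (N <= n)%N ->
      D.-int (fun x => (v x - w n x) ^+ 2) /\
      \int[leb]_(x in D) (v x - w n x) ^+ 2 <= e].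
Proof.
move=> mD mw wi wC.
have dwi m n : D.-int (fun x => (w m x - w n x) ^+ 2).
  apply: (@int_le _ _ _ (fun x => 2 * w m x ^+ 2 + 2 * w n x ^+ 2)) => //.
  - by apply: measurable_funX; exact: measurable_funB.
  - move=> x _; rewrite ger0_norm ?sqr_ge0//.
    by have := sqr_ge0 (w m x + w n x); nra.
  - by apply: intD => //; exact: intZ.
(* Pointwise geometric decay needs the squared increments weighted by [4 ^+ k]; the rate 8^-k leaves
   integrals 2^-k, which are still summable. *)
have /choice [phi Hphi] k : exists N, forall m n, (N <= m)%N -> (N <= n)%N ->
     \int[leb]_(x in D) (w m x - w n x) ^+ 2 <= 8^-1 ^+ k.
  by apply: wC; rewrite exprn_gt0.
pose N k := (\sum_(i < k.+1) phi i + k)%N.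
have phiN k : (phi k <= N k)%N.
  by rewrite /N big_ord_recr/= -addnA addnCA leq_addr.
have NS k : (N k <= N k.+1)%N.
  by rewrite /N [in leqRHS]big_ord_recr/= leq_add// leq_addr.
have Nk k : (k <= N k)%N by exact: leq_addl.
pose s k := w (N k).
pose d k x := 4 ^+ k * (s k.+1 x - s k x) ^+ 2.
have [E [mE ED] [aeE HE]] : exists2 E : set R, measurable E /\ E `<=` D &
    {ae leb, forall x, D x -> E x} /\
    forall x, E x -> exists2 M, 0 <= M & forall k, d k x <= M.
  apply: Rint_nneseries_ae_fin => //.
  - by move=> k; apply: intZ => //; exact: dwi.
  - by move=> k x _; rewrite mulr_ge0 ?sqr_ge0// exprn_ge0.
  - move=> k; rewrite /d RintegralZl//; last exact: dwi.
    apply: (@le_trans _ _ (4 ^+ k * 8^-1 ^+ k)).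
      rewrite ler_wpM2l ?exprn_ge0//; apply: Hphi; last exact: phiN.
      exact: leq_trans (phiN k) (NS k).
    by rewrite -exprMn (_ : 4 * 8^-1 = 2^-1 :> R)//; field.
have cvE x : E x -> cvgn (s ^~ x).
  by move=> /HE[M M0 HM]; exact: (@cvg_geometric_increments _ M).
(* Cutting the sequence off to 0 outside [E] makes it converge everywhere, so that [v] is
   measurable. *)
pose v x := limn (fun k => (s k \_ E) x).
have sEv x : (s k \_ E) x @[k --> \oo] --> v x.
  suff : cvgn (fun k => (s k \_ E) x) by [].
  have [xE|xE] := boolP (x \in E).
    rewrite (_ : (fun _ => _) = s ^~ x); last by apply/funext => k; rewrite patchE xE.
    exact/cvE/set_mem.
  rewrite (_ : (fun _ => _) = cst 0); first exact: is_cvg_cst.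
  by apply/funext => k; rewrite patchE (negbTE xE).
have mv : measurable_fun D v.
  apply: (@measurable_fun_cvg _ _ _ D (fun k => s k \_ E) v) => //.
  move=> k; apply/measurable_restrict => //; rewrite setIC.
  by apply: measurable_funS (mw _) => //; exact: subIsetr.
have fat e : 0 < e -> exists N, forall n, (N <= n)%N ->
      D.-int (fun x => (v x - w n x) ^+ 2) /\
      \int[leb]_(x in D) (v x - w n x) ^+ 2 <= e.
  move=> e0; have [N0 HN0] := wC e e0; exists N0 => n N0n.
  apply: (@Rint_fatou D (fun k x => (s (k + N0)%N x - w n x) ^+ 2)) => //.
  - by move=> k; exact: dwi.
  - by move=> k x _; exact: sqr_ge0.
  - by move=> k; apply: HN0 => //; apply: leq_trans (Nk _); exact: leq_addl.
  - by apply: measurable_funX; exact: measurable_funB.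
  - move: aeE; apply: filterS; first exact: (ae_filter_ringOfSetsType leb).
    move=> x Ex /Ex {}Ex.
    have sv : s k x @[k --> \oo] --> v x.
      rewrite (_ : (fun _ => _) = (fun k => (s k \_ E) x)); first exact: sEv.
      by apply/funext => k; rewrite patchE mem_set.
    have sv' : s (k + N0)%N x @[k --> \oo] --> v x by rewrite (cvg_shiftn N0 (s ^~ x)).
    have svw : s (k + N0)%N x - w n x @[k --> \oo] --> v x - w n x.
      by apply: cvgB => //; exact: cvg_cst.
    by under eq_fun do rewrite expr2; rewrite expr2; apply: cvgM.
  - by move=> x _; exact: sqr_ge0.
exists v; split => //.
have [N0 /(_ _ (leqnn _))[vwi _]] := fat 1 ltr01.
apply: (@int_le _ _ _ (fun x => 2 * (v x - w N0 x) ^+ 2 + 2 * w N0 x ^+ 2)) => //.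
- exact: measurable_funX.
- move=> x _; rewrite ger0_norm ?sqr_ge0//.
  by have := sqr_ge0 (v x - 2 * w N0 x); nra.
- by apply: intD => //; exact: intZ.
Qed.

End l2_completeness.

Section l2_weak_limits.
Context {R : realType}.
Implicit Types (D A B : set R) (f g u v w z : R -> R) (a b c x y r e : R).

(* The elements of almost minimal norm form a Cauchy sequence, by the
   parallelogram identity. *)
Lemma nested_convex_L2 D (C : nat -> set (R -> R)) T : measurable D ->
  (forall n w, C n w -> measurable_fun D w /\ D.-int (fun x => w x ^+ 2)) ->
  (forall n m, (n <= m)%N -> C m `<=` C n) ->
  (forall n w z, C n w -> C n z -> C n (fun x => (w x + z x) / 2)) ->
  (forall n e, 0 < e -> exists2 w, C n w & \int[leb]_(x in D) w x ^+ 2 <= T + e) ->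
  exists v, [/\ measurable_fun D v, D.-int (fun x => v x ^+ 2),
    \int[leb]_(x in D) v x ^+ 2 <= T &
    forall n e, 0 < e -> exists2 w, C n w & D.-int (fun x => (v x - w x) ^+ 2) /\
      \int[leb]_(x in D) (v x - w x) ^+ 2 <= e].
Proof.
move=> mD Cw Cmono Cconv CT.
pose Q w := \int[leb]_(x in D) w x ^+ 2.
pose S n := [set Q w | w in C n].
have hS n : has_inf (S n).
  split; first by have [w Cnw _] := CT n 1 ltr01; exists (Q w); exists w.
  by exists 0 => _ [w _ <-]; apply: Rintegral_ge0 => x _; exact: sqr_ge0.
pose d n := inf (S n).
have dT n : d n <= T.
  apply/ler_addgt0Pr => e e0; have [w Cnw Qw] := CT n e e0.
  by apply: le_trans Qw; apply: ge_inf; [exact: (hS n).2|exists w].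
have dle n w : C n w -> d n <= Q w.
  by move=> Cnw; apply: ge_inf; [exact: (hS n).2|exists w].
have dmono n m : (n <= m)%N -> d n <= d m.
  move=> nm; apply: lb_le_inf; first exact: (hS m).1.
  by move=> _ [w Cmw <-]; apply: dle; exact: Cmono nm _ Cmw.
have d0 n : 0 <= d n.
  apply: lb_le_inf; first exact: (hS n).1.
  by move=> _ [w _ <-]; apply: Rintegral_ge0 => x _; exact: sqr_ge0.
have /choice[w Hw] n : exists w, C n w /\ Q w <= d n + n.+1%:R^-1.
  have n0 : 0 < (n.+1%:R^-1 : R) by rewrite invr_gt0.
  have [_ [w Cnw <-] Qw] := inf_adherent n0 (hS n).
  by exists w; split => //; exact: ltW.
have mw n : measurable_fun D (w n) by case: (Cw n _ (Hw n).1).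
have wi n : D.-int (fun x => w n x ^+ 2) by case: (Cw n _ (Hw n).1).
have para n m : (n <= m)%N ->
    \int[leb]_(x in D) (w m x - w n x) ^+ 2 <= 2 * (d m - d n) + 4 * n.+1%:R^-1.
  move=> nm.
  have Cmid : C n (fun x => (w m x + w n x) / 2).
    by apply: Cconv; [exact: Cmono nm _ (Hw m).1|exact: (Hw n).1].
  have [_ midi] := Cw _ _ Cmid; have Qmid := dle _ _ Cmid.
  have -> : \int[leb]_(x in D) (w m x - w n x) ^+ 2 =
      2 * Q (w m) + 2 * Q (w n) - 4 * Q (fun x => (w m x + w n x) / 2).
    rewrite /Q -!RintegralZl// -RintegralD//; [|exact: intZ|exact: intZ].
    rewrite -RintegralB//; last 2 first.
    - by apply: intD => //; exact: intZ.
    - exact: intZ.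
    by apply: eq_Rintegral => x _; field.
  have := (Hw m).2; have := (Hw n).2.
  have : (m.+1%:R^-1 : R) <= n.+1%:R^-1 by rewrite lef_pV2 ?posrE// ler_nat ltnS.
  move: (Q _) Qmid => q; move: (Q _) (Q _) (d n) (d m) => q1 q2 d1 d2.
  by move: (n.+1%:R^-1) (m.+1%:R^-1) => a b; lra.
have supd : has_sup (range d).
  by split; [exists (d 0%N); exists 0%N|exists T => _ [n _ <-]; exact: dT].
have wC e : 0 < e -> exists N, forall m n, (N <= m)%N -> (N <= n)%N ->
     \int[leb]_(x in D) (w m x - w n x) ^+ 2 <= e.
  move=> e0; have e4 : 0 < e / 4 by rewrite divr_gt0.
  have [_ [N1 _ <-] dN1] := sup_adherent e4 supd.
  have e8 : 0 < e / 8 by rewrite divr_gt0.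
  pose N2 := Num.truncn (e / 8)^-1.
  have HN2 : (N2.+1%:R^-1 : R) <= e / 8.
    rewrite -[leRHS]invrK lef_pV2 ?posrE// ?invr_gt0//.
    by apply: ltW; exact: truncnS_gt.
  exists (maxn N1 N2) => m n.
  wlog nm : m n / (n <= m)%N => [H|].
    have [nm|/ltnW mn] := leqP n m; first exact: H.
    move=> Hm Hn; rewrite (@eq_Rintegral _ _ _ leb _ (fun x => (w n x - w m x) ^+ 2)).
      exact: H.
    by move=> x _; ring.
  rewrite !geq_max => /andP[N1m N2m] /andP[N1n N2n].
  apply: le_trans (para _ _ nm) _.
  have dm : d m <= sup (range d) by apply: ub_le_sup; [exact: supd.2|exists m].
  have dn := dmono _ _ N1n.
  have : (n.+1%:R^-1 : R) <= e / 8.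
    by apply: le_trans HN2; rewrite lef_pV2 ?posrE// ler_nat ltnS.
  move: (n.+1%:R^-1) (d m) (d n) (d N1) (sup _) dm dn dN1 => r p1 p2 p3 s.
  by clear; move=> ? ? ? ?; lra.
have [v [mv vi wv]] := L2_complete mD mw wi wC.
have near n e : 0 < e -> exists2 k, (n <= k)%N & D.-int (fun x => (v x - w k x) ^+ 2) /\
      \int[leb]_(x in D) (v x - w k x) ^+ 2 <= e.
  move=> e0; have [N HN] := wv e e0; exists (maxn n N); first exact: leq_maxl.
  by apply: HN; exact: leq_maxr.
exists v; split => //; last first.
  move=> n e /(near n)[k nk Hk]; exists (w k) => //.
  exact: Cmono nk _ (Hw k).1.
have T0 : 0 <= T by exact: le_trans (d0 0%N) (dT _).
apply/ler_addgt0Pr => e e0.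
(* In (a + b)^2 <= (1 + n) a^2 + (1 + 1/n) b^2 the three errors, coming from [n], from [m] and from
   the distance [r], are each at most e / 4. *)
pose n : R := e / (4 * (T + 1)).
have T1 : 0 < 4 * (T + 1) by rewrite mulr_gt0// ltr_wpDl.
have n0 : 0 < n by rewrite divr_gt0.
pose m : R := Num.min 1 (e / 4).
have m0 : 0 < m by rewrite lt_min ltr01 divr_gt0.
pose r : R := e / 4 / (1 + n^-1).
have n1 : 0 < 1 + n^-1 by rewrite ltr_wpDr// invr_ge0 ltW.
have r0 : 0 < r by rewrite !divr_gt0.
have [k Nk [rki rk]] := near (Num.truncn m^-1) r r0.
have km : (k.+1%:R^-1 : R) <= m.
  rewrite -[leRHS]invrK lef_pV2 ?posrE// ?invr_gt0//.
  by apply: ltW; apply: lt_le_trans (truncnS_gt _) _; rewrite ler_nat ltnS.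
have Qk : Q (w k) <= T + m.
  by apply: le_trans (Hw k).2 _; apply: lerD.
have : Q v <= (1 + n) * Q (w k) + (1 + n^-1) * \int[leb]_(x in D) (v x - w k x) ^+ 2.
  rewrite /Q -!RintegralZl// -RintegralD//; [|exact: intZ|exact: intZ].
  apply: le_Rintegral => //; first by apply: intD => //; exact: intZ.
  move=> x _; rewrite -subr_ge0.
  have -> : (1 + n) * w k x ^+ 2 + (1 + n^-1) * (v x - w k x) ^+ 2 - v x ^+ 2 =
    (n * w k x - (v x - w k x)) ^+ 2 / n by field; rewrite gt_eqF.
  by rewrite divr_ge0 ?sqr_ge0// ltW.
rewrite -/(Q v) => /le_trans; apply.
have h1 : (1 + n^-1) * \int[leb]_(x in D) (v x - w k x) ^+ 2 <= e / 4.
  by rewrite mulrC -ler_pdivlMr.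
have h2 : n * (T + 1) = e / 4 by rewrite /n; field; rewrite gt_eqF// ltr_wpDl.
have m1 : m <= 1 by rewrite ge_min lexx.
have me : m <= e / 4 by rewrite ge_min lexx orbT.
have h3 : n * Q (w k) <= n * (T + 1) by rewrite ler_pM2l//; apply: le_trans Qk _; rewrite lerD2l.
rewrite mulrDl mul1r; move: (n * Q _) (_ * Rintegral _ _ _) h1 h3 => a b; rewrite h2.
by move: (Q _) Qk => q; clear -e0 me; lra.
Qed.

(** Nonnegativity of the integral of [(f - c) ^+ 2] when [c] is the mean value of [f]. *)
Lemma cauchy_schwarz_itv a b f : a <= b -> (`[a, b]).-int f ->
  (`[a, b]).-int (fun x => f x ^+ 2) ->
  (\int[leb]_(x in `[a, b]) f x) ^+ 2 <= (b - a) * \int[leb]_(x in `[a, b]) f x ^+ 2.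
Proof.
move=> ab fi f2i; set I := Rintegral _ _ _; set J := Rintegral _ _ _.
have J0 : 0 <= J by apply: Rintegral_ge0 => x _; exact: sqr_ge0.
have H c : 0 <= J - 2 * c * I + c ^+ 2 * (b - a).
  have -> : J - 2 * c * I + c ^+ 2 * (b - a) =
      \int[leb]_(x in `[a, b]) (f x - c) ^+ 2.
    rewrite -(Rintegral_itv_cst (c ^+ 2) ab) /J /I -RintegralZl// -RintegralB//; last exact: intZ.
    rewrite -RintegralD//; last 2 first.
    - by apply: intB => //; exact: intZ.
    - exact: integrable_cst_itv.
    by apply: eq_Rintegral => x _; ring.
  by apply: Rintegral_ge0 => x _; exact: sqr_ge0.
move: ab; rewrite le_eqVlt => /predU1P[E|ab].
  by rewrite /I -E set_itv1 Rintegral_set1 expr0n/= subrr mul0r.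
have ab0 : 0 < b - a by rewrite subr_gt0.
have := H (I / (b - a)).
have -> : J - 2 * (I / (b - a)) * I + (I / (b - a)) ^+ 2 * (b - a) = J - I ^+ 2 / (b - a).
  by field; rewrite gt_eqF.
by rewrite subr_ge0 ler_pdivrMr// mulrC.
Qed.

End l2_weak_limits.

(** * Weak derivatives *)

Section sobolev_pairs.
Context {R : realType}.
Implicit Types (D A B : set R) (f g u v w z : R -> R) (a b c x y r e : R).

Lemma test_function_out A (psi : R -> R) x : test_function A psi -> ~ A x ->
  psi x = 0 /\ derive1 psi x = 0.
Proof.
move=> [_ _ [K [cK KA K0]]] nAx.
have nKx : ~ K x by move=> /KA /interior_subset.
split; first exact: K0.
have clK : closed K by exact: (compact_closed (@Rhausdorff R)).
rewrite derive1E.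
have : \forall y \near x, psi y = cst 0 y.
  have : nbhs x (~` K) by apply: open_nbhs_nbhs; split => //; rewrite openC.
  by apply: filterS => y; exact: K0.
by move=> /near_eq_derive ->; rewrite derive_cst.
Qed.

Lemma test_functionS A D (psi : R -> R) : A `<=` D -> test_function A psi -> test_function D psi.
Proof.
move=> AD [? ? [K [? KA ?]]]; split => //; exists K; split => //.
by apply: subset_trans KA _; exact: interiorS.
Qed.

Lemma primitive_on_integral a b v : (`[a, b]).-int v ->
  primitive_on `[a, b] (fun x => \int[leb]_(t in `[a, x]) v t) v.
Proof.
move=> vi x y /=; rewrite !in_itv/= => /andP[ax xb] /andP[ay yb] xy.
have vxy : (`[x, y]).-int v by exact: integrable_itv_sub vi.
split => //; rewrite (@Rintegral_itv_cat _ v a x y)//; last exact: integrable_itv_sub vi.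
by rewrite addrAC subrr add0r.
Qed.

(** The difference between [u] and the integral of [v] has zero weak derivative, so it is constant
    by [weakly_constant] (du Bois-Reymond). Continuity of [u] selects the right representative. *)
Lemma weak_primitive D u v : is_interval D -> econt D u ->
  measurable_fun D v -> D.-int (fun x => v x ^+ 2) ->
  (forall psi, test_function D psi ->
    \int[leb]_(x in D) (u x * derive1 psi x) = - \int[leb]_(x in D) (v x * psi x)) ->
  primitive_on D u v.
Proof.
move=> iD cu mv vi weak a b Da Db ab.
have sD := is_interval_sub_itv iD Da Db.
have mD : measurable D by exact: is_interval_measurable.
have vab : (`[a, b]).-int v.
  apply: int_sq_itv; first exact: measurable_funS mv.
  exact: integrableS vi.
split => //.
move: ab; rewrite le_eqVlt => /predU1P[<-|ab].
  by rewrite set_itv1 Rintegral_set1 subrr.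
pose U x := \int[leb]_(t in `[a, x]) v t.
have pU : primitive_on `[a, b] U v by exact: primitive_on_integral.
have cU := primitive_on_itv_econt pU.
have cu' := econtS sD cu.
have iab : is_interval `[a, b] by exact: interval_is_interval.
have : u a - U a = u b - U b.
  apply: (@weakly_constant _ a b (fun x => u x - U x)) => //.
    apply/econtP; apply: within_continuousB; exact/econtP.
  move=> psi tpsi.
  have tD := test_functionS sD tpsi.
  have WU := primitive_on_weak iab pU tpsi.
  have := weak psi tD.
  rewrite (Rint_support sD) => [|x _ /(test_function_out tpsi)[_ ->]]; last by rewrite mulr0.
  rewrite (Rint_support sD) => [|x _ /(test_function_out tpsi)[-> _]]; last by rewrite mulr0.
  rewrite -WU => /eqP; rewrite -subr_eq0 => /eqP <-.
  have [_ cpsi' _] := tpsi.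
  have pi : (`[a, b]).-int (derive1 psi).
    by apply: econt_integrable; exact: continuous_econt.
  rewrite -RintegralB//; [|exact: int_econtM|exact: int_econtM].
  by apply: eq_Rintegral => x _; rewrite mulrBl.
rewrite {1}/U set_itv1 Rintegral_set1 subr0 => ->.
by rewrite opprB addrC subrK.
Qed.

(** [v - w], extended by 0, integrates to 0 over every half-line []-oo, x]], so it vanishes almost
    everywhere by Lebesgue's differentiation theorem. *)
Lemma primitive_on_unique_ae a b u v w : a <= b ->
  primitive_on `[a, b] u v -> primitive_on `[a, b] u w ->
  {ae leb, forall x, `[a, b] x -> v x = w x}.
Proof.
move=> ab pv pw.
have Ia : `[a, b] a by rewrite /= in_itv/= lexx.
have Ib : `[a, b] b by rewrite /= in_itv/= lexx andbT.
have [vi _] := pv _ _ Ia Ib ab; have [wi _] := pw _ _ Ia Ib ab.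
pose d x := v x - w x.
have di : (`[a, b]).-int d by exact: intB.
pose f := d \_ `[a, b].
have fi : setT.-int f.
  have mab : measurable `[a, b] by [].
  have := (@integrable_mkcond _ _ _ leb `[a, b] (EFin \o d) mab).1 di.
  by rewrite restrict_EFin.
have F0 x : \int[leb]_(t in `]-oo, x]) f t = 0.
  rewrite -Rintegral_mkcondr.
  have [xa|ax] := ltP x a.
    rewrite (_ : _ `&` _ = set0) ?Rintegral_set0//.
    apply/seteqP; split => t //= []; rewrite !in_itv/= => tx /andP[at_ _].
    by have := le_lt_trans tx xa; rewrite ltNge at_.
  pose y := Num.min x b.
  have ay : a <= y by rewrite le_min ax.
  have yb : y <= b by rewrite ge_min lexx orbT.
  have Iy : `[a, b] y by rewrite /= in_itv/= ay yb.
  rewrite (_ : _ `&` _ = `[a, y]).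
    rewrite /d RintegralB//; [|exact: integrable_itv_sub vi|exact: integrable_itv_sub wi].
    by rewrite -(pv _ _ Ia Iy ay).2 -(pw _ _ Ia Iy ay).2 subrr.
  apply/seteqP; split => t /=; rewrite !in_itv/= /y le_min; first by move=> [-> /andP[-> ->]].
  by move=> /and3P[-> -> ->].
have locf : locally_integrable setT f.
  by apply: integrable_locally_restrict.
have fint y : (`]-oo, y]).-int f by exact: integrableS fi.
have := @FTC1Ny R f fint locf.
rewrite (_ : (fun x => _) = cst 0); last by apply/funext => x; exact: F0.
apply: filterS; first exact: (ae_filter_ringOfSetsType leb).
move=> x [_ +] xab; rewrite derive1_cst /f patchE mem_set// => /esym/eqP.
by rewrite subr_eq0 => /eqP.
Qed.

(** Treats the line, a ray and a compact interval alike, the sequences being constant at an endpoint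
    that belongs to [D]. Integrals of nonnegative functions over [D] are then limits over compact
    intervals. *)
Definition exhausted D := exists a b : nat -> R,
  [/\ forall n, [/\ D (a n), D (b n) & a n <= b n],
      forall n m, (n <= m)%N -> a m <= a n /\ b n <= b m &
      forall x, D x -> exists n, a n <= x <= b n].

Lemma exhausted_cvg D f : is_interval D -> exhausted D -> measurable_fun D f ->
  (forall x, D x -> 0 <= f x) -> exists a b : nat -> R,
  (forall n, [/\ D (a n), D (b n) & a n <= b n]) /\
  ((\int[leb]_(x in `[a n, b n]) (f x)%:E)%E @[n --> \oo] -->
     (\int[leb]_(x in D) (f x)%:E)%E).
Proof.
move=> iD [a [b [abD abm abx]]] mf f0; exists a, b; split => //.
have sD n : `[a n, b n] `<=` D.
  by have [Da Db _] := abD n; exact: is_interval_sub_itv.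
have -> : D = \bigcup_n `[a n, b n].
  apply/seteqP; split => x; last by move=> [n _]; exact: sD.
  by move=> /abx[n xn]; exists n => //=; rewrite in_itv.
apply: ge0_nondecreasing_set_cvg_integral => //.
- move=> n m nm; apply/subsetPset; apply: subset_itv; rewrite bnd_simp;
  by have [] := abm _ _ nm.
- move=> n; apply/measurable_EFinP; exact: measurable_funS (is_interval_measurable iD) (sD n) mf.
- by move=> n x /sD Dx; rewrite lee_fin f0.
Qed.

Lemma Rint_exhausted_lt D f e : is_interval D -> exhausted D -> D.-int f ->
  (forall x, D x -> 0 <= f x) -> 0 < e ->
  exists a b, [/\ D a, D b, a <= b & \int[leb]_(x in D) f x <= \int[leb]_(x in `[a, b]) f x + e].
Proof.
move=> iD exD fi f0 e0.
have mD : measurable D by exact: is_interval_measurable.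
have [a [b [abD cv]]] := exhausted_cvg iD exD (int_measurable fi) f0.
have fn n : (`[a n, b n]).-int f.
  by have [Da Db _] := abD n; apply: integrableS fi => //; exact: is_interval_sub_itv.
rewrite Rint_fin// in cv.
have cv' : (\int[leb]_(x in `[a n, b n]) f x) @[n --> \oo] --> \int[leb]_(x in D) f x.
  move: cv => /fine_cvg; apply: cvg_trans; apply: near_eq_cvg.
  by apply: nearW => n /=; rewrite Rint_fin.
have /cvgrPdist_le/(_ e e0)[N _ HN] := cv'.
exists (a N), (b N); have [Da Db ab] := abD N; split => //.
by have := HN N (leqnn N); rewrite ler_norml => /andP[_]; lra.
Qed.

Lemma int_exhausted D f K : is_interval D -> exhausted D -> measurable_fun D f ->
  (forall x, D x -> 0 <= f x) ->
  (forall a b, D a -> D b -> a <= b -> (`[a, b]).-int f /\ \int[leb]_(x in `[a, b]) f x <= K) ->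
  D.-int f /\ \int[leb]_(x in D) f x <= K.
Proof.
move=> iD exD mf f0 fK.
have mD : measurable D by exact: is_interval_measurable.
have [a [b [abD cv]]] := exhausted_cvg iD exD mf f0.
have H : (\int[leb]_(x in D) (f x)%:E <= K%:E)%E.
  rewrite -(cvg_lim _ cv)//; apply: lime_le; first by apply/cvg_ex; eexists; exact: cv.
  apply: nearW => n; have [Da Db ab] := abD n; have [fi fle] := fK _ _ Da Db ab.
  by rewrite Rint_fin// lee_fin.
have fi : D.-int f by apply: int_nneg => //; apply: le_lt_trans H _; rewrite ltry.
by split => //; rewrite -lee_fin -Rint_fin.
Qed.

Definition sobolev D u v := [/\ primitive_on D u v, measurable_fun D u,
  measurable_fun D v, D.-int (fun x => u x ^+ 2) & D.-int (fun x => v x ^+ 2)].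

Lemma le_sobolev_deriv D u v w : is_interval D -> exhausted D ->
  sobolev D u v -> sobolev D u w ->
  \int[leb]_(x in D) v x ^+ 2 <= \int[leb]_(x in D) w x ^+ 2.
Proof.
move=> iD exD [pv _ mv _ vi] [pw _ mw _ wi].
have mD : measurable D by exact: is_interval_measurable.
apply/ler_addgt0Pr => e e0.
have [a [b [Da Db ab]]] := Rint_exhausted_lt iD exD vi (fun x _ => sqr_ge0 _) e0.
move=> /le_trans; apply; rewrite lerD2r.
have sD := is_interval_sub_itv iD Da Db.
have vi' : (`[a, b]).-int (fun x => v x ^+ 2) by exact: integrableS vi.
have wi' : (`[a, b]).-int (fun x => w x ^+ 2) by exact: integrableS wi.
have ae := primitive_on_unique_ae ab (primitive_onS sD pv) (primitive_onS sD pw).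
apply: (@le_trans _ _ (\int[leb]_(x in `[a, b]) w x ^+ 2)).
  rewrite -lee_fin -!Rint_fin// le_eqVlt; apply/orP; left; apply/eqP.
  apply: ae_eq_integral => //; [by case/integrableP : vi'|by case/integrableP : wi'|].
  move: ae; apply: filterS; first exact: (ae_filter_ringOfSetsType leb).
  by move=> x /= H xab; rewrite H.
rewrite -lee_fin -!Rint_fin//; apply: ge0_subset_integral => //.
- by case/integrableP : wi.
- by move=> x _; rewrite lee_fin sqr_ge0.
Qed.

(** The energies are defined with [wderiv], a representative obtained by choice; this allows them to
    be computed with any explicit derivative. *)
Lemma eq_sobolev_deriv D u v w : is_interval D -> exhausted D ->
  sobolev D u v -> sobolev D u w ->
  \int[leb]_(x in D) v x ^+ 2 = \int[leb]_(x in D) w x ^+ 2.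
Proof. by move=> *; apply/eqP; rewrite eq_le !(@le_sobolev_deriv D u). Qed.

Lemma normX2E D f : normX 2 D f = (\int[leb]_(x in D) (f x ^+ 2)%:E)%E.
Proof.
apply: eq_integral => x _; congr EFin.
by rewrite powR_mulrn// real_normK// num_real.
Qed.

Lemma L2P D f : measurable D ->
  L2 D f <-> measurable_fun D f /\ D.-int (fun x => f x ^+ 2).
Proof.
move=> mD; rewrite /L2 normX2E; split => -[mf fi]; split => //.
  apply: int_nneg => //; first exact: measurable_funX.
  by move=> x _; exact: sqr_ge0.
exact: integrable_lty.
Qed.

Lemma sobolev_H1 D u v : is_interval D -> sobolev D u v -> H1 D u.
Proof.
move=> iD [pu mu mv ui vi]; have mD : measurable D by exact: is_interval_measurable.
split; first exact/L2P.
exists v; split; first exact/L2P.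
by move=> psi; exact: primitive_on_weak.
Qed.

Lemma H1_sobolev D u : is_interval D -> econt D u -> H1 D u ->
  sobolev D u (wderiv D u).
Proof.
move=> iD cu [L2u exv]; have mD : measurable D by exact: is_interval_measurable.
have : weak_derivative D u (wderiv D u) by apply: (@getPex _ [set v | weak_derivative D u v]).
move=> [/(L2P _ mD)[mv vi] weak].
have [mu ui] := (L2P u mD).1 L2u.
by split => //; exact: weak_primitive.
Qed.

End sobolev_pairs.

(** * Calibration *)

Section action.
Context {R : realType}.
Implicit Types (D A B : set R) (f g u v w z : R -> R) (a b c x y r e : R).

Lemma Rint_oppr a b f : a <= b -> continuous f ->
  \int[leb]_(x in `[- b, - a]) f x = \int[leb]_(x in `[a, b]) f (- x).
Proof.
move=> ab cf; rewrite /Rintegral integration_by_substitution_oppr//.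
exact: continuous_subspaceT.
Qed.

Lemma continuous_norm_powR p : 0 < p -> continuous (fun t : R => `|t| `^ p).
Proof.
move=> p0 t; have [->|t0] := eqVneq t 0.
  apply/cvgrPdist_le => e e0; rewrite normr0 powR0 ?gt_eqF//.
  near=> y; rewrite sub0r normrN ger0_norm ?powR_ge0//.
  have -> : e = (e `^ p^-1) `^ p by rewrite -powRrM mulVf ?gt_eqF// powRr1// ltW.
  rewrite ge0_ler_powR ?nnegrE ?powR_ge0// ?(ltW p0)//.
  near: y; apply/nbhs_ballP; exists (e `^ p^-1) => /=; first exact: powR_gt0.
  by move=> y; rewrite /ball/= sub0r normrN; exact: ltW.
apply: (@continuous_comp _ _ _ (fun t : R => `|t|) (fun t => t `^ p)).
  exact: norm_continuous.
apply: differentiable_continuous; apply/derivable1_diffP.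
by apply: derivable_powR; rewrite in_itv/= andbT normr_gt0.
Unshelve. all: by end_near. Qed.

Lemma continuous_primitive f : continuous f ->
  exists2 F, primitive_on setT F f & F 0 = 0.
Proof.
move=> cf; pose F x := \int[leb]_(t in `[0, x]) f t - \int[leb]_(t in `[x, 0]) f t.
have fi a b : (`[a, b]).-int f by apply: econt_integrable; exact: continuous_econt.
have E0 a b : b <= a -> \int[leb]_(t in `[a, b]) f t = 0.
  rewrite le_eqVlt => /predU1P[->|ba]; first by rewrite set_itv1 Rintegral_set1.
  by rewrite set_itv_ge ?bnd_simp -?ltNge// Rintegral_set0.
exists F; last by rewrite /F subrr.
move=> a b _ _ ab; split => //; rewrite /F.
have [a0|/ltW a0] := leP 0 a.
  rewrite (E0 b 0) ?(le_trans a0)// (E0 a 0)// (@Rintegral_itv_cat _ f 0 a b)//; ring.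
have [b0|/ltW b0] := leP b 0.
  rewrite (E0 0 b)// (E0 0 a)// (@Rintegral_itv_cat _ f a b 0)//; ring.
rewrite (E0 b 0)// (E0 0 a)// (@Rintegral_itv_cat _ f a 0 b)//; ring.
Qed.

Lemma primitive_on_econt u v : primitive_on setT u v -> econt setT u.
Proof.
move=> pu t _ e e0.
have Ht : `[t - 1, t + 1] t by rewrite /= in_itv/=; apply/andP; split; lra.
have [d d0 H] := primitive_on_itv_econt (primitive_onS (@subsetT _ `[t - 1, t + 1]) pu) Ht e0.
exists (Num.min d 1); first by rewrite lt_min d0 ltr01.
move=> y _; rewrite lt_min => /andP[yd y1]; apply: H => //.
by rewrite /= in_itv/=; move: y1; rewrite ltr_norml => /andP[? ?]; apply/andP; split; lra.
Qed.

Section calibration.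
Variable p : R.
Hypothesis p2 : 2 < p.

Let p_gt0 : 0 < p. Proof. by apply: lt_trans p2. Qed.

(** The soliton divided by its maximum is a profile [w] with [w'] equal to a constant times
    [slope w], up to sign. The maximum with 0 extends the formula continuously beyond [|t| <= 1]. *)
Definition slope (t : R) := Num.sqrt (Num.max 0 (t ^+ 2 - `|t| `^ p)).

Lemma continuous_slope : continuous slope.
Proof.
move=> t; apply: (@continuous_comp _ _ _ (fun t : R => Num.max 0 (t ^+ 2 - `|t| `^ p)) Num.sqrt).
  apply: (@continuous_max _ _ (cst 0) (fun t : R => t ^+ 2 - `|t| `^ p)); first exact: cvg_cst.
  apply: cvgB; last exact: continuous_norm_powR.
  exact: exprn_continuous.
exact: sqrt_continuous.
Qed.

Lemma slopeN t : slope (- t) = slope t.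
Proof. by rewrite /slope sqrrN normrN. Qed.

Lemma norm_powR_le_sq t : `|t| <= 1 -> `|t| `^ p <= t ^+ 2.
Proof.
move=> t1; have [->|t0] := eqVneq t 0.
  by rewrite normr0 powR0 ?sqr_ge0// gt_eqF.
rewrite -(real_normK (num_real t)) -powR_mulrn//.
by apply: ger_powR; rewrite ?normr_gt0 ?t0// ltW.
Qed.

Lemma sqr_slope t : `|t| <= 1 -> slope t ^+ 2 = t ^+ 2 - `|t| `^ p.
Proof.
move=> t1; rewrite /slope sqr_sqrtr ?le_max ?lexx//.
by apply/max_idPr; rewrite subr_ge0 norm_powR_le_sq.
Qed.

Definition action : R -> R :=
  projT1 (cid2 (continuous_primitive continuous_slope)).

Lemma action_primitive : primitive_on setT action slope.
Proof. by rewrite /action; case: cid2. Qed.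

Lemma action0 : action 0 = 0.
Proof. by rewrite /action; case: cid2. Qed.

Lemma actionN t : action (- t) = - action t.
Proof.
wlog t0 : t / 0 <= t => [H|].
  have [/H//|/ltW t0] := leP 0 t.
  by move: (H (- t)); rewrite oppr_ge0 opprK => /(_ t0) ->; rewrite opprK.
have [_] := action_primitive I I t0; rewrite action0 subr0 => ->.
have mt0 : - t <= 0 by rewrite oppr_le0.
have [_] := action_primitive I I mt0; rewrite action0 sub0r => /eqP.
rewrite eqr_oppLR => /eqP ->; congr (- _).
have := Rint_oppr t0 continuous_slope; rewrite oppr0 => H; apply: etrans H _.
by apply: eq_Rintegral => x _; rewrite slopeN.
Qed.

Lemma action_ge0 t : 0 <= t -> 0 <= action t.
Proof.
move=> t0; have [_] := action_primitive I I t0; rewrite action0 subr0 => ->.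
by apply: Rintegral_ge0 => x _; exact: sqrtr_ge0.
Qed.

Lemma norm_action t : `|action t| = action `|t|.
Proof.
have [t0|/ltW t0] := leP 0 t; first by rewrite !ger0_norm// action_ge0.
rewrite (ler0_norm t0) actionN ler0_norm//.
by rewrite -oppr_ge0 -actionN action_ge0// oppr_ge0.
Qed.

(** The interval [1/4, 1/2] alone suffices: there t^2 >= 1/16 and t^(p - 2) is at most [q], which is
    below 1. *)
Lemma action1_gt0 : 0 < action 1.
Proof.
have [_] := action_primitive I I ler01; rewrite action0 subr0 => ->.
have p2' := p2; have si a b : (`[a, b]).-int slope.
  by apply: econt_integrable; apply: continuous_econt; exact: continuous_slope.
have s0 a b : 0 <= \int[leb]_(t in `[a, b]) slope t.
  by apply: Rintegral_ge0 => x _; exact: sqrtr_ge0.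
pose q := (2^-1 : R) `^ (p - 2).
have q1 : q < 1.
  have <- : 1 `^ (p - 2) = 1 :> R by rewrite powR1.
  by apply: gt0_ltr_powR; rewrite ?nnegrE ?subr_gt0//; lra.
have k0 : 0 < Num.sqrt ((1 - q) / 16) by rewrite sqrtr_gt0 divr_gt0// subr_gt0.
rewrite (@Rintegral_itv_cat _ slope 0 (4^-1) 1)//; last by lra.
rewrite (@Rintegral_itv_cat _ slope (4^-1) (2^-1) 1)//; [|by lra|by lra].
rewrite ltr_wpDl// ltr_pwDl//.
have h : (4^-1 : R) <= 2^-1 by lra.
apply: lt_le_trans (_ : \int[leb]_(t in `[4^-1, 2^-1]) Num.sqrt ((1 - q) / 16) <= _).
  by rewrite Rintegral_itv_cst// mulr_gt0//; lra.
apply: le_Rintegral => //; first exact: integrable_cst_itv.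
move=> t /=; rewrite in_itv/= => /andP[t4 t2].
have t0 : 0 < t by lra.
rewrite /slope ler_sqrt ?le_max ?lexx//; apply/orP; right.
rewrite (gtr0_norm t0) (_ : p = 2 + (p - 2)); last by ring.
rewrite powRD; last by rewrite (gt_eqF t0) implybT.
rewrite powR_mulrn ?(ltW t0)//.
have -> : t ^+ 2 - t ^+ 2 * t `^ (p - 2) = t ^+ 2 * (1 - t `^ (p - 2)) by ring.
have tq : t `^ (p - 2) <= q.
  by apply: ge0_ler_powR; rewrite ?nnegrE//; lra.
have t16 : 16^-1 <= t ^+ 2 by nra.
have : 0 <= 1 - t `^ (p - 2) by lra.
by move: (t `^ (p - 2)) (t ^+ 2) tq t16 => a b; nra.
Qed.

End calibration.

End action.

(** * Energy densities and passages between two values *)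

Section densities.
Context {R : realType}.
Implicit Types (D A B : set R) (f g u v w z : R -> R) (a b c x y r e : R).

Lemma primitive_onZ D u v c : primitive_on D u v ->
  primitive_on D (fun x => c * u x) (fun x => c * v x).
Proof.
move=> pu a b Da Db ab; have [vi Ev] := pu a b Da Db ab.
by split; [exact: intZ|rewrite -mulrBr Ev RintegralZl].
Qed.

Lemma le_Rint_sub A D f : measurable A -> measurable D -> A `<=` D -> D.-int f ->
  (forall x, D x -> 0 <= f x) ->
  \int[leb]_(x in A) f x <= \int[leb]_(x in D) f x.
Proof.
move=> mA mD AD fi f0; have fA : A.-int f by exact: integrableS fi.
rewrite -lee_fin -!Rint_fin//; apply: ge0_subset_integral => //.
by case/integrableP : fi.
Qed.

Lemma small_on_long D a b f e : measurable D -> `[a, b] `<=` D -> D.-int f ->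
  (forall x, D x -> 0 <= f x) -> a <= b -> \int[leb]_(x in D) f x < e * (b - a) ->
  exists2 x, a <= x <= b & f x < e.
Proof.
move=> mD abD fi f0 ab; apply: contraPP => H; apply/negP; rewrite -leNgt.
apply: le_trans (le_Rint_sub _ mD abD fi f0) => //.
rewrite -(Rintegral_itv_cst e ab); apply: le_Rintegral => //.
- exact: integrable_cst_itv.
- exact: integrableS fi.
- move=> x /=; rewrite in_itv/= => xab; rewrite leNgt; apply/negP => fxe.
  by apply: H; exists x.
Qed.

(** Averages [u x ^+ 2 <= 2 * u y ^+ 2 + 2 * V] over [y] in [x, x + 1], then uses [t <= t ^+ 2 + 1].
    The unit interval has to lie in [D], which excludes the pendant. *)
Lemma sobolev_bounded D u v : measurable D ->
  (forall x, D x -> `[x, x + 1] `<=` D) -> sobolev D u v ->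
  forall x, D x -> `|u x| <=
    2 * (\int[leb]_(x in D) u x ^+ 2) + 2 * (\int[leb]_(x in D) v x ^+ 2) + 1.
Proof.
move=> mD D1 [pu mu mv ui vi].
set U := \int[leb]_(x in D) u x ^+ 2; set V := \int[leb]_(x in D) v x ^+ 2.
have U0 : 0 <= U by apply: Rintegral_ge0 => x _; exact: sqr_ge0.
have V0 : 0 <= V by apply: Rintegral_ge0 => x _; exact: sqr_ge0.
move=> x Dx.
have x1 : x <= x + 1 by rewrite lerDl.
have sD := D1 _ Dx.
have Ix : `[x, x + 1] x by rewrite /= in_itv/= lexx.
have vi' : (`[x, x + 1]).-int (fun x => v x ^+ 2) by exact: integrableS vi.
have ui' : (`[x, x + 1]).-int (fun x => u x ^+ 2) by exact: integrableS ui.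
have pw y : x <= y <= x + 1 -> u x ^+ 2 <= 2 * u y ^+ 2 + 2 * V.
  move=> /andP[xy y1].
  have Iy : `[x, x + 1] y by rewrite /= in_itv/= xy.
  have [vxy E] := pu x y Dx (sD _ Iy) xy.
  have vxy2 : (`[x, y]).-int (fun x => v x ^+ 2) by exact: integrable_itv_sub vi'.
  have CS := cauchy_schwarz_itv xy vxy vxy2; rewrite -E in CS.
  have le1 : \int[leb]_(x in `[x, y]) v x ^+ 2 <= V.
    apply: le_Rint_sub => //; last by move=> t _; exact: sqr_ge0.
    by apply: subset_trans sD; apply: subset_itv; rewrite bnd_simp.
  have le0 : 0 <= \int[leb]_(x in `[x, y]) v x ^+ 2.
    by apply: Rintegral_ge0 => t _; exact: sqr_ge0.
  have : (u y - u x) ^+ 2 <= V.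
    apply: le_trans CS _; apply: le_trans le1.
    by rewrite ler_piMl//; lra.
  have := sqr_ge0 (u x - 2 * u y); nra.
have : u x ^+ 2 * (x + 1 - x) <= 2 * U + 2 * V * (x + 1 - x).
  rewrite -(Rintegral_itv_cst _ x1).
  apply: (@le_trans _ _ (\int[leb]_(y in `[x, x + 1]) (2 * u y ^+ 2 + 2 * V))).
    apply: le_Rintegral => //; first exact: integrable_cst_itv.
    - by apply: intD => //; [exact: intZ|exact: integrable_cst_itv].
  rewrite RintegralD//; [|exact: intZ|exact: integrable_cst_itv].
  rewrite Rintegral_itv_cst// lerD2r RintegralZl// ler_wpM2l//.
  by apply: le_Rint_sub => // t _; exact: sqr_ge0.
rewrite (_ : x + 1 - x = 1); last by ring.
rewrite !mulr1 -(real_normK (num_real (u x))) => H.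
have := sqr_ge0 (`|u x| - 1); nra.
Qed.

Section energy.
Variable p : R.
Hypothesis p2 : 2 < p.
Let p_gt0 : 0 < p. Proof. by apply: lt_trans p2. Qed.

Lemma powR_norm_split t : `|t| `^ p = `|t| `^ (p - 2) * t ^+ 2.
Proof.
have -> : p = (p - 2) + 2 by ring.
rewrite powRD; last by rewrite subrK gt_eqF.
by rewrite addrK powR_mulrn// real_normK// num_real.
Qed.

Lemma powR_norm_le t K : `|t| <= K -> `|t| `^ p <= K `^ (p - 2) * t ^+ 2.
Proof.
move=> tK; rewrite powR_norm_split ler_wpM2r ?sqr_ge0//.
have K0 : 0 <= K by exact: le_trans tK.
by apply: ge0_ler_powR; rewrite ?nnegrE// subr_ge0 ltW.
Qed.

Lemma int_powR D u K : measurable D -> measurable_fun D u ->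
  D.-int (fun x => u x ^+ 2) -> (forall x, D x -> `|u x| <= K) ->
  D.-int (fun x => `|u x| `^ p).
Proof.
move=> mD mu ui uK.
apply: (@int_le _ _ _ (fun x => K `^ (p - 2) * u x ^+ 2)) => //.
- apply: (@measurableT_comp _ _ _ _ _ _ (fun t : R => t `^ p) _ (fun x => `|u x|)).
    exact: measurable_powR.
  exact: measurableT_comp.
- by move=> x /uK ux; rewrite ger0_norm ?powR_ge0// powR_norm_le.
- exact: intZ.
Qed.

(* Completed by [c / p * M ^ (p - 2)] times the mass density, the energy
   density becomes a sum of two squares as long as [|u| <= M]. *)
Definition density c M u v x :=
  v x ^+ 2 / 2 + c / p * (M `^ (p - 2) * u x ^+ 2 - `|u x| `^ p).

(** With u = M w the second term of the density is c / p * M^p times w^2 - |w|^p, which is the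
    square of [slope w] as long as |w| <= 1. *)
Lemma density_squares c M u v x : 0 < M -> 0 <= c -> `|u x| <= M ->
  density c M u v x = v x ^+ 2 / 2 +
    (Num.sqrt (2 * c / p * M `^ (p - 2)) * M * slope p (M^-1 * u x)) ^+ 2 / 2.
Proof.
move=> M0 c0 uM.
have k0 : 0 <= 2 * c / p * M `^ (p - 2).
  by rewrite mulr_ge0 ?powR_ge0// divr_ge0 ?mulr_ge0// ltW.
have w1 : `|M^-1 * u x| <= 1.
  by rewrite normrM normfV (gtr0_norm M0) mulrC ler_pdivrMr// mul1r.
have Mp : M `^ p = M `^ (p - 2) * M ^+ 2.
  by have := powR_norm_split M; rewrite gtr0_norm.
have Minv : M^-1 `^ p = (M `^ p)^-1.
  by rewrite -(powR_inv1 (ltW M0)) -powRrM mulN1r powRN.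
have Mp0 : M `^ (p - 2) != 0 by rewrite gt_eqF// powR_gt0.
have M0' : M != 0 by rewrite gt_eqF.
have p0' : p != 0 by rewrite gt_eqF.
rewrite /density !exprMn sqr_sqrtr// sqr_slope//.
rewrite normrM normfV (gtr0_norm M0) powRM ?invr_ge0 ?(ltW M0)//.
rewrite Minv Mp.
by field; rewrite M0' Mp0 p0'.
Qed.

Lemma density_ge0 c M u v x : 0 < M -> 0 <= c -> `|u x| <= M -> 0 <= density c M u v x.
Proof.
by move=> M0 c0 uM; rewrite density_squares// addr_ge0// divr_ge0// sqr_ge0.
Qed.

Lemma int_density D c M u v : measurable D ->
  sobolev D u v -> (forall x, D x -> `|u x| <= M) -> D.-int (density c M u v).
Proof.
move=> mD [_ mu mv ui vi] uM; rewrite /density.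
apply: intD => //.
  by under [X in _.-int X]eq_fun do rewrite mulrC; exact: intZ.
apply: intZ => //; apply: intB => //; first exact: intZ.
exact: int_powR uM.
Qed.

Lemma Rint_density D c M u v : measurable D ->
  sobolev D u v -> (forall x, D x -> `|u x| <= M) ->
  \int[leb]_(x in D) density c M u v x =
  (\int[leb]_(x in D) v x ^+ 2) / 2 + c / p * (M `^ (p - 2) *
     (\int[leb]_(x in D) u x ^+ 2) - \int[leb]_(x in D) `|u x| `^ p).
Proof.
move=> mD [_ mu mv ui vi] uM.
have upi := int_powR mD mu ui uM.
have vi2 : D.-int (fun x => v x ^+ 2 / 2).
  by under [X in _.-int X]eq_fun do rewrite mulrC; exact: intZ.
have ui2 : D.-int (fun x => M `^ (p - 2) * u x ^+ 2) by exact: intZ.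
rewrite /density RintegralD//; last by apply: intZ => //; exact: intB.
rewrite RintegralZr// RintegralZl//; last exact: intB.
by rewrite RintegralB// RintegralZl.
Qed.

(** One factor [M] comes from the second square in [density_squares], the other from differentiating
    [u / M]. In [M] this is a multiple of M^((p + 2) / 2). *)
Definition calib c M := Num.sqrt (2 * c / p * M `^ (p - 2)) * M ^+ 2.

Lemma calib_ge0 c M : 0 <= calib c M.
Proof. by rewrite mulr_ge0 ?sqrtr_ge0 ?sqr_ge0. Qed.

(** a^2 / 2 + b^2 / 2 >= |a b| for the two squares; the product is [calib c M] times the derivative
    of [action (u / M)]. *)
Lemma path_bound D c M u v a b : is_interval D -> 0 < M -> 0 <= c ->
  sobolev D u v -> (forall x, D x -> `|u x| <= M) -> D a -> D b -> a <= b ->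
  calib c M * `|action p2 (u b / M) - action p2 (u a / M)| <=
    \int[leb]_(x in `[a, b]) density c M u v x.
Proof.
move=> iD M0 c0 su uM Da Db ab; have [pu mu mv ui vi] := su.
have sD := is_interval_sub_itv iD Da Db.
have mD : measurable D by exact: is_interval_measurable.
have pw := primitive_onZ M^-1 pu.
have cs : econt setT (slope p) by apply: continuous_econt; exact: continuous_slope.
have [ci Ec] := primitive_on_comp iD (action_primitive p2) cs pw Da Db ab.
rewrite ![u _ / M]mulrC Ec.
rewrite -[calib _ _]ger0_norm ?calib_ge0// -normrM -RintegralZl//.
rewrite -[leRHS]mul1r; apply: le_Rint_norm => //.
- exact: intZ.
- by apply: integrableS (int_density c mD su uM).
move=> x /sD/uM ux; rewrite mul1r density_squares// ler_norml.
rewrite /calib; set k := Num.sqrt _; set s := slope _ _.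
have -> : k * M ^+ 2 * (s * (M^-1 * v x)) = (k * M * s) * v x by field; rewrite gt_eqF.
have := sqr_ge0 (k * M * s - v x); have := sqr_ge0 (k * M * s + v x).
by move: (k * M * s) => q; move: (v x) => r; clear=> ? ?; apply/andP; split; nra.
Qed.

(** The supremum [M] need not be attained and [u] need not vanish anywhere; continuity of [action]
    at 1 and at 0 lets nearly extremal points serve instead, at the cost of [e]. *)
Lemma action_gap M e : 0 < M -> 0 < e -> exists2 d : R, 0 < d &
  forall s t, `|s| <= M -> M - d < `|s| -> `|t| < d ->
    action p2 1 - e <= `|action p2 (s / M) - action p2 (t / M)|.
Proof.
move=> M0 e0; have e2 : 0 < e / 2 by rewrite divr_gt0.
have ca := primitive_on_econt (action_primitive p2).
have [d1 d10 H1] := ca 1 I _ e2; have [d0 d00 H0] := ca 0 I _ e2.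
exists (M * Num.min d1 d0); first by rewrite mulr_gt0// lt_min d10.
move=> s t sM sd td.
have n1 : `|action p2 (`|s| / M) - action p2 1| <= e / 2.
  apply: H1 => //; rewrite ler0_norm; last by rewrite subr_le0 ler_pdivrMr// mul1r.
  rewrite opprB ltrBlDr -ltrBlDl ltr_pdivlMr//.
  apply: le_lt_trans sd; rewrite mulrBl mul1r lerD2l lerN2 mulrC.
  by rewrite ler_pM2r// ge_min lexx.
have n0 : `|action p2 (t / M)| <= e / 2.
  have := H0 (t / M) I; rewrite action0 !subr0; apply.
  rewrite normrM normfV (gtr0_norm M0) ltr_pdivrMr//.
  apply: lt_le_trans td _; rewrite mulrC ler_pM2r//.
  by rewrite ge_min lexx orbT.
have := ler_dist_dist (action p2 (s / M)) (action p2 (t / M)).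
rewrite (norm_action p2 (s / M)) normrM normfV (gtr0_norm M0).
move: n1; rewrite !ler_norml => /andP[? _] /andP[_].
by move=> ?; lra.
Qed.

End energy.

End densities.

Section calibration.
Context {R : realType}.
Implicit Types (D A B : set R) (f g u v w z : R -> R) (a b c x y r e : R).

Lemma norm_sup D u K : D !=set0 -> (forall x, D x -> `|u x| <= K) ->
  exists M, (forall x, D x -> `|u x| <= M) /\
    forall d, 0 < d -> exists2 x, D x & M - d < `|u x|.
Proof.
move=> [x0 Dx0] uK; pose S := [set `|u x| | x in D].
have hS : has_sup S.
  by split; [exists `|u x0|; exists x0|exists K => _ [x Dx <-]; exact: uK].
exists (sup S); split => [x Dx|d d0].
  by apply: ub_le_sup; [exact: hS.2|exists x].
by have [_ [x Dx <-] ux] := sup_adherent d0 hS; exists x.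
Qed.

Lemma le_of_eps_mul (k A I : R) : 0 <= k -> (forall e, 0 < e -> k * (A - e) <= I) -> k * A <= I.
Proof.
move=> k0 H; apply/ler_addgt0Pr => e e0.
have k1 : 0 < k + 1 by rewrite ltr_wpDl.
have := H (e / (k + 1)); rewrite divr_gt0// => /(_ isT).
have : k * (e / (k + 1)) <= e.
  by rewrite mulrA ler_pdivrMr// mulrC ler_pM2l// lerDl.
by rewrite mulrBr; lra.
Qed.

Definition ray : set R := `[0, +oo[.

Lemma rayP x : ray x <-> 0 <= x.
Proof. by rewrite /ray /= in_itv/= andbT. Qed.

Lemma ray_interval : is_interval ray.
Proof. exact: interval_is_interval. Qed.

Lemma measurable_ray : measurable ray.
Proof. by rewrite /ray. Qed.
#[local] Hint Resolve measurable_ray : core.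

Lemma ray_exhausted : exhausted ray.
Proof.
exists (fun=> 0), (fun n => n%:R); split.
- by move=> n; split; [apply/rayP|apply/rayP; exact: ler0n|exact: ler0n].
- by move=> n m nm; rewrite ler_nat.
- move=> x /rayP x0; exists (Num.truncn x).+1; rewrite x0/=.
  exact: ltW (truncnS_gt _).
Qed.

Lemma setT_interval : is_interval [set: R].
Proof. by []. Qed.

Lemma setT_exhausted : exhausted [set: R].
Proof.
exists (fun n => - n%:R), (fun n => n%:R); split.
- by move=> n; split => //; apply: (@le_trans _ _ 0); rewrite ?oppr_le0 ler0n.
- by move=> n m nm; rewrite lerN2 ler_nat.
- move=> x _; exists (Num.truncn `|x|).+1; rewrite -ler_norml.
  exact: ltW (truncnS_gt _).
Qed.

Lemma itv_exhausted a b : a <= b -> exhausted `[a, b].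
Proof.
move=> ab; exists (fun=> a), (fun=> b); split => //.
- by move=> n; rewrite /= !in_itv/= !lexx ab.
- by move=> x /=; rewrite in_itv/= => xab; exists 0%N.
Qed.

Lemma small_on_ray f e X : ray.-int f -> (forall x, 0 <= x -> 0 <= f x) ->
  0 < e -> 0 <= X -> exists2 x, X <= x & f x < e.
Proof.
move=> fi f0 e0 X0.
pose L := (\int[leb]_(x in ray) f x) / e + 1.
have I0 : 0 <= \int[leb]_(x in ray) f x by apply: Rintegral_ge0 => x /rayP; exact: f0.
have L0 : 0 < L by rewrite ltr_wpDl// divr_ge0// ltW.
have XL : X <= X + L by rewrite lerDl ltW.
have sXL : `[X, X + L] `<=` ray.
  by move=> x /=; rewrite in_itv/= => /andP[Xx _]; apply/rayP; exact: le_trans Xx.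
have f0' x : ray x -> 0 <= f x by move=> /rayP; exact: f0.
have IL : \int[leb]_(x in ray) f x < e * (X + L - X).
  rewrite addrAC subrr add0r /L mulrDr mulr1 mulrCA divff ?gt_eqF// mulr1.
  by rewrite ltrDl.
have [x /andP[Xx _] fx] := small_on_long measurable_ray sXL fi f0' XL IL.
by exists x.
Qed.

Lemma ray_approx f e : ray.-int f -> (forall x, 0 <= x -> 0 <= f x) -> 0 < e ->
  exists2 B, 0 <= B & forall b, B <= b ->
    \int[leb]_(x in ray) f x <= \int[leb]_(x in `[0, b]) f x + e.
Proof.
move=> fi f0 e0.
have f0' x : ray x -> 0 <= f x by move=> /rayP; exact: f0.
have [a [B [/rayP a0 /rayP B0 aB H]]] :=
  Rint_exhausted_lt ray_interval ray_exhausted fi f0' e0.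
exists B => // b Bb; apply: le_trans H _; rewrite lerD2r.
apply: le_Rint_sub => //.
- by apply: subset_itv; rewrite bnd_simp.
- apply: integrableS fi => // x /=; rewrite in_itv/= => /andP[x0 _]; exact/rayP.
- by move=> x /=; rewrite in_itv/= => /andP[x0 _]; exact: f0.
Qed.

Lemma int_ray_itv f a b : 0 <= a -> ray.-int f -> (`[a, b]).-int f.
Proof.
move=> a0; apply: integrableS => // x /=; rewrite in_itv/= => /andP[ax _].
by apply/rayP; exact: le_trans ax.
Qed.

Section lower_bounds.
Variable p : R.
Hypothesis p2 : 2 < p.

Lemma line_density_ge M u v : 0 < M -> sobolev setT u v -> (forall x, `|u x| <= M) ->
  (forall d, 0 < d -> exists x, M - d < `|u x|) ->
  2 * calib p 1 M * action p2 1 <= \int[leb]_x density p 1 M u v x.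
Proof.
move=> M0 su uM Msup; apply: le_of_eps_mul.
  by rewrite mulr_ge0// calib_ge0.
move=> e e0; have [d d0 gap] := action_gap p2 M0 e0.
have [x0 x0M] := Msup d d0.
have [_ _ _ ui _] := su.
(* An interval of length [L] on which [|u| >= d] would carry more than the whole mass; small values
   therefore exist on both sides of [x0]. *)
pose L := (\int[leb]_x u x ^+ 2) / d ^+ 2 + 1.
have d20 : 0 < d ^+ 2 by rewrite exprn_gt0.
have L0 : 0 < L by rewrite ltr_wpDl// divr_ge0 ?(ltW d20)// Rintegral_ge0// => x _; exact: sqr_ge0.
have LI : \int[leb]_x u x ^+ 2 < d ^+ 2 * L.
  by rewrite /L mulrDr mulr1 mulrCA divff ?gt_eqF// mulr1 ltrDl.
have sm a : exists2 x, a <= x <= a + L & `|u x| < d.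
  have aL : a <= a + L by rewrite lerDl ltW.
  have aI : \int[leb]_x u x ^+ 2 < d ^+ 2 * (a + L - a) by rewrite addrAC subrr add0r.
  have [x xa ux] := @small_on_long R setT a (a + L) _ _ measurableT (@subsetT _ _) ui (fun x _ => sqr_ge0 _) aL aI.
  exists x => //; move: ux; rewrite -(real_normK (num_real (u x))).
  by rewrite ltr_pXn2r// nnegrE// ltW.
have [X /andP[x0X _] uX] := sm x0.
have [Y /andP[_ Yx0] uY] := sm (x0 - L); rewrite subrK in Yx0.
have di : setT.-int (density p 1 M u v) by apply: int_density.
have P1 := path_bound p2 setT_interval M0 ler01 su (fun x _ => uM x) I I Yx0.
have P2 := path_bound p2 setT_interval M0 ler01 su (fun x _ => uM x) I I x0X.
have G1 := gap _ _ (uM x0) x0M uY.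
have G2 := gap _ _ (uM x0) x0M uX; rewrite distrC in G2.
have YX : Y <= X by exact: le_trans x0X.
apply: (@le_trans _ _ (\int[leb]_(x in `[Y, X]) density p 1 M u v x)); last first.
  by apply: le_Rint_sub => // x _; exact: density_ge0.
rewrite (@Rintegral_itv_cat _ _ Y x0 X)//; last exact: integrableS di.
apply: le_trans (lerD P1 P2); rewrite -mulrA mulr_natl mulr2n.
by apply: lerD; rewrite ler_wpM2l// calib_ge0.
Qed.

Lemma ray_small u v d x0 : sobolev ray u v -> 0 < d -> 0 <= x0 ->
  exists2 X, x0 <= X & `|u X| < d.
Proof.
move=> [_ _ _ ui _] d0 x00.
have [X x0X uX] := small_on_ray ui (fun x _ => sqr_ge0 _) (exprn_gt0 2 d0) x00.
exists X => //; move: uX; rewrite -(real_normK (num_real (u X))).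
by rewrite ltr_pXn2r// nnegrE// ltW.
Qed.

Lemma ray_density_ge M c u v a b : 0 < M -> 0 <= c -> sobolev ray u v ->
  (forall x, 0 <= x -> `|u x| <= M) -> 0 <= a -> a <= b ->
  \int[leb]_(x in `[a, b]) density p c M u v x <= \int[leb]_(x in ray) density p c M u v x.
Proof.
move=> M0 c0 su uM a0 ab.
have uM' x : ray x -> `|u x| <= M by move=> /rayP; exact: uM.
apply: le_Rint_sub => //.
- by move=> x /=; rewrite in_itv/= => /andP[ax _]; apply/rayP; exact: le_trans ax.
- exact: int_density.
- by move=> x /uM'; exact: density_ge0.
Qed.

(** One passage leads outwards along the first half-line. The other runs from [x0] back to the
    vertex and out along the second; its two legs are joined by the triangle inequality at the
    common value [u1 0 = u2 0]. *)
Lemma two_rays_density_ge M u1 v1 u2 v2 : 0 < M ->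
  sobolev ray u1 v1 -> sobolev ray u2 v2 -> u1 0 = u2 0 ->
  (forall x, 0 <= x -> `|u1 x| <= M) -> (forall x, 0 <= x -> `|u2 x| <= M) ->
  (forall d, 0 < d -> exists2 x, 0 <= x & M - d < `|u1 x|) ->
  2 * calib p 1 M * action p2 1 <=
    \int[leb]_(x in ray) density p 1 M u1 v1 x + \int[leb]_(x in ray) density p 1 M u2 v2 x.
Proof.
move=> M0 s1 s2 u12 uM1 uM2 Msup; apply: le_of_eps_mul.
  by rewrite mulr_ge0// calib_ge0.
move=> e e0; have [d d0 gap] := action_gap p2 M0 e0.
have [x0 x00 x0M] := Msup d d0.
have [X x0X uX] := ray_small s1 d0 x00.
have [Y Y0 uY] := ray_small s2 d0 (lexx 0).
have uM1' x : ray x -> `|u1 x| <= M by move=> /rayP; exact: uM1.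
have uM2' x : ray x -> `|u2 x| <= M by move=> /rayP; exact: uM2.
have r0 : ray 0 by apply/rayP.
have rx0 : ray x0 by apply/rayP.
have rX : ray X by apply/rayP; exact: le_trans x0X.
have rY : ray Y by apply/rayP.
have P1 := path_bound p2 ray_interval M0 ler01 s1 uM1' r0 rx0 x00.
have P2 := path_bound p2 ray_interval M0 ler01 s1 uM1' rx0 rX x0X.
have P3 := path_bound p2 ray_interval M0 ler01 s2 uM2' r0 rY Y0.
have G1 := gap _ _ (uM1 _ x00) x0M uX; rewrite distrC in G1.
have G2 := gap _ _ (uM1 _ x00) x0M uY.
have X0 : 0 <= X by exact: le_trans x0X.
have R1 := ray_density_ge M0 ler01 s1 uM1 (lexx 0) X0.
have R2 := ray_density_ge M0 ler01 s2 uM2 (lexx 0) Y0.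
rewrite (@Rintegral_itv_cat _ _ 0 x0 X)// in R1; last first.
  by apply: int_ray_itv => //; exact: int_density.
apply: le_trans (lerD R1 R2); rewrite addrAC.
apply: le_trans (_ : calib p 1 M * (action p2 1 - e) + calib p 1 M * (action p2 1 - e) <= _).
  by rewrite -mulrA mulr_natl mulr2n.
apply: lerD; last by apply: le_trans P2; rewrite ler_wpM2l// calib_ge0.
apply: le_trans (lerD P1 P3); rewrite -mulrDr ler_wpM2l ?calib_ge0//.
apply: le_trans G2 _; rewrite u12.
rewrite (distrC (action p2 (u2 Y / M))).
by apply: le_trans (ler_normD _ _); rewrite addrA subrK.
Qed.

(** A single passage, hence half of the bound on the line; with the free weight [c] this weaker
    estimate serves coercivity. *)
Lemma ray_density_path M c u v : 0 < M -> 0 <= c ->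
  sobolev ray u v ->
  (forall x, 0 <= x -> `|u x| <= M) ->
  (forall d, 0 < d -> exists2 x, 0 <= x & M - d < `|u x|) ->
  calib p c M * action p2 1 <= \int[leb]_(x in ray) density p c M u v x.
Proof.
move=> M0 c0 s1 uM1 Msup; apply: le_of_eps_mul; first exact: calib_ge0.
move=> e e0; have [d d0 gap] := action_gap p2 M0 e0.
have [x0 x00 x0M] := Msup d d0.
have [X x0X uX] := ray_small s1 d0 x00.
have uM1' x : ray x -> `|u x| <= M by move=> /rayP; exact: uM1.
have rx0 : ray x0 by apply/rayP.
have rX : ray X by apply/rayP; exact: le_trans x0X.
have P2 := path_bound p2 ray_interval M0 c0 s1 uM1' rx0 rX x0X.
have G1 := gap _ _ (uM1 _ x00) x0M uX; rewrite distrC in G1.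
apply: le_trans (ray_density_ge M0 c0 s1 uM1 x00 x0X).
by apply: le_trans P2; rewrite ler_wpM2l// calib_ge0.
Qed.

Lemma pendant_density_path M c l u0 v0 u v : 0 < M -> 0 <= c -> 0 <= l ->
  sobolev `[0, l] u0 v0 -> sobolev ray u v -> u0 0 = u 0 ->
  (forall x, 0 <= x <= l -> `|u0 x| <= M) -> (forall x, 0 <= x -> `|u x| <= M) ->
  (forall d, 0 < d -> exists2 x, 0 <= x <= l & M - d < `|u0 x|) ->
  calib p c M * action p2 1 <= \int[leb]_(x in `[0, l]) density p c M u0 v0 x
   + \int[leb]_(x in ray) density p c M u v x.
Proof.
move=> M0 c0 l0 s0 s1 u01 uM0 uM1 Msup; apply: le_of_eps_mul; first exact: calib_ge0.
move=> e e0; have [d d0 gap] := action_gap p2 M0 e0.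
have [x0 /andP[x00 x0l] x0M] := Msup d d0.
have [X X0 uX] := ray_small s1 d0 (lexx 0).
have uM0' x : `[0, l] x -> `|u0 x| <= M by rewrite /= in_itv; exact: uM0.
have uM1' x : ray x -> `|u x| <= M by move=> /rayP; exact: uM1.
have I0 : `[0, l] 0 by rewrite /= in_itv/= lexx.
have Ix0 : `[0, l] x0 by rewrite /= in_itv/= x00.
have r0 : ray 0 by apply/rayP.
have rX : ray X by apply/rayP.
have il : is_interval `[0, l] by exact: interval_is_interval.
have P1 := path_bound p2 il M0 c0 s0 uM0' I0 Ix0 x00.
have P2 := path_bound p2 ray_interval M0 c0 s1 uM1' r0 rX X0.
have x0M' : `|u0 x0| <= M by exact: uM0'.
have G1 := gap _ _ x0M' x0M uX.
have R2 := ray_density_ge M0 c0 s1 uM1 (lexx 0) X0.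
have R1 : \int[leb]_(x in `[0, x0]) density p c M u0 v0 x <=
    \int[leb]_(x in `[0, l]) density p c M u0 v0 x.
  apply: le_Rint_sub => //.
  - by apply: subset_itv; rewrite bnd_simp.
  - exact: int_density.
  - by move=> x /uM0'; exact: density_ge0.
apply: le_trans (lerD R1 R2); apply: le_trans (lerD P1 P2).
rewrite -mulrDr ler_wpM2l ?calib_ge0//.
apply: le_trans G1 _; rewrite u01 (distrC (action p2 (u X / M))).
by apply: le_trans (ler_normD _ _); rewrite addrA subrK.
Qed.

End lower_bounds.

End calibration.

#[local] Hint Extern 0 (@measurable _ _ _) => solve [exact: measurable_ray] : core.

(** * The soliton *)

Section hyperbolic.
Context {R : realType}.
Implicit Types (D A B : set R) (f g u v w z : R -> R) (a b c x y r e : R).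

(** Twice the hyperbolic cosine, not its square. *)
Definition cosh2 (x : R) := expR x + expR (- x).
Definition tanh (x : R) := (expR x - expR (- x)) / cosh2 x.

Lemma cosh2_gt0 x : 0 < cosh2 x.
Proof. by rewrite addr_gt0 ?expR_gt0. Qed.

Lemma is_derive_expRN x : is_derive x 1 (fun t : R => expR (- t)) (- expR (- x)).
Proof.
have dN : is_derive x 1 (fun t : R => - t) (-1) by apply: is_deriveN.
have := @is_derive1_comp R expR (fun t : R => - t) x _ _ (is_derive_expR _) dN.
by rewrite mulrN1.
Qed.

Lemma is_derive_cosh2 x : is_derive x 1 cosh2 (expR x - expR (- x)).
Proof. by have h := is_derive_expRN x; apply: is_deriveD. Qed.

Lemma is_derive_tanh x : is_derive x 1 tanh (1 - tanh x ^+ 2).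
Proof.
have h := is_derive_expRN x; have hc := is_derive_cosh2 x.
have c0 : cosh2 x != 0 by rewrite gt_eqF// cosh2_gt0.
have hi : is_derive x 1 (fun t => (cosh2 t)^-1) (- (cosh2 x) ^- 2 * (expR x - expR (- x))).
  exact: is_deriveV.
apply: is_derive_eq; rewrite /GRing.scale/= /tanh.
have -> : expR x - - expR (- x) = cosh2 x by rewrite opprK.
by field.
Qed.

Lemma sqr_tanh_lt1 x : tanh x ^+ 2 < 1.
Proof.
rewrite /tanh expr_div_n ltr_pdivrMr ?exprn_gt0 ?cosh2_gt0// mul1r /cosh2.
have := expR_gt0 x; have := expR_gt0 (- x); nra.
Qed.

Lemma tanh_ge0 x : 0 <= x -> 0 <= tanh x.
Proof.
move=> x0; rewrite divr_ge0 ?(ltW (cosh2_gt0 _))// subr_ge0 ler_expR; lra.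
Qed.

Lemma tanhN x : tanh (- x) = - tanh x.
Proof. by rewrite /tanh /cosh2 opprK (addrC (expR (- x)) (expR x)) -mulNr opprB. Qed.

Lemma continuous_derivable f (g : R -> R) : (forall x, is_derive x 1 f (g x)) -> continuous f.
Proof.
move=> df x; apply: differentiable_continuous; apply/derivable1_diffP.
by have [] := df x.
Qed.

(* The hyperbolic secant to the power q. *)
Definition sechq q x := expR (- q * ln (cosh2 x / 2)).

Lemma is_derive_sechq q x : is_derive x 1 (sechq q) (- q * tanh x * sechq q x).
Proof.
have c0 : 0 < cosh2 x / 2 by rewrite divr_gt0// cosh2_gt0.
have hc : is_derive x 1 (fun t => cosh2 t / 2) ((expR x - expR (- x)) / 2).
  have := is_derive_cosh2 x => h; apply: is_derive_eq.
  by rewrite /GRing.scale/=; field.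
have hl : is_derive x 1 (fun t => ln (cosh2 t / 2)) ((cosh2 x / 2)^-1 * ((expR x - expR (- x)) / 2)).
  exact: (@is_derive1_comp R (@ln R) (fun t => cosh2 t / 2) x _ _ (is_derive1_ln c0) hc).
have hm : is_derive x 1 (fun t => - q * ln (cosh2 t / 2)) (- q * tanh x).
  apply: is_derive_eq; rewrite /GRing.scale/= /tanh.
  by field; rewrite gt_eqF// cosh2_gt0.
have := @is_derive1_comp R expR _ x _ _ (is_derive_expR _) hm.
by rewrite mulrC.
Qed.

Lemma sechq_gt0 q x : 0 < sechq q x. Proof. exact: expR_gt0. Qed.

Lemma sechqN q x : sechq q (- x) = sechq q x.
Proof. by rewrite /sechq /cosh2 opprK addrC. Qed.

Lemma sechq0 q : sechq q 0 = 1.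
Proof. by rewrite /sechq /cosh2 oppr0 expR0 divff ?ln1 ?mulr0 ?expR0// pnatr_eq0. Qed.

Lemma sechq_powR q r x : q * r = 2 -> sechq q x `^ r = 1 - tanh x ^+ 2.
Proof.
move=> qr; have c0 : 0 < cosh2 x / 2 by rewrite divr_gt0// cosh2_gt0.
rewrite /sechq -expRM mulrAC mulNr qr mulNr expRN.
have -> : 2 * ln (cosh2 x / 2) = ln (cosh2 x / 2) * 2%:R by rewrite mulrC.
rewrite expRM_natr lnK ?posrE// /tanh /cosh2.
have e0 := expR_gt0 x; have e1 : expR (- x) = (expR x)^-1 by rewrite expRN.
rewrite e1; have e2 : expR x ^+ 2 + 1 != 0 by rewrite gt_eqF// addr_gt0// exprn_gt0.
field; rewrite (gt_eqF e0)/= -expr2.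
by rewrite e2.
Qed.

Lemma sechq_le q x : 0 <= q -> sechq q x <= expR (q * ln 2) * expR (- q * x).
Proof.
move=> q0; rewrite -expRD ler_expR -[q * ln 2]opprK -mulNr -mulrN -mulrDr !mulNr lerN2 ler_wpM2l//.
have c0 : 0 < cosh2 x / 2 by rewrite divr_gt0// cosh2_gt0.
rewrite -[leLHS]expRK ler_ln ?posrE ?expR_gt0// expRD expRN lnK ?posrE//.
by rewrite mulrC ler_pM2r ?invr_gt0// lerDl expR_ge0.
Qed.

Lemma sechq_le1 q x : 0 <= q -> sechq q x <= 1.
Proof.
move=> q0; rewrite /sechq -[leRHS](expR0 R) ler_expR mulNr oppr_le0 mulr_ge0//.
apply: ln_ge0; rewrite ler_pdivlMr// mul1r /cosh2 expRN.
have e0 := expR_gt0 x.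
rewrite -subr_ge0 (_ : expR x + (expR x)^-1 - 2 = (expR x - 1) ^+ 2 / expR x); last by field; exact: lt0r_neq0.
by rewrite divr_ge0 ?sqr_ge0// ltW.
Qed.

Lemma int_ray_expR c : 0 < c -> ray.-int (fun x => expR (- c * x)).
Proof.
move=> c0.
have cexp : continuous (fun x => expR (- c * x)).
  move=> x; apply: (@continuous_comp _ _ _ (fun x : R => - c * x) expR); last exact: continuous_expR.
  by apply: cvgM; [exact: cvg_cst|exact: cvg_id].
have mexp : measurable_fun ray (fun x => expR (- c * x)).
  by apply: econt_measurable; [exact: ray_interval|exact: continuous_econt].
have pe : primitive_on setT (fun x => - c^-1 * expR (- c * x)) (fun x => expR (- c * x)).
  apply: primitive_on_is_derive => // x.
  have hl : is_derive x 1 (fun t : R => - c * t) (- c).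
    by apply: (@is_derive_quadratic_error _ _ _ 0) => t; rewrite mul0r (_ : _ - _ = 0) ?normr0//; ring.
  have he := @is_derive1_comp R expR _ x _ _ (is_derive_expR _) hl.
  apply: is_derive_eq; rewrite /GRing.scale/=; field; exact: lt0r_neq0.
have bnd a b : ray a -> ray b -> a <= b -> (`[a, b]).-int (fun x => expR (- c * x)) /\
    \int[leb]_(x in `[a, b]) expR (- c * x) <= c^-1.
  move=> /rayP a0 /rayP b0 ab; have [ei <-] := pe a b I I ab; split => //.
  have e1 : expR (- c * a) <= 1.
    by rewrite -[leRHS](expR0 R) ler_expR mulNr oppr_le0 mulr_ge0// ltW.
  rewrite -[leRHS]mulr1 -mulrBr mulNr -mulrN ler_pM2l ?invr_gt0//.
  by have := expR_ge0 (- c * b); lra.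
by have [] := int_exhausted (@ray_interval R) (@ray_exhausted R) mexp (fun x _ => expR_ge0 _) bnd.
Qed.

End hyperbolic.

Section soliton_profile.
Context {R : realType}.
Implicit Types (D A B : set R) (f g u v w z : R -> R) (a b c x y r e : R).

Lemma Rint_setT_even f : continuous f -> (forall x, 0 <= f x) -> (forall x, f (- x) = f x) ->
  ray.-int f -> setT.-int f /\ \int[leb]_x f x = 2 * \int[leb]_(x in ray) f x.
Proof.
move=> cf f0 fN fi.
have E : (\int[leb]_x (f x)%:E = (2 * \int[leb]_(x in ray) f x)%:E)%E.
  rewrite ge0_symfun_integralT//; last by move=> x /=; rewrite fN.
  by rewrite -set_itvcy EFinM -Rint_fin.
have fT : setT.-int f.
  apply: int_nneg => //; first exact: continuous_measurable_fun.
  by rewrite E ltry.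
by split => //; rewrite /Rintegral E.
Qed.

Lemma continuous_sqr f : continuous f -> continuous (fun x => f x ^+ 2).
Proof.
move=> cf x; apply: (@continuous_comp _ _ _ f (fun t : R => t ^+ 2)); first exact: cf.
exact: exprn_continuous.
Qed.

Section soliton.
Variables p M : R.
Hypotheses (p2 : 2 < p) (M0 : 0 < M).

Let p_gt0 : 0 < p. Proof. by apply: lt_trans p2. Qed.
Let q : R := 2 / (p - 2).
Let P : R := M `^ (p - 2).
Let lam : R := 2 / p * P.
(** The rate for which [q * k] is the square root of [lam], so that the profile satisfies the first
    integral dsol^2 = 2 / p * (M^(p - 2) sol^2 - sol^p). The exponent [q] is the quotient of alpha
    by beta. *)
Definition soliton_rate := Num.sqrt lam / q.
Local Notation k := soliton_rate.

(* Opaque, as unification would otherwise compare exponential series. *)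
Fact sol_sig : {f | forall x, f x = M * sechq q (k * x)}.
Proof. by exists (fun x => M * sechq q (k * x)). Qed.
Definition sol : R -> R := sval sol_sig.

Lemma solE x : sol x = M * sechq q (k * x).
Proof. exact: (svalP sol_sig). Qed.

Fact dsol_sig : {f | forall x, f x = - Num.sqrt lam * tanh (k * x) * sol x}.
Proof. by exists (fun x => - Num.sqrt lam * tanh (k * x) * sol x). Qed.
Definition dsol : R -> R := sval dsol_sig.

Lemma dsolE x : dsol x = - Num.sqrt lam * tanh (k * x) * sol x.
Proof. exact: (svalP dsol_sig). Qed.

Local Notation sg x := (tanh (k * x)).

Let q0 : 0 < q. Proof. by rewrite divr_gt0// subr_gt0. Qed.
Let P0 : 0 < P. Proof. exact: powR_gt0. Qed.
Let lam0 : 0 < lam. Proof. by rewrite mulr_gt0// divr_gt0. Qed.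
Let sl0 : 0 < Num.sqrt lam. Proof. by rewrite sqrtr_gt0. Qed.
Let k0 : 0 < k. Proof. by rewrite divr_gt0. Qed.
Let qk : q * k = Num.sqrt lam. Proof. by rewrite /k mulrC divfK// gt_eqF. Qed.
Let slE : Num.sqrt lam ^+ 2 = lam. Proof. by rewrite sqr_sqrtr// ltW. Qed.
Let qp : q * (p - 2) = 2. Proof. by rewrite /q divfK// gt_eqF// subr_gt0. Qed.

Let is_derive_lin c x : is_derive x 1 (fun t : R => c * t) c.
Proof.
by apply: (@is_derive_quadratic_error _ _ _ 0) => t; rewrite mul0r (_ : _ - _ = 0) ?normr0//; ring.
Qed.

Lemma is_derive_sol x : is_derive x 1 sol (dsol x).
Proof.
have h := @is_derive1_comp R (sechq q) _ x _ _ (is_derive_sechq q _) (is_derive_lin k x).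
have h2 : is_derive x 1 (fun t => M * sechq q (k * t)) (M * (- q * sg x * sechq q (k * x) * k)).
  by apply: is_derive_eq; rewrite /GRing.scale/=; ring.
rewrite (_ : dsol x = M * (- q * sg x * sechq q (k * x) * k)); last first.
  by rewrite dsolE -qk solE; ring.
by rewrite (_ : sol = fun t => M * sechq q (k * t)) //; apply/funext => t; exact: solE.
Qed.

Let is_derive_sg x : is_derive x 1 (fun t => sg t) (k * (1 - sg x ^+ 2)).
Proof.
rewrite mulrC.
exact: (@is_derive1_comp R tanh _ x _ _ (is_derive_tanh _) (is_derive_lin k x)).
Qed.

Lemma continuous_sol : continuous sol.
Proof. exact: (continuous_derivable is_derive_sol). Qed.

Let continuous_sg : continuous (fun x => sg x).
Proof. exact: (continuous_derivable is_derive_sg). Qed.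

Lemma continuous_dsol : continuous dsol.
Proof.
rewrite (_ : dsol = fun x => - Num.sqrt lam * sg x * sol x); last first.
  by apply/funext => x; exact: dsolE.
move=> x; apply: cvgM; last exact: continuous_sol.
by apply: cvgM; [exact: cvg_cst|exact: continuous_sg].
Qed.

Lemma sol_gt0 x : 0 < sol x. Proof. by rewrite solE mulr_gt0// sechq_gt0. Qed.

Lemma solN x : sol (- x) = sol x.
Proof. by rewrite !solE mulrN sechqN. Qed.

Lemma sqr_dsolN x : dsol (- x) ^+ 2 = dsol x ^+ 2.
Proof. by rewrite !dsolE solN mulrN tanhN; ring. Qed.

Lemma sol_le x : sol x <= M.
Proof. by rewrite solE -[leRHS]mulr1 ler_pM2l// sechq_le1// ltW. Qed.

Lemma sol0 : sol 0 = M. Proof. by rewrite solE mulr0 sechq0 mulr1. Qed.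

Lemma sqr_dsol x : dsol x ^+ 2 = lam * (sol x ^+ 2 - sol x ^+ 2 * (1 - sg x ^+ 2)).
Proof. by rewrite dsolE !exprMn sqrrN slE; ring. Qed.

Lemma sol_powR x : sol x `^ p = P * (sol x ^+ 2 * (1 - sg x ^+ 2)).
Proof.
have := powR_norm_split p2 (sol x); rewrite gtr0_norm ?sol_gt0// => ->.
rewrite [X in X `^ _]solE powRM ?(ltW M0) ?(ltW (sechq_gt0 _ _))// (sechq_powR _ qp).
by rewrite -/P; ring.
Qed.

Let sg1 x : 0 <= 1 - sg x ^+ 2 <= 1.
Proof.
by rewrite subr_ge0 (ltW (sqr_tanh_lt1 _))/= lerBlDr lerDl sqr_ge0.
Qed.

Lemma int_sol2 : ray.-int (fun x => sol x ^+ 2).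
Proof.
have c0 : 0 < 2 * (q * k) by rewrite mulr_gt0// mulr_gt0.
pose K := (M * expR (q * ln 2)) ^+ 2.
apply: (@int_le _ _ _ (fun x => K * expR (- (2 * (q * k)) * x))) => //.
- apply: measurable_funX; apply: econt_measurable; first exact: ray_interval.
  by apply: continuous_econt; exact: continuous_sol.
- move=> x _; rewrite ger0_norm ?sqr_ge0//.
  have -> : - (2 * (q * k)) * x = (- q * (k * x)) * 2%:R by ring.
  have h : sol x <= M * expR (q * ln 2) * expR (- q * (k * x)).
    by rewrite solE -mulrA ler_pM2l//; exact: sechq_le (ltW q0).
  rewrite expRM_natr /K -exprMn; apply: lerXn2r h; rewrite nnegrE.
    exact: ltW (sol_gt0 _).
  by rewrite !mulr_ge0 ?expR_ge0// ltW.
- by apply: intZ => //; exact: int_ray_expR.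
Qed.

Let msol2 D : is_interval D -> measurable_fun D (fun x => sol x ^+ 2 * (1 - sg x ^+ 2)).
Proof.
move=> iD; apply: econt_measurable => //; apply: continuous_econt => x.
apply: cvgM; first exact: (continuous_sqr continuous_sol).
apply: cvgB; first exact: cvg_cst.
exact: (continuous_sqr continuous_sg).
Qed.

Lemma int_sol2_sech : ray.-int (fun x => sol x ^+ 2 * (1 - sg x ^+ 2)).
Proof.
apply: int_le int_sol2 => //; first by apply: msol2; exact: ray_interval.
move=> x _; have /andP[s0 s1] := sg1 x.
by rewrite ger0_norm; [apply: ler_piMr; rewrite ?sqr_ge0|apply: mulr_ge0; rewrite ?sqr_ge0].
Qed.

Lemma int_dsol2 : ray.-int (fun x => dsol x ^+ 2).
Proof.
under [X in _.-int X]eq_fun do rewrite sqr_dsol.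
by apply: intZ => //; apply: intB => //; [exact: int_sol2|exact: int_sol2_sech].
Qed.

Let m := \int[leb]_(x in ray) sol x ^+ 2.
Let n := \int[leb]_(x in ray) (sol x ^+ 2 * (1 - sg x ^+ 2)).
Let a := \int[leb]_(x in ray) dsol x ^+ 2.

Let aE : a = lam * (m - n).
Proof.
rewrite /a (@eq_Rintegral _ _ _ leb _ _ _ (fun x _ => sqr_dsol x)).
have i2 := int_sol2; have i3 := int_sol2_sech.
by rewrite RintegralZl// ?RintegralB//; exact: intB.
Qed.

(* The identity comes from the derivative of [sol ^ 2 * tanh (k x)], which
   vanishes at 0 and at infinity. *)
Let mnE : 2 * q * m = (2 * q + 1) * n.
Proof.
have f2 x : 0 <= sol x ^+ 2 by exact: sqr_ge0.
have f3 x : 0 <= sol x ^+ 2 * (1 - sg x ^+ 2).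
  by have /andP[s0 _] := sg1 x; rewrite mulr_ge0.
pose F x := sol x ^+ 2 * sg x.
pose f x := k * ((2 * q + 1) * (sol x ^+ 2 * (1 - sg x ^+ 2)) - 2 * q * sol x ^+ 2).
have cf : continuous f.
  move=> x; apply: cvgM; first exact: cvg_cst.
  have cs2 : {for x, continuous (fun x => sol x ^+ 2)}.
    exact: (continuous_sqr continuous_sol).
  apply: cvgB; last by apply: cvgM; [exact: cvg_cst|exact: cs2].
  apply: cvgM; first exact: cvg_cst.
  apply: cvgM; first exact: cs2.
  apply: cvgB; first exact: cvg_cst.
  exact: (continuous_sqr continuous_sg).
have pF : primitive_on setT F f.
  apply: primitive_on_is_derive; last exact: cf.
  move=> x; have h1 := is_derive_sol x; have h2 := is_derive_sg x.
  have h3 : is_derive x 1 (fun t => sol t ^+ 2) (2 * sol x * dsol x).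
    have := is_deriveM h1 h1; rewrite (_ : sol * sol = fun t => sol t ^+ 2) => [h|]; last first.
      by apply/funext => t; rewrite expr2.
    by rewrite (_ : 2 * _ * _ = sol x *: dsol x + sol x *: dsol x)//; rewrite /GRing.scale/=; ring.
  have := is_deriveM h3 h2; rewrite (_ : _ * _ = F)//.
  rewrite (_ : _ + _ = f x)// /f /GRing.scale/=.
  rewrite (_ : dsol x = - (q * k) * sg x * sol x); last by rewrite qk dsolE.
  ring.
(* The boundary term at 0 vanishes with [tanh], and the one at [b] is at most [sol b ^+ 2], which is
   small at arbitrarily remote points. *)
have key b : 0 <= b -> `|k * ((2 * q + 1) * \int[leb]_(x in `[0, b]) (sol x ^+ 2 * (1 - sg x ^+ 2))
     - 2 * q * \int[leb]_(x in `[0, b]) sol x ^+ 2)| <= sol b ^+ 2.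
  move=> b0; have [_] := pF 0 b I I b0.
  have i2 : (`[0, b]).-int (fun x => sol x ^+ 2) by apply: int_ray_itv => //; exact: int_sol2.
  have i3 : (`[0, b]).-int (fun x => sol x ^+ 2 * (1 - sg x ^+ 2)).
    by apply: int_ray_itv => //; exact: int_sol2_sech.
  rewrite /f RintegralZl//; last by apply: intB => //; exact: intZ.
  rewrite RintegralB//; [|exact: intZ|exact: intZ].
  rewrite !RintegralZl// => <-.
  rewrite /F mulr0 (_ : tanh 0 = 0) ?mulr0 ?subr0; last by rewrite /tanh oppr0 subrr mul0r.
  rewrite normrM ger0_norm// ler_piMr//.
  by rewrite -[leRHS]sqrtr1 -sqrtr_sqr ler_sqrt// ltW// sqr_tanh_lt1.
have q2 : 0 < 2 * q + 1 by rewrite addr_gt0// mulr_gt0.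
have close e : 0 < e -> `|k * ((2 * q + 1) * n - 2 * q * m)| <= (1 + k * (2 * q + 1) * 2) * e.
  move=> e0.
  have [B1 B10 H1] := ray_approx int_sol2 (fun x _ => f2 x) e0.
  have [B2 B20 H2] := ray_approx int_sol2_sech (fun x _ => f3 x) e0.
  have [b Bb sb] := small_on_ray int_sol2 (fun x _ => f2 x) e0 (addr_ge0 B10 B20).
  have b0 : 0 <= b by apply: le_trans Bb; exact: addr_ge0.
  have := H1 b; rewrite (le_trans _ Bb) ?lerDl// => /(_ isT) h1.
  have := H2 b; rewrite (le_trans _ Bb) ?lerDr// => /(_ isT) h2.
  have s1 : \int[leb]_(x in `[0, b]) sol x ^+ 2 <= m.
    apply: le_Rint_sub => //; last exact: int_sol2.
    by move=> x /=; rewrite in_itv/= => /andP[x0 _]; apply/rayP.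
  have s2 : \int[leb]_(x in `[0, b]) (sol x ^+ 2 * (1 - sg x ^+ 2)) <= n.
    apply: le_Rint_sub => //; last exact: int_sol2_sech.
    by move=> x /=; rewrite in_itv/= => /andP[x0 _]; apply/rayP.
  have K := key b b0; rewrite !ler_norml in K *.
  rewrite -/m -/n in h1 h2.
  pose I2 := \int[leb]_(x in `[0, b]) sol x ^+ 2.
  pose I3 := \int[leb]_(x in `[0, b]) (sol x ^+ 2 * (1 - sg x ^+ 2)).
  rewrite -/I2 -/I3 in h1 h2 s1 s2 K; clearbody I2 I3.
  move: K => /andP[y1 y2].
  have kq : 0 < k * (2 * q) by apply: mulr_gt0 k0 _; exact: mulr_gt0.
  have kq1 : 0 < k * (2 * q + 1) by exact: mulr_gt0 k0 q2.
  have g1 : 0 <= k * (2 * q) * (m - I2) by rewrite mulr_ge0 ?(ltW kq)// subr_ge0.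
  have g1' : k * (2 * q) * (m - I2) <= k * (2 * q) * e by rewrite ler_wpM2l ?(ltW kq)//; lra.
  have g2 : 0 <= k * (2 * q + 1) * (n - I3) by rewrite mulr_ge0 ?(ltW kq1)// subr_ge0.
  have g2' : k * (2 * q + 1) * (n - I3) <= k * (2 * q + 1) * e.
    by rewrite ler_wpM2l ?(ltW kq1)//; lra.
  have g3 : k * (2 * q) * e <= k * (2 * q + 1) * e.
    by rewrite ler_wpM2r ?(ltW e0)// ler_wpM2l ?(ltW k0)// lerDl.
  have -> : k * ((2 * q + 1) * n - 2 * q * m) = k * (2 * q + 1) * (n - I3)
     - k * (2 * q) * (m - I2) + k * ((2 * q + 1) * I3 - 2 * q * I2) by ring.
  have -> : (1 + k * (2 * q + 1) * 2) * e = e + k * (2 * q + 1) * e + k * (2 * q + 1) * e by ring.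
  have kqe : 0 <= k * (2 * q + 1) * e by rewrite mulr_ge0 ?(ltW kq1) ?(ltW e0).
  move: (k * (2 * q) * _) (k * (2 * q + 1) * _) (k * (2 * q + 1) * _) g1 g1' g2 g2' g3 kqe
    => t1 t2 t3 g1 g1' g2 g2' g3 kqe.
  by apply/andP; split; lra.
have : k * ((2 * q + 1) * n - 2 * q * m) = 0.
  apply/eqP; rewrite -normr_le0; apply/ler_addgt0Pr => e e0; rewrite add0r.
  have c0 : 0 < 1 + k * (2 * q + 1) * 2 by apply: addr_gt0 => //; apply: mulr_gt0 => //; exact: mulr_gt0 k0 q2.
  apply: le_trans (close _ (divr_gt0 e0 c0)) _.
  by rewrite mulrC divfK// gt_eqF.
move=> /eqP; rewrite mulf_eq0 gt_eqF//= subr_eq0 => /eqP ->.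
by [].
Qed.

(** [mnE] relates the two remaining integrals, so every quantity of the soliton is an explicit
    multiple of its mass and no integral of a power of sech is evaluated. *)
Lemma dsol2_virial : a = lam * m * (p - 2) / (p + 2).
Proof.
have pp : p + 2 != 0 by rewrite gt_eqF// addr_gt0.
have pm : p - 2 != 0 by rewrite gt_eqF// subr_gt0.
have q21 : 2 * q + 1 = (p + 2) / (p - 2) by rewrite /q; field.
have q24 : 2 * q = 4 / (p - 2) by rewrite /q; field.
have : n = 4 / (p + 2) * m.
  have := mnE; rewrite q21 q24 => /(congr1 (fun y => y * ((p - 2) / (p + 2)))).
  rewrite (_ : 4 / (p - 2) * m * ((p - 2) / (p + 2)) = 4 / (p + 2) * m); last by field; rewrite ?pp ?pm.
  by move=> ->; field; rewrite ?pp ?pm.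
by rewrite aE => ->; field.
Qed.

End soliton.

End soliton_profile.

(** * The energy of the soliton as a lower bound for [lower] *)

Section soliton_energy_bound.
Context {R : realType}.
Implicit Types (D A B : set R) (f g u v w z : R -> R) (a b c x y r e : R).

(** Phrased with a primitive [F] because [c] may be negative, which reverses the endpoints
    [c * a + d] and [c * b + d]. *)
Lemma Rint_affine f c d a b : continuous f -> a <= b ->
  exists2 F, primitive_on setT F f &
    F (c * b + d) - F (c * a + d) = c * \int[leb]_(x in `[a, b]) f (c * x + d).
Proof.
move=> cf ab; have [F pF _] := continuous_primitive cf; exists F => //.
have pl : primitive_on setT (fun x => c * x + d) (fun=> c).
  move=> x y _ _ xy; split; first exact: integrable_cst_itv.
  by rewrite Rintegral_itv_cst//; ring.
have [_ E] := primitive_on_comp (@setT_interval R) pF (continuous_econt cf) pl I I ab.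
move: E => /= ->; rewrite -RintegralZl//.
  by apply: eq_Rintegral => x _; rewrite mulrC.
apply: econt_integrable; apply: continuous_econt => x.
apply: (@continuous_comp _ _ _ (fun x : R => c * x + d) f); last exact: cf.
by apply: cvgD; [apply: cvgM; [exact: cvg_cst|exact: cvg_id]|exact: cvg_cst].
Qed.

Lemma continuous_affine f c d : continuous f -> continuous (fun x => f (c * x + d)).
Proof.
move=> cf x; apply: (@continuous_comp _ _ _ (fun x : R => c * x + d) f); last exact: cf.
by apply: cvgD; [apply: cvgM; [exact: cvg_cst|exact: cvg_id]|exact: cvg_cst].
Qed.

Lemma ray_affine f c d : continuous f -> (forall x, 0 <= x -> 0 <= f x) -> ray.-int f ->
  0 < c -> 0 <= d ->
  ray.-int (fun x => f (c * x + d)) /\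
  c * \int[leb]_(x in ray) f (c * x + d) =
    \int[leb]_(x in ray) f x - \int[leb]_(x in `[0, d]) f x.
Proof.
move=> cf f0 fi c0 d0.
have fitv a b : (`[a, b]).-int f by apply: econt_integrable; exact: continuous_econt.
have cg := @continuous_affine f c d cf.
have gitv a b : (`[a, b]).-int (fun x => f (c * x + d)) by apply: econt_integrable; exact: continuous_econt.
have f0r x : ray x -> 0 <= f x by move=> /rayP; exact: f0.
have g0 x : 0 <= x -> 0 <= f (c * x + d).
  by move=> x0; apply: f0; rewrite addr_ge0// mulr_ge0// ltW.
have sub b : 0 <= b -> c * \int[leb]_(x in `[0, b]) f (c * x + d) =
    \int[leb]_(x in `[0, c * b + d]) f x - \int[leb]_(x in `[0, d]) f x.
  move=> b0; have [F pF <-] := @Rint_affine f c d 0 b cf b0.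
  have db : d <= c * b + d by rewrite lerDr mulr_ge0// ltW.
  rewrite (@Rintegral_itv_cat _ f 0 d (c * b + d))// [X in _ = X]addrAC subrr add0r.
  by rewrite -(pF _ _ I I db).2 mulr0 add0r.
have le_ray b : \int[leb]_(x in `[0, b]) f x <= \int[leb]_(x in ray) f x.
  apply: le_Rint_sub => // x /=; rewrite in_itv/= => /andP[x0 _]; exact/rayP.
have bnd a b : ray a -> ray b -> a <= b -> (`[a, b]).-int (fun x => f (c * x + d)) /\
    \int[leb]_(x in `[a, b]) f (c * x + d) <=
      c^-1 * (\int[leb]_(x in ray) f x - \int[leb]_(x in `[0, d]) f x).
  move=> /rayP a0 /rayP b0 ab; split => //.
  rewrite ler_pdivlMl//; apply: le_trans (_ : c * \int[leb]_(x in `[0, b]) f (c * x + d) <= _).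
    rewrite ler_pM2l//; apply: le_Rint_sub => //.
    - by apply: subset_itv; rewrite bnd_simp.
    - by move=> x /=; rewrite in_itv/= => /andP[x0 _]; exact: g0.
  by rewrite sub// lerD2r.
have mg : measurable_fun ray (fun x => f (c * x + d)).
  by apply: econt_measurable; [exact: ray_interval|exact: continuous_econt].
have g0r x : ray x -> 0 <= f (c * x + d) by move=> /rayP; exact: g0.
have [gi gle] := int_exhausted (@ray_interval R) (@ray_exhausted R) mg g0r bnd.
split => //; apply/eqP; rewrite eq_le -ler_pdivlMl// gle/=.
apply/ler_addgt0Pr => e e0.
have [B B0 HB] := ray_approx fi f0 e0.
pose b := B / c.
have b0 : 0 <= b by rewrite divr_ge0// ltW.
have := HB (c * b + d); rewrite /b mulrC divfK ?gt_eqF// lerDl => /(_ d0) H.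
rewrite lerBlDr; apply: le_trans H _; rewrite addrAC lerD2r.
have := sub b b0; rewrite /b mulrCA divff ?gt_eqF// mulr1 => E.
rewrite -lerBlDr -E ler_pM2l//; apply: le_Rint_sub => // x /=.
by rewrite in_itv/= => /andP[x0 _]; exact/rayP.
Qed.

Lemma Rint_itv_gt0 f a b : a < b -> continuous f -> (forall x, 0 < f x) ->
  0 < \int[leb]_(x in `[a, b]) f x.
Proof.
move=> ab cf f0.
have [c _ Hc] := EVT_min (ltW ab) (continuous_subspaceT cf).
apply: (@lt_le_trans _ _ (f c * (b - a))); first by rewrite mulr_gt0// subr_gt0.
rewrite -(Rintegral_itv_cst _ (ltW ab)); apply: le_Rintegral => //.
- exact: integrable_cst_itv.
- by apply: econt_integrable; exact: continuous_econt.
Qed.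

Section soliton_energy.
Variable p : R.
Hypothesis p2 : 2 < p.
Let p_gt0 : 0 < p. Proof. by apply: lt_trans p2. Qed.

Lemma line_sol M : 0 < M ->
  setT.-int (fun x => sol p M x ^+ 2) /\
  \int[leb]_x sol p M x ^+ 2 = 2 * \int[leb]_(x in ray) sol p M x ^+ 2.
Proof.
move=> M0; have cs := continuous_sqr (continuous_sol (M := M) p2).
have ev x : sol p M (- x) ^+ 2 = sol p M x ^+ 2 by rewrite solN.
exact: (Rint_setT_even cs (fun x => sqr_ge0 _) ev (int_sol2 p2 M0)).
Qed.

Lemma line_dsol M : 0 < M ->
  setT.-int (fun x => dsol p M x ^+ 2) /\
  \int[leb]_x dsol p M x ^+ 2 = 2 * \int[leb]_(x in ray) dsol p M x ^+ 2.
Proof.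
move=> M0; have cs := continuous_sqr (continuous_dsol (M := M) p2).
have ev x : dsol p M (- x) ^+ 2 = dsol p M x ^+ 2 by exact: sqr_dsolN.
exact: (Rint_setT_even cs (fun x => sqr_ge0 _) ev (int_dsol2 p2 M0)).
Qed.

Lemma sobolev_sol M : 0 < M -> sobolev setT (sol p M) (dsol p M).
Proof.
move=> M0; have cs := continuous_sol (M := M) p2; have cd := continuous_dsol (M := M) p2.
split.
- exact: (primitive_on_is_derive (is_derive_sol M p2) cd).
- exact: continuous_measurable_fun cs.
- exact: continuous_measurable_fun cd.
- exact: (line_sol M0).1.
- exact: (line_dsol M0).1.
Qed.

Lemma norm_sol M x : 0 < M -> `|sol p M x| = sol p M x.
Proof. by move=> M0; rewrite gtr0_norm ?sol_gt0. Qed.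

(** The pointwise identity is the first integral of the soliton equation, solved for the
    potential. *)
Lemma ray_potential_sol M : 0 < M ->
  ray.-int (fun x => `|sol p M x| `^ p) /\
  \int[leb]_(x in ray) `|sol p M x| `^ p = M `^ (p - 2) * (\int[leb]_(x in ray) sol p M x ^+ 2)
    - p / 2 * \int[leb]_(x in ray) dsol p M x ^+ 2.
Proof.
move=> M0; have P0 : 0 < M `^ (p - 2) by exact: powR_gt0.
have E x : `|sol p M x| `^ p = M `^ (p - 2) * sol p M x ^+ 2 - p / 2 * dsol p M x ^+ 2.
  rewrite norm_sol// sol_powR// sqr_dsol//; move: (tanh _) (sol _ _ _) => t s.
  by field; rewrite gt_eqF.
have i1 := int_sol2 p2 M0; have i2 := int_dsol2 p2 M0.
rewrite (@eq_Rintegral _ _ _ leb _ _ _ (fun x _ => E x)).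
under [X in _.-int X]eq_fun do rewrite E.
split; first by apply: intB => //; exact: intZ.
by rewrite RintegralB//; [rewrite !RintegralZl|exact: intZ|exact: intZ].
Qed.

Lemma line_potential_sol M : 0 < M ->
  \int[leb]_x `|sol p M x| `^ p = 2 * \int[leb]_(x in ray) `|sol p M x| `^ p.
Proof.
move=> M0; have cs := continuous_sol (M := M) p2.
have cp : continuous (fun x => `|sol p M x| `^ p).
  move=> x; apply: (@continuous_comp _ _ _ (sol p M) (fun t : R => `|t| `^ p)); first exact: cs.
  exact: continuous_norm_powR.
have ev x : `|sol p M (- x)| `^ p = `|sol p M x| `^ p by rewrite solN.
exact: (Rint_setT_even cp (fun x => powR_ge0 _ _) ev (ray_potential_sol M0).1).2.
Qed.

(** On the half-line the soliton decreases and attains equality in the calibration: the integral up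
    to [B] is [calib p 1 M] times [action 1 - action (sol B / M)]. Dropping the last term avoids the
    limit of [sol] at infinity. *)
Lemma dsol2_le_action M : 0 < M ->
  \int[leb]_(x in ray) dsol p M x ^+ 2 <= calib p 1 M * action p2 1.
Proof.
move=> M0; set sl := Num.sqrt (2 / p * M `^ (p - 2)).
have sl0 : 0 < sl by rewrite sqrtr_gt0 mulr_gt0 ?powR_gt0// divr_gt0.
have cE : calib p 1 M = sl * M ^+ 2 by rewrite /calib mulr1.
have [pu mu mv ui vi] := sobolev_sol M0.
have i2 := int_dsol2 p2 M0.
apply/ler_addgt0Pr => e e0.
have [B B0 HB] := ray_approx i2 (fun x _ => sqr_ge0 _) e0.
apply: le_trans (HB B (lexx _)) _; rewrite lerD2r.
have pw := primitive_onZ M^-1 pu.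
have cs : econt setT (slope p) by apply: continuous_econt; exact: continuous_slope.
have [_ Ec] := primitive_on_comp (@setT_interval R) (action_primitive p2) cs pw I I B0.
have sE x : 0 <= x -> slope p (M^-1 * sol p M x) * (M^-1 * dsol p M x) =
    - (sl * M ^+ 2)^-1 * dsol p M x ^+ 2.
  move=> x0; set t := M^-1 * sol p M x; set s := tanh (soliton_rate p M * x).
  have t0 : 0 < t by rewrite mulr_gt0 ?invr_gt0 ?sol_gt0.
  have k0 : 0 < soliton_rate p M.
    by rewrite /soliton_rate divr_gt0// divr_gt0// subr_gt0.
  have s0 : 0 <= s by apply: tanh_ge0; rewrite mulr_ge0// ltW.
  have tp : t `^ (p - 2) = 1 - s ^+ 2.
    rewrite /t solE mulrA mulVf ?gt_eqF// mul1r sechq_powR//.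
    by rewrite divfK// gt_eqF// subr_gt0.
  have -> : slope p t = t * s.
    have ts0 : 0 <= t * s by exact: mulr_ge0 (ltW t0) s0.
    apply/eqP; rewrite -(@eqrXn2 _ 2 _ _ isT (sqrtr_ge0 _) ts0).
    rewrite sqr_slope//; last first.
      rewrite gtr0_norm// /t mulrC ler_pdivrMr// mul1r; exact: sol_le.
    by rewrite powR_norm_split// gtr0_norm// tp; apply/eqP; ring.
  have -> : dsol p M x = - sl * s * sol p M x by rewrite dsolE.
  by rewrite /t; field; rewrite !gt_eqF.
have E2 : action p2 (M^-1 * sol p M B) - action p2 1 =
    - (sl * M ^+ 2)^-1 * \int[leb]_(x in `[0, B]) dsol p M x ^+ 2.
  have i2B : (`[0, B]).-int (fun x => dsol p M x ^+ 2) by exact: int_ray_itv i2.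
  rewrite -RintegralZl//.
  transitivity (\int[leb]_(t in `[0, B]) (slope p (M^-1 * sol p M t) * (M^-1 * dsol p M t))).
    by rewrite -Ec /= sol0 mulVf// gt_eqF.
  by apply: eq_Rintegral => x; rewrite inE/= in_itv/= => /andP[x0 _]; exact: sE.
have A0 : 0 <= action p2 (M^-1 * sol p M B).
  by apply: action_ge0; rewrite mulr_ge0 ?invr_ge0 ?(ltW M0) ?(ltW (sol_gt0 _ _ _)).
have sM : 0 < sl * M ^+ 2 by rewrite mulr_gt0// exprn_gt0.
rewrite cE mulrC -ler_pdivrMr// mulrC.
by move: E2; rewrite mulNr => E2; lra.
Qed.

(** Bounds from below the energy of a function of mass [mu] and supremum [N] that passes twice
    between [N] and 0; the subtracted term is the mass term added to complete the squares. *)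
Definition lower mu N := 2 * calib p 1 N * action p2 1 - N `^ (p - 2) * mu / p.

Lemma sol_energy_le_lower mu M N : p < 6 -> 0 < M -> 0 < N ->
  \int[leb]_x sol p M x ^+ 2 = mu ->
  (\int[leb]_x dsol p M x ^+ 2) / 2 - p^-1 * \int[leb]_x `|sol p M x| `^ p <= lower mu N /\
  (0 < mu -> (\int[leb]_x dsol p M x ^+ 2) / 2 - p^-1 * \int[leb]_x `|sol p M x| `^ p < 0).
Proof.
move=> p6 M0 N0; rewrite (line_sol M0).2 => mE.
rewrite (line_dsol M0).2 (line_potential_sol M0) (ray_potential_sol M0).2.
have vir := dsol2_virial p2 M0.
have act := dsol2_le_action M0.
set m := \int[leb]_(x in ray) _ in mE vir *.
set a := \int[leb]_(x in ray) _ in vir act *.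
set P := M `^ (p - 2) in vir *; have P0 : 0 < P by exact: powR_gt0.
(* The quotient of p - 2 by (p + 2) / 2, the exponents of [N] in the two terms of [lower]. By the
   virial identity the kinetic integral of the soliton is [C * th], and p < 6 amounts to
   [th < 1]. *)
pose th := 2 * (p - 2) / (p + 2).
have pp : 0 < p + 2 by rewrite addr_gt0.
have pm : 0 < p - 2 by rewrite subr_gt0.
have th0 : 0 < th by rewrite !divr_gt0// mulr_gt0.
have th1 : th < 1 by rewrite ltr_pdivrMr// mul1r; lra.
have mu0 : 0 <= mu.
  by rewrite -mE mulr_ge0// Rintegral_ge0// => x _; exact: sqr_ge0.
pose C := P * mu / p.
have C0 : 0 <= C by rewrite divr_ge0 ?(ltW p_gt0)// mulr_ge0// ltW.
have aE : 2 * a = C * th.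
  by rewrite vir /C /th -mE; field; rewrite !gt_eqF.
have -> : (2 * a) / 2 - p^-1 * (2 * (P * m - p / 2 * a)) = C * (th - 1).
  rewrite [RHS]mulrBr -aE mulr1 /C -mE; field; rewrite !gt_eqF//.
split; last first.
  by move=> mu1; rewrite pmulr_rlt0 ?subr_lt0// divr_gt0// mulr_gt0.
pose t := N / M; have t0 : 0 < t by rewrite divr_gt0.
have NE : N = t * M by rewrite /t divfK// gt_eqF.
pose z := t `^ (p - 2); have z0 : 0 < z by exact: powR_gt0.
have NP : N `^ (p - 2) = z * P by rewrite NE powRM// ltW.
have cN : calib p 1 N = calib p 1 M * (Num.sqrt z * t ^+ 2).
  rewrite /calib NP {1}NE (_ : 2 * 1 / p * (z * P) = (2 * 1 / p * P) * z); last by ring.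
  rewrite sqrtrM; first by ring.
  by rewrite mulr_ge0 ?(ltW P0)// divr_ge0 ?mulr_ge0// ltW.
(* Weighted arithmetic-geometric mean inequality for t^((p + 2) / 2) and 1, with weights [th] and
   [1 - th]; equality holds at [t = 1], that is at [N = M]. *)
have young : z <= th * (Num.sqrt z * t ^+ 2) + (1 - th).
  have thn : th != 0 by rewrite gt_eqF.
  have th1n : 1 - th != 0 by rewrite subr_eq0 gt_eqF.
  have H := @conjugate_powR R z 1 th^-1 (1 - th)^-1 (ltW z0) ler01.
  have := H; rewrite !invr_gt0 subr_gt0 !invrK subrKC mulr1 powR1 mul1r => {}H.
  apply: le_trans (H th0 th1 erefl) _; rewrite lerD2r mulrC ler_pM2l//.
  rewrite /z -powRrM -powR12_sqrt ?powR_ge0// -powRrM -powR_mulrn ?(ltW t0)//.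
  rewrite -powRD; last by rewrite (gt_eqF t0) implybT.
  rewrite le_eqVlt; apply/orP; left; apply/eqP; congr (_ `^ _).
  by rewrite /th; field; rewrite !gt_eqF.
have S0 : 0 <= Num.sqrt z * t ^+ 2 by rewrite mulr_ge0 ?sqrtr_ge0 ?sqr_ge0.
rewrite /lower NP cN.
have -> : z * P * mu / p = C * z by rewrite /C; ring.
have h1 : 2 * a * (Num.sqrt z * t ^+ 2) <= 2 * (calib p 1 M * (Num.sqrt z * t ^+ 2)) * action p2 1.
  move: (ler_wpM2l S0 act); clear act vir aE.
  by move: (Num.sqrt z * t ^+ 2) (calib p 1 M) (action p2 1) a => S c1 A1 a1; clear; lra.
have h2 := ler_wpM2l C0 young.
rewrite aE in h1; move: h1 h2; move: (Num.sqrt z * t ^+ 2) (2 * (calib p 1 M * _) * _) => S1 X1.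
by clear; lra.
Qed.

End soliton_energy.

End soliton_energy_bound.

(** * The minimization problem on the line *)

Section line_minimizer.
Context {R : realType}.
Implicit Types (D A B : set R) (f g u v w z : R -> R) (a b c x y r e : R).

Lemma ray_dilate f c : continuous f -> (forall x, 0 <= x -> 0 <= f x) -> ray.-int f ->
  0 < c -> ray.-int (fun x => f (c * x)) /\
  c * \int[leb]_(x in ray) f (c * x) = \int[leb]_(x in ray) f x.
Proof.
move=> cf f0 fi c0; have [gi gE] := ray_affine cf f0 fi c0 (lexx 0).
have E : (fun x => f (c * x + 0)) = (fun x => f (c * x)).
  by apply/funext => x; rewrite addr0.
rewrite E in gi; split => //.
rewrite -[RHS](subr0) -[X in _ = _ - X](Rintegral_set1 f 0) -set_itv1 -gE.
by congr (_ * _); apply: eq_Rintegral => x _; rewrite addr0.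
Qed.

Section minimizer.
Variable p : R.
Hypotheses (p2 : 2 < p) (p6 : p < 6).
Let p_gt0 : 0 < p. Proof. by apply: lt_trans p2. Qed.

Lemma sol_scale M x : 0 < M ->
  sol p M x = M * sol p 1 (Num.sqrt (M `^ (p - 2)) * x).
Proof.
move=> M0; rewrite !solE /soliton_rate powR1 mulr1 mul1r; congr (_ * sechq _ _).
by rewrite sqrtrM ?divr_ge0 ?(ltW p_gt0)//; ring.
Qed.

Lemma ray_mass_sol M : 0 < M ->
  \int[leb]_(x in ray) sol p M x ^+ 2 =
  M ^+ 2 / Num.sqrt (M `^ (p - 2)) * \int[leb]_(x in ray) sol p 1 x ^+ 2.
Proof.
move=> M0; set r := Num.sqrt _.
have r0 : 0 < r by rewrite sqrtr_gt0 powR_gt0.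
have cs := continuous_sqr (continuous_sol (M := 1) p2).
have [si sE] := ray_dilate cs (fun x _ => sqr_ge0 _) (int_sol2 p2 ltr01) r0.
have h : M ^+ 2 * \int[leb]_(x in ray) sol p 1 (r * x) ^+ 2 = \int[leb]_(x in ray) sol p M x ^+ 2.
  rewrite -RintegralZl; [|exact: measurable_ray|exact: si].
  by apply: eq_Rintegral => x _; rewrite (sol_scale _ M0) exprMn.
have aux (a b c I : R) : c != 0 -> a * I = b -> forall J, c * I = J -> b = a / c * J.
  by move=> c0 <- J <-; field.
exact: aux (lt0r_neq0 r0) h _ sE.
Qed.

(** By dilation the mass is proportional to M^((6 - p) / 2), with a positive exponent, so the
    equation for [M] is solved by a power. *)
Lemma sol_mass_exists mu : 0 < mu -> exists2 M, 0 < M & \int[leb]_x sol p M x ^+ 2 = mu.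
Proof.
move=> mu0; pose m1 := \int[leb]_(x in ray) sol p 1 x ^+ 2.
have m10 : 0 < m1.
  have cs := continuous_sqr (continuous_sol (M := 1) p2).
  apply: (@lt_le_trans _ _ (\int[leb]_(x in `[0, 1]) sol p 1 x ^+ 2)).
    by apply: Rint_itv_gt0 => // x; rewrite exprn_gt0// sol_gt0.
  apply: le_Rint_sub.
  - by [].
  - exact: measurable_ray.
  - by move=> x /=; rewrite in_itv/= => /andP[x0 _]; apply/rayP.
  - exact: int_sol2.
  - by move=> x _; exact: sqr_ge0.
pose c := mu / (2 * m1); have c0 : 0 < c by rewrite divr_gt0// mulr_gt0.
have d0 : 0 < 6 - p by rewrite subr_gt0.
exists (c `^ (2 / (6 - p))); first exact: powR_gt0.
set M := _ `^ _; have M0 : 0 < M by exact: powR_gt0.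
rewrite (line_sol p2 M0).2 ray_mass_sol// -/m1.
suff -> : M ^+ 2 / Num.sqrt (M `^ (p - 2)) = c.
  by rewrite /c; field; rewrite gt_eqF.
rewrite -powR12_sqrt ?powR_ge0// -powRrM -powR_mulrn ?(ltW M0)// -powRN -powRD; last first.
  by rewrite (gt_eqF M0) implybT.
rewrite /M -powRrM (_ : _ * _ = 1) ?powRr1 ?(ltW c0)//.
by field; rewrite gt_eqF.
Qed.

Lemma line_lower mu u v : 0 < mu -> sobolev setT u v -> \int[leb]_x u x ^+ 2 = mu ->
  setT.-int (fun x => `|u x| `^ p) /\ exists2 N, 0 < N & lower p2 mu N <=
    (\int[leb]_x v x ^+ 2) / 2 - p^-1 * \int[leb]_x `|u x| `^ p.
Proof.
move=> mu0 su mE; have [_ mu' _ ui _] := su.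
have uK := sobolev_bounded measurableT (fun x _ => @subsetT _ _) su.
have [N [uN Nsup]] := norm_sup (ex_intro _ 0 I) uK.
have N0 : 0 < N.
  rewrite ltNge; apply/negP => N0.
  have u0 x : u x = 0.
    by apply/eqP; rewrite -normr_le0 (le_trans _ N0)// uN.
  move: mu0; rewrite -mE (@eq_Rintegral _ _ _ leb _ (fun=> 0)); last first.
    by move=> x _; rewrite u0 expr0n.
  by rewrite /Rintegral integral0 ltxx.
have uN' x : `|u x| <= N by exact: uN.
split; first exact: (int_powR p2 measurableT mu' ui uN).
exists N => //.
have Nsup' d : 0 < d -> exists x, N - d < `|u x|.
  by move=> /Nsup[x _ ?]; exists x.
have := line_density_ge p2 N0 su uN' Nsup'.
rewrite (Rint_density p2 _ measurableT su uN) mE /lower.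
move: (\int[leb]_x v x ^+ 2) (\int[leb]_x `|u x| `^ p) (2 * calib _ _ _ * _) => T B C H.
have -> : N `^ (p - 2) * mu / p = 1 / p * (N `^ (p - 2) * mu) by ring.
by rewrite -[p^-1]mul1r lerBlDr; apply: le_trans H _; rewrite mulrBr; lra.
Qed.

Lemma energy_lineE mu u v : 0 < mu -> sobolev setT u v ->
  \int[leb]_x u x ^+ 2 = mu -> continuous u ->
  H1mu_line mu u /\ energy_line p u =
    ((\int[leb]_x v x ^+ 2) / 2 - p^-1 * \int[leb]_x `|u x| `^ p)%:E.
Proof.
move=> mu0 su mE cu; have [_ _ _ ui _] := su.
have h1 := sobolev_H1 (@setT_interval R) su.
have sw := H1_sobolev (@setT_interval R) (continuous_econt cu) h1.
have [_ _ _ _ wi] := sw.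
have [pi _] := line_lower mu0 su mE.
split; first by split; [split|rewrite normX2E Rint_fin// mE].
rewrite /energy_line normX2E Rint_fin// /normX Rint_fin//.
rewrite (eq_sobolev_deriv (@setT_interval R) (@setT_exhausted R) sw su).
by rewrite -!EFinM -EFinB mulrC.
Qed.

Lemma H1mu_line_sobolev mu u : H1mu_line mu u ->
  sobolev setT u (wderiv setT u) /\ \int[leb]_x u x ^+ 2 = mu.
Proof.
move=> [[cu h1] mE].
have sw := H1_sobolev (@setT_interval R) (continuous_econt cu) h1.
have [_ _ _ ui _] := sw.
by split => //; move: mE; rewrite normX2E Rint_fin// => -[].
Qed.

Definition soliton_energy M :=
  (\int[leb]_x dsol p M x ^+ 2) / 2 - p^-1 * \int[leb]_x `|sol p M x| `^ p.

Lemma soliton_exists mu M : 0 < mu -> 0 < M -> \int[leb]_x sol p M x ^+ 2 = mu ->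
  [/\ soliton p mu (sol p M), energy_line p (sol p M) = (soliton_energy M)%:E &
    ereal_inf [set energy_line p u | u in H1mu_line mu] = energy_line p (sol p M)].
Proof.
move=> mu0 M0 mE; have ss := sobolev_sol p2 M0.
have [hs eE] := energy_lineE mu0 ss mE (continuous_sol (M := M) p2).
have minE u : H1mu_line mu u -> (energy_line p (sol p M) <= energy_line p u)%E.
  move=> hu; have [su muE] := H1mu_line_sobolev hu.
  have [_ [N N0 Nle]] := line_lower mu0 su muE.
  have [_ ->] := energy_lineE mu0 su muE hu.1.1.
  rewrite eE lee_fin; apply: le_trans Nle.
  exact: (sol_energy_le_lower p2 p6 M0 N0 mE).1.
split.
- split; first by split.
  + by move=> x; exact: sol_gt0.
  + by move=> x; exact: solN.
- exact: eE.
- apply/eqP; rewrite eq_le; apply/andP; split.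
    by apply: ereal_inf_lbound; exists (sol p M).
  by apply: le_ereal_inf_tmp => _ [u hu <-]; exact: minE.
Qed.

(** The first term grows like N^((p + 2) / 2), the second like N^(p - 2). The first dominates once
    N^((6 - p) / 2) exceeds [C], that is beyond [N0]; below [N0] the second is at most its value
    there. *)
Lemma coercive_bound mu (c : R) : 0 < mu -> 0 < c -> exists K, forall N, 0 < N ->
  - K <= calib p c N * action p2 1 - c / p * (N `^ (p - 2) * mu).
Proof.
move=> mu0 c0; have A0 := action1_gt0 p2.
have s0 : 0 < Num.sqrt (2 * c / p) by rewrite sqrtr_gt0 divr_gt0// mulr_gt0.
pose C := c / p * mu / (Num.sqrt (2 * c / p) * action p2 1).
have cp : 0 < c / p by rewrite divr_gt0.
have C0 : 0 < C by apply: divr_gt0; [exact: mulr_gt0 cp mu0|exact: mulr_gt0 s0 A0].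
have d0 : 0 < 6 - p by rewrite subr_gt0.
pose N0 := C `^ (2 / (6 - p)).
have N00 : 0 < N0 by exact: powR_gt0.
exists (c / p * (N0 `^ (p - 2) * mu)) => N Np.
have z0 : 0 <= N `^ (p - 2) by exact: powR_ge0.
have [NN0|/ltW NN0] := leP N N0.
  have : N `^ (p - 2) <= N0 `^ (p - 2).
    by apply: ge0_ler_powR; rewrite ?nnegrE ?subr_ge0 ?(ltW p2) ?(ltW Np) ?(ltW N00).
  move=> /(ler_wpM2r (ltW mu0))/(ler_wpM2l (ltW cp)).
  by have := mulr_ge0 (calib_ge0 p c N) (ltW A0); lra.
have K0 : 0 <= c / p * (N0 `^ (p - 2) * mu).
  by rewrite mulr_ge0 ?(ltW cp)// mulr_ge0 ?powR_ge0// ltW.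
suff : c / p * (N `^ (p - 2) * mu) <= calib p c N * action p2 1 by lra.
rewrite /calib sqrtrM ?divr_ge0 ?mulr_ge0 ?(ltW c0) ?(ltW p_gt0)//.
set S := Num.sqrt (N `^ (p - 2)).
have SE : S ^+ 2 = N `^ (p - 2) by rewrite sqr_sqrtr.
have S0 : 0 <= S by exact: sqrtr_ge0.
have CN : C * S <= N ^+ 2.
  have -> : N ^+ 2 = N `^ ((6 - p) / 2) * S.
    rewrite /S -powR12_sqrt// -powRrM -powR_mulrn ?(ltW Np)// -powRD.
      by congr (_ `^ _); field.
    by rewrite (gt_eqF Np) implybT.
  rewrite ler_wpM2r//.
  have -> : C = N0 `^ ((6 - p) / 2).
    rewrite /N0 -powRrM (_ : _ * _ = 1) ?powRr1 ?(ltW C0)//.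
    by field; rewrite gt_eqF.
  by apply: ge0_ler_powR; rewrite ?nnegrE ?divr_ge0 ?(ltW d0) ?(ltW Np) ?(ltW N00).
have : C * S * (Num.sqrt (2 * c / p) * action p2 1 * S) <=
    N ^+ 2 * (Num.sqrt (2 * c / p) * action p2 1 * S).
  by rewrite ler_wpM2r// mulr_ge0// mulr_ge0// ltW.
have -> : C * S * (Num.sqrt (2 * c / p) * action p2 1 * S) = c / p * (N `^ (p - 2) * mu).
  by rewrite /C -SE; field; rewrite !gt_eqF.
by move=> /le_trans; apply; rewrite le_eqVlt; apply/orP; left; apply/eqP; ring.
Qed.

End minimizer.

End line_minimizer.

(** * Functions on the graph *)

Section graph_functions.
Context {R : realType}.
Implicit Types (D A B : set R) (f g u v w z : R -> R) (a b c x y r : R).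

Section graph.
Variables p l : R.
Hypotheses (p2 : 2 < p) (p6 : p < 6) (l0 : 0 < l).
Let p_gt0 : 0 < p. Proof. by apply: lt_trans p2. Qed.
Local Notation dom := (edge_set l).
Implicit Types (U V : edge -> R -> R) (e : edge).

Lemma sum_edge (F : edge -> R) : \sum_(e : edge) F e = F None + (F (Some true) + F (Some false)).
Proof.
rewrite (bigD1 None)//= (bigD1 (Some true))//= (bigD1 (Some false))//=.
by rewrite big1 ?addr0// => -[[]|].
Qed.

Lemma sum_edge_negb (F : edge -> R) (b : bool) :
  \sum_(e : edge) F e = F None + (F (Some b) + F (Some (~~ b))).
Proof. by rewrite sum_edge; case: b => //=; rewrite [in RHS](addrC (F (Some false))). Qed.

Lemma edge_interval e : is_interval (dom e).
Proof. by case: e => [b|]; exact: interval_is_interval. Qed.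

Lemma edge_exhausted e : exhausted (dom e).
Proof. by case: e => [b|]; [exact: ray_exhausted|apply: itv_exhausted; exact: ltW]. Qed.

Lemma measurable_edge e : measurable (dom e).
Proof. by case: e => [b|]; exact: measurable_itv. Qed.

Lemma edge0 e : dom e 0.
Proof. by case: e => [b|] /=; rewrite in_itv/= lexx// ltW. Qed.

Definition gsob U V := (forall e, sobolev (dom e) (U e) (V e)) /\
  forall e e', U e 0 = U e' 0.
(** The mass when applied to [U], twice the kinetic energy when applied to [V]. *)
Definition gmass U : R := \sum_(e : edge) \int[leb]_(x in dom e) U e x ^+ 2.
Definition gpot U : R := \sum_(e : edge) \int[leb]_(x in dom e) `|U e x| `^ p.
Definition gE U V : R := gmass V / 2 - p^-1 * gpot U.

Lemma gmass_ge0 U : 0 <= gmass U.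
Proof. by apply: sumr_ge0 => e _; apply: Rintegral_ge0 => x _; exact: sqr_ge0. Qed.

(** The suprema are kept edge by edge because the number of passages to 0 depends on which edge has
    the largest. On the pendant, boundedness comes from compactness. *)
Lemma gsob_sup U V : gsob U V -> exists M : edge -> R, forall e,
  (forall x, dom e x -> `|U e x| <= M e) /\
  forall d, 0 < d -> exists2 x, dom e x & M e - d < `|U e x|.
Proof.
move=> [sU _].
suff H e : exists M, (forall x, dom e x -> `|U e x| <= M) /\
  forall d, 0 < d -> exists2 x, dom e x & M - d < `|U e x|.
  by have /choice[M HM] := H; exists M.
have D0 : dom e !=set0 by exists 0; exact: edge0.
suff [K uK] : exists K, forall x, dom e x -> `|U e x| <= K by exact: norm_sup D0 uK.
case: e {D0} => [b|].
  have sr x : ray x -> `[x, x + 1] `<=` ray.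
    move=> /rayP x0 y /=; rewrite in_itv/= => /andP[xy _].
    by apply/rayP; exact: le_trans x0 xy.
  by eexists; exact: (sobolev_bounded (@measurable_ray R) sr (sU (Some b))).
have [pu _ _ _ _] := sU None.
by have [K _ uK] := econt_bounded (primitive_on_itv_econt pu); exists K.
Qed.

Lemma gsob_int_pot U V e : gsob U V -> (dom e).-int (fun x => `|U e x| `^ p).
Proof.
move=> sUV; have [M HM] := gsob_sup sUV; have [uM _] := HM e.
have [_ mu _ ui _] := sUV.1 e.
exact: (int_powR p2 (measurable_edge e) mu ui uM).
Qed.

Lemma gsob_energy mu U V : gsob U V -> gmass U = mu ->
  H1mu_graph l mu U /\ energy_graph p l U = (gE U V)%:E.
Proof.
move=> sUV mE; have [sU U0] := sUV.
have cU e : econt (dom e) (U e).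
  move=> t Dt d d0; have [pu _ _ _ _] := sU e.
  (* A compact interval of the edge containing a relative neighbourhood of [t], on which
     [primitive_on_itv_econt] applies. *)
  have [a [b [Da Db ab Hin]]] : exists a b, [/\ dom e a, dom e b, a <= t <= b &
      exists2 r, 0 < r & forall y, dom e y -> `|y - t| < r -> a <= y <= b].
    case: e Dt {pu} => [b|] /=; rewrite in_itv/=.
      rewrite andbT => t0; exists 0, (t + 1); rewrite !in_itv/= lexx; split => //.
      - lra.
      - by rewrite t0; lra.
      - exists 1 => // y; rewrite in_itv/= andbT => -> /=.
        by rewrite ltr_norml => /andP[_]; lra.
    move=> /andP[t0 tl]; exists 0, l; rewrite !in_itv/= lexx (ltW l0) lexx; split => //.
      by rewrite t0.
    by exists 1 => // y; rewrite in_itv.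
  have [r r0 Hr] := Hin.
  have sD := is_interval_sub_itv (@edge_interval e) Da Db.
  have It : `[a, b] t by rewrite /= in_itv.
  have [r' r'0 H'] := primitive_on_itv_econt (primitive_onS sD pu) It d0.
  exists (Num.min r r'); first by rewrite lt_min r0.
  move=> y Dy; rewrite lt_min => /andP[y1 y2]; apply: H' => //.
  by rewrite /= in_itv/=; exact: Hr.
have H1e e : H1 (dom e) (U e) by exact: sobolev_H1 (@edge_interval e) (sU e).
have mnorm e : normX 2 (dom e) (U e) = (\int[leb]_(x in dom e) U e x ^+ 2)%:E.
  by have [_ _ _ ui _] := sU e; rewrite normX2E (Rint_fin (measurable_edge e) ui).
split.
  split; first by split => //; split => // e; exact/econtP.
  under eq_bigr do rewrite mnorm.
  by rewrite sumEFin -mE.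
have kin e : normX 2 (dom e) (wderiv (dom e) (U e)) = (\int[leb]_(x in dom e) V e x ^+ 2)%:E.
  have sw := H1_sobolev (@edge_interval e) (cU e) (H1e e).
  have [_ _ _ _ wi] := sw.
  rewrite normX2E (Rint_fin (measurable_edge e) wi).
  by congr EFin; exact: eq_sobolev_deriv (@edge_interval e) (edge_exhausted e) sw (sU e).
have pot e : normX p (dom e) (U e) = (\int[leb]_(x in dom e) `|U e x| `^ p)%:E.
  by rewrite /normX (Rint_fin (measurable_edge e) (gsob_int_pot e sUV)).
rewrite /energy_graph; under eq_bigr do rewrite kin.
under [X in (_ - _ * X)%E]eq_bigr do rewrite pot.
by rewrite !sumEFin -!EFinM -EFinB mulrC.
Qed.

Lemma H1mu_graph_gsob mu U : H1mu_graph l mu U ->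
  gsob U (fun e => wderiv (dom e) (U e)) /\ gmass U = mu.
Proof.
move=> [[[cU U0] H1U] mE].
have sU e : sobolev (dom e) (U e) (wderiv (dom e) (U e)).
  by apply: H1_sobolev; [exact: edge_interval|apply/econtP; exact: cU|exact: H1U].
split => //; move: mE.
have mnorm e : normX 2 (dom e) (U e) = (\int[leb]_(x in dom e) U e x ^+ 2)%:E.
  by have [_ _ _ ui _] := sU e; rewrite normX2E (Rint_fin (measurable_edge e) ui).
by under eq_bigr do rewrite mnorm; rewrite sumEFin => -[].
Qed.

Lemma sum_density c M U V : gsob U V -> (forall e x, dom e x -> `|U e x| <= M) ->
  \sum_(e : edge) \int[leb]_(x in dom e) density p c M (U e) (V e) x =
  gmass V / 2 + c / p * (M `^ (p - 2) * gmass U - gpot U).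
Proof.
move=> [sU _] uM; rewrite /gmass /gpot !sum_edge.
have E e := Rint_density p2 c (measurable_edge e) (sU e) (uM e).
rewrite (E None) (E (Some true)) (E (Some false)).
have aux (T0 T1 T2 m0 m1 m2 b0 b1 b2 k P : R) :
   T0 / 2 + k * (P * m0 - b0) + (T1 / 2 + k * (P * m1 - b1) + (T2 / 2 + k * (P * m2 - b2)))
   = (T0 + (T1 + T2)) / 2 + k * (P * (m0 + (m1 + m2)) - (b0 + (b1 + b2))) by ring.
exact: aux.
Qed.

Lemma gpot_le m U V : gsob U V -> (forall e x, dom e x -> `|U e x| <= m) ->
  gpot U <= m `^ (p - 2) * gmass U.
Proof.
move=> sUV um; rewrite /gpot /gmass mulr_sumr; apply: ler_sum => e _.
have [_ _ _ ui _] := sUV.1 e.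
rewrite -RintegralZl; [|exact: measurable_edge|exact: ui].
apply: le_Rintegral; [exact: measurable_edge|exact: gsob_int_pot sUV| |].
  by apply: intZ => //; exact: measurable_edge.
by move=> x /um; exact: powR_norm_le.
Qed.

Lemma edge_density_ge0 M c U V e : 0 < M -> 0 <= c ->
  (forall e x, dom e x -> `|U e x| <= M) ->
  0 <= \int[leb]_(x in dom e) density p c M (U e) (V e) x.
Proof. by move=> M0 c0 uM; apply: Rintegral_ge0 => x /uM; exact: density_ge0. Qed.

Lemma gmass_sup_gt0 M U V mu : gsob U V -> gmass U = mu -> 0 < mu ->
  (forall e x, dom e x -> `|U e x| <= M) -> 0 < M.
Proof.
move=> sUV mE mu0 uM; rewrite ltNge; apply/negP => M0.
suff : gmass U = 0 by move=> m0; move: mu0; rewrite -mE m0 ltxx.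
apply: big1 => e _; rewrite (@eq_Rintegral _ _ _ leb _ (fun=> 0)).
  by rewrite /Rintegral integral0.
move=> x /set_mem Dx; have -> : U e x = 0; last by rewrite expr0n.
by apply/eqP; rewrite -normr_le0 (le_trans _ M0)// uM.
Qed.

Lemma edge_le_sum (I : edge -> R) e : (forall e, 0 <= I e) ->
  I e <= I None + (I (Some true) + I (Some false)).
Proof.
move=> I0; have := I0 None; have := I0 (Some true); have := I0 (Some false).
by case: e => [[]|]; lra.
Qed.

(** From a near-maximum on any edge at least one passage to 0 is available; from the pendant it
    leaves through the vertex along a half-line. *)
Lemma graph_path_bound M c U V e : 0 < M -> 0 <= c -> gsob U V ->
  (forall e x, dom e x -> `|U e x| <= M) ->
  (forall d, 0 < d -> exists2 x, dom e x & M - d < `|U e x|) ->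
  calib p c M * action p2 1 <=
    \sum_(e : edge) \int[leb]_(x in dom e) density p c M (U e) (V e) x.
Proof.
move=> M0 c0 [sU U0] uM.
have d0 e' : 0 <= \int[leb]_(x in dom e') density p c M (U e') (V e') x.
  exact: edge_density_ge0.
have uMr (b : bool) x : 0 <= x -> `|U (Some b) x| <= M by move=> x0; apply: uM; apply/rayP.
rewrite sum_edge; case: e => [b|] Msup.
  have Msup' d : 0 < d -> exists2 x, 0 <= x & M - d < `|U (Some b) x|.
    by move=> /Msup[x /rayP x0 ?]; exists x.
  have := ray_density_path p2 M0 c0 (sU (Some b)) (uMr b) Msup'.
  move=> /le_trans; apply.
  exact: (edge_le_sum (Some b) d0).
have uMp x : 0 <= x <= l -> `|U None x| <= M.
  by move=> xl; apply: uM; rewrite /= in_itv.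
have Msup' d : 0 < d -> exists2 x, 0 <= x <= l & M - d < `|U None x|.
  by move=> /Msup[x /=]; rewrite in_itv/= => xl ?; exists x.
have := pendant_density_path p2 M0 c0 (ltW l0) (sU None) (sU (Some true)) (U0 _ _) uMp (uMr true) Msup'.
move=> /le_trans; apply.
by rewrite addrA lerDl; exact: (d0 (Some false)).
Qed.

(** With [c = 2] the potential counts double; half of the resulting inequality bounds the energy
    from below and leaves a quarter of [gmass V] to spare. *)
Lemma graph_coercive mu : 0 < mu -> exists K, forall U V, gsob U V -> gmass U = mu ->
  gmass V / 4 - K <= gE U V.
Proof.
move=> mu0; have c0 : 0 < (2 : R) by [].
have [K HK] := coercive_bound p2 p6 mu0 c0.
exists (K / 2) => U V sUV mE; have [M HM] := gsob_sup sUV.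
have [e0 _ He0] := @Order.TotalTheory.arg_maxP _ _ _ (None : edge) xpredT M isT.
have uM e x : dom e x -> `|U e x| <= M e0.
  by move=> Dx; apply: le_trans ((HM e).1 x Dx) _; exact: He0.
have M0 : 0 < M e0 by exact: gmass_sup_gt0 sUV mE mu0 uM.
have := graph_path_bound M0 (ltW c0) sUV uM (HM e0).2.
rewrite (sum_density 2 sUV uM) mE => H.
have := HK _ M0; rewrite /gE.
have -> : p^-1 * gpot U = 2 / p * gpot U / 2 by field; rewrite gt_eqF.
move: H; rewrite mulrBr.
move: (gmass V) (gpot U) (calib _ _ _ * _) (2 / p * (_ * mu)) => T B X Y; lra.
Qed.

(** Either [|U|] is at most [m] on all edges and [gpot_le] bounds the potential, or the largest
    supremum belongs to a half-line, where two passages are available as on the line. *)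
Lemma pendant_small mu m U V : 0 < mu -> 0 < m -> gsob U V -> gmass U = mu ->
  (forall x, 0 <= x <= l -> `|U None x| <= m) ->
  (exists2 N, 0 < N & lower p2 mu N <= gE U V) \/ - (m `^ (p - 2) * mu / p) <= gE U V.
Proof.
move=> mu0 m0 sUV mE um; have [M HM] := gsob_sup sUV.
have [b Hb] : exists b : bool, forall b' : bool, M (Some b') <= M (Some b).
  have [h|/ltW h] := leP (M (Some true)) (M (Some false)).
    by exists false => -[].
  by exists true => -[].
have um' x : dom None x -> `|U None x| <= m by rewrite /= in_itv; exact: um.
have [Mm|mM] := leP (M (Some b)) m.
  right; have uM e x : dom e x -> `|U e x| <= m.
    case: e => [b'|]; last exact: um'.
    by move=> Dx; apply: le_trans ((HM (Some b')).1 x Dx) _; exact: le_trans (Hb b') Mm.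
  have := gpot_le sUV uM; rewrite mE => H.
  have pi : 0 < p^-1 by rewrite invr_gt0.
  have := ler_wpM2l (ltW pi) H; rewrite /gE; have := gmass_ge0 V.
  rewrite (mulrC p^-1 (_ * mu)).
  by move: (gmass V) (p^-1 * gpot U) (_ * mu / p) => T X Y; lra.
left; set N := M (Some b) in Hb mM; exists N; first exact: lt_trans m0 mM.
have N0 : 0 < N by exact: lt_trans m0 mM.
have uM e x : dom e x -> `|U e x| <= N.
  case: e => [b'|]; last by move=> /um' h; exact: le_trans h (ltW mM).
  by move=> Dx; apply: le_trans ((HM (Some b')).1 x Dx) _; exact: Hb.
have uMr (b' : bool) x : 0 <= x -> `|U (Some b') x| <= N by move=> x0; apply: uM; apply/rayP.
have Nsup d : 0 < d -> exists2 x, 0 <= x & N - d < `|U (Some b) x|.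
  by move=> /(HM (Some b)).2[x /rayP x0 ?]; exists x.
have [sU U0] := sUV.
pose J (e : edge) := \int[leb]_(x in dom e) density p 1 N (U e) (V e) x.
have H : 2 * calib p 1 N * action p2 1 <= J (Some b) + J (Some (~~ b)).
  exact: (two_rays_density_ge p2 N0 (sU (Some b)) (sU (Some (~~ b))) (U0 _ _) (uMr b) (uMr (~~ b)) Nsup).
have d0 : 0 <= J None by exact: edge_density_ge0.
have E : \sum_(e : edge) J e = gmass V / 2 + 1 / p * (N `^ (p - 2) * gmass U - gpot U).
  exact: (sum_density 1 sUV uM).
rewrite (sum_edge_negb _ b) mE in E.
move: (J _) (J _) (J _) d0 H E => J0 J1 J2 d0 H E.
rewrite /lower /gE.
have -> : N `^ (p - 2) * mu / p = 1 / p * (N `^ (p - 2) * mu) by ring.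
have -> : p^-1 * gpot U = 1 / p * gpot U by rewrite div1r.
rewrite lerBlDr; apply: le_trans H _.
move: E; rewrite mulrBr.
by move: (gmass V) (1 / p * _) (1 / p * _) => T X Y; lra.
Qed.

End graph.

End graph_functions.

(** * A competitor on the graph with less energy than the soliton *)

Section graph_competitor.
Context {R : realType}.
Implicit Types (D A B : set R) (f g u v w z : R -> R) (a b c x y r : R).

Section competitor.
Variables p l : R.
Hypotheses (p2 : 2 < p) (l0 : 0 < l).
Let p_gt0 : 0 < p. Proof. by apply: lt_trans p2. Qed.
Local Notation dom := (edge_set l).
Variables f g : R -> R.
Hypotheses (cf : continuous f) (cg : continuous g) (pf : primitive_on setT f g).
Hypotheses (f2i : ray.-int (fun x => f x ^+ 2)) (g2i : ray.-int (fun x => g x ^+ 2)).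
Hypothesis fpi : ray.-int (fun x => `|f x| `^ p).

(* The part of the profile above [0, l / 2], counted twice on the line, is
   stretched over the pendant. *)
Definition comp_u (e : edge) x := if e is Some _ then f (1 * x + l / 2) else f (- 2^-1 * x + l / 2).
Definition comp_v (e : edge) x :=
  if e is Some _ then g (1 * x + l / 2) * 1 else g (- 2^-1 * x + l / 2) * - 2^-1.

Let prim_affine c d : primitive_on setT (fun x => f (c * x + d)) (fun x => g (c * x + d) * c).
Proof.
have pl : primitive_on setT (fun x => c * x + d) (fun=> c).
  move=> x y _ _ xy; split; first exact: integrable_cst_itv.
  by rewrite Rintegral_itv_cst//; ring.
exact: (primitive_on_comp (@setT_interval R) pf (continuous_econt cg) pl).
Qed.

(** The vertex end of the pendant is sent to [l / 2] and its free end to 0, the maximum of the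
    profile; the factor 2 is the stretching. *)
Let fold (F : R -> R) : continuous F ->
  \int[leb]_(x in `[0, l]) F (- 2^-1 * x + l / 2) = 2 * \int[leb]_(x in `[0, l / 2]) F x.
Proof.
move=> cF; have [P pP] := @Rint_affine R F (- 2^-1) (l / 2) 0 l cF (ltW l0).
have -> : - 2^-1 * l + l / 2 = 0 by field.
rewrite mulr0 add0r => E.
have l20 : 0 <= l / 2 by rewrite divr_ge0// ltW.
have [_ E2] := pP 0 (l / 2) I I l20.
have aux (A B X Y : R) : A - B = - 2^-1 * X -> B - A = Y -> X = 2 * Y.
  by move=> H1 H2; lra.
exact: aux E E2.
Qed.

Let tail (F : R -> R) : continuous F -> (forall x, 0 <= x -> 0 <= F x) -> ray.-int F ->
  ray.-int (fun x => F (1 * x + l / 2)) /\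
  \int[leb]_(x in ray) F (1 * x + l / 2) =
    \int[leb]_(x in ray) F x - \int[leb]_(x in `[0, l / 2]) F x.
Proof.
move=> cF F0 Fi; have l20 : 0 <= l / 2 by rewrite divr_ge0// ltW.
by have [i1] := ray_affine cF F0 Fi ltr01 l20; rewrite mul1r.
Qed.

Lemma sobolev_comp : gsob l comp_u comp_v.
Proof.
have cpos (F : R -> R) (c d : R) : continuous F -> continuous (fun x => F (c * x + d)) by exact: continuous_affine.
have cV (c d k : R) : continuous (fun x => g (c * x + d) * k).
  by move=> x; apply: cvgM; [exact: (@cpos g c d cg)|exact: cvg_cst].
split; last first.
  by move=> e e'; case: e => [b|]; case: e' => [b'|]; rewrite /comp_u ?mulr0.
case=> [b|].
  have cU := @cpos f 1 (l / 2) cf.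
  have cVr := cV 1 (l / 2) 1.
  have mr (F : R -> R) : continuous F -> measurable_fun ray F.
    by move=> cF; apply: econt_measurable; [exact: ray_interval|exact: continuous_econt].
  split.
  - exact: primitive_onS (@subsetT _ _) (@prim_affine 1 (l / 2)).
  - exact: mr.
  - exact: mr.
  - exact: (tail (continuous_sqr cf) (fun x _ => sqr_ge0 _) f2i).1.
  - rewrite /comp_v; under [X in _.-int X]eq_fun do rewrite mulr1.
    exact: (tail (continuous_sqr cg) (fun x _ => sqr_ge0 _) g2i).1.
have cU := @cpos f (- 2^-1) (l / 2) cf.
have cVp := cV (- 2^-1) (l / 2) (- 2^-1).
have mp (F : R -> R) : continuous F -> measurable_fun `[0, l] F.
  by move=> cF; apply: econt_measurable; [exact: interval_is_interval|exact: continuous_econt].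
split.
- exact: primitive_onS (@subsetT _ _) (@prim_affine (- 2^-1) (l / 2)).
- exact: mp.
- exact: mp.
- by apply: econt_integrable; apply: continuous_econt; exact: (continuous_sqr cU).
- by apply: econt_integrable; apply: continuous_econt; exact: (continuous_sqr cVp).
Qed.

Let split_sum (F : R -> R) : continuous F -> (forall x, 0 <= x -> 0 <= F x) -> ray.-int F ->
  \int[leb]_(x in `[0, l]) F (- 2^-1 * x + l / 2) +
  (\int[leb]_(x in ray) F (1 * x + l / 2) + \int[leb]_(x in ray) F (1 * x + l / 2))
  = 2 * \int[leb]_(x in ray) F x.
Proof.
move=> cF F0 Fi; have E1 := fold cF; have [_ E2] := tail cF F0 Fi.
have aux (A B C D : R) : A = 2 * B -> C = D - B -> A + (C + C) = 2 * D.
  by move=> -> ->; ring.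
exact: aux E1 E2.
Qed.

Lemma comp_mass : gmass l comp_u = 2 * \int[leb]_(x in ray) f x ^+ 2.
Proof.
by rewrite /gmass sum_edge; exact: (split_sum (continuous_sqr cf) (fun x _ => sqr_ge0 _) f2i).
Qed.

Lemma comp_pot : gpot p l comp_u = 2 * \int[leb]_(x in ray) `|f x| `^ p.
Proof.
have cp : continuous (fun x => `|f x| `^ p).
  move=> x; apply: (@continuous_comp _ _ _ f (fun t : R => `|t| `^ p)); first exact: cf.
  exact: continuous_norm_powR.
by rewrite /gpot sum_edge; exact: (split_sum cp (fun x _ => powR_ge0 _ _) fpi).
Qed.

(** Stretching by 2 divides the squared derivative by 4 and doubles the length, so the pendant
    carries half of the integral over [0, l / 2], which the soliton on the line has twice: the gain
    is 3 / 2 of it. *)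
Lemma comp_kin : gmass l comp_v =
  2 * (\int[leb]_(x in ray) g x ^+ 2) - 3 / 2 * \int[leb]_(x in `[0, l / 2]) g x ^+ 2.
Proof.
have cg2 := continuous_sqr cg.
have E1 := fold cg2; have [_ E2] := tail cg2 (fun x _ => sqr_ge0 _) g2i.
have Ep : \int[leb]_(x in `[0, l]) comp_v None x ^+ 2 =
    4^-1 * \int[leb]_(x in `[0, l]) g (- 2^-1 * x + l / 2) ^+ 2.
  rewrite -RintegralZl; [|exact: measurable_itv|].
    by apply: eq_Rintegral => x _; rewrite /comp_v; field.
  apply: econt_integrable; apply: continuous_econt.
  exact: (continuous_sqr (@continuous_affine _ g (- 2^-1) (l / 2) cg)).
have Er (b : bool) : \int[leb]_(x in ray) comp_v (Some b) x ^+ 2 =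
    \int[leb]_(x in ray) g (1 * x + l / 2) ^+ 2.
  by apply: eq_Rintegral => x _; rewrite /comp_v mulr1.
have aux (A B C D I1 I2 I3 : R) : A = 2 * B -> C = D - B -> I1 = 4^-1 * A -> I2 = C -> I3 = C ->
    I1 + (I2 + I3) = 2 * D - 3 / 2 * B.
  by move=> -> -> -> -> ->; field.
by rewrite /gmass sum_edge; exact: (aux _ _ _ _ _ _ _ E1 E2 Ep (Er true) (Er false)).
Qed.

End competitor.

Lemma tanh_gt0 x : 0 < x -> 0 < tanh x.
Proof.
move=> x0; rewrite divr_gt0 ?cosh2_gt0// subr_gt0 ltr_expR; lra.
Qed.

Lemma sol_lt p M x : 2 < p -> 0 < M -> 0 < x -> sol p M x != M.
Proof.
move=> p2 M0 x0; apply/eqP => E.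
have p0 : 0 < p by exact: lt_trans p2.
have k0 : 0 < soliton_rate p M.
  rewrite /soliton_rate divr_gt0//; last by rewrite divr_gt0// subr_gt0.
  by rewrite sqrtr_gt0 mulr_gt0 ?powR_gt0// divr_gt0.
have s1 : sechq (2 / (p - 2)) (soliton_rate p M * x) = 1.
  by move: E; rewrite solE => /(canRL (mulKf (lt0r_neq0 M0))) ->; rewrite mulVf// gt_eqF.
have qp : 2 / (p - 2) * (p - 2) = 2 by rewrite divfK// gt_eqF// subr_gt0.
have := sechq_powR (soliton_rate p M * x) qp; rewrite s1 powR1.
have t0 : 0 < tanh (soliton_rate p M * x) by apply: tanh_gt0; exact: mulr_gt0.
have := exprn_gt0 2 t0; move: (tanh _ ^+ 2) => t; lra.
Qed.

Lemma graph_competitor (p l M mu : R) : 2 < p -> 0 < l -> 0 < M ->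
  \int[leb]_x sol p M x ^+ 2 = mu ->
  exists U V, [/\ gsob l U V, gmass l U = mu & gE p l U V < soliton_energy p M].
Proof.
move=> p2 l0 M0 mE.
have cs := continuous_sol (M := M) p2; have cd := continuous_dsol (M := M) p2.
have [ps _ _ _ _] := sobolev_sol p2 M0.
have i1 := int_sol2 p2 M0; have i2 := int_dsol2 p2 M0.
have [i3 _] := ray_potential_sol p2 M0.
exists (comp_u l (sol p M)), (comp_v l (dsol p M)); split.
- exact: sobolev_comp.
- rewrite comp_mass//; exact: (etrans (esym (line_sol p2 M0).2) mE).
have E1 := comp_kin l0 cd i2.
have E2 := comp_pot p2 l0 cs i3.
have E3 := (line_dsol p2 M0).2.
have E4 := line_potential_sol p2 M0.
(* [sol] takes different values at 0 and at [l / 2], so by Cauchy-Schwarz its derivative has a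
   positive square integral in between; this is the source of strictness. *)
have I0 : 0 < \int[leb]_(x in `[0, l / 2]) dsol p M x ^+ 2.
  have l20 : 0 < l / 2 by rewrite divr_gt0.
  have [di E] := ps 0 (l / 2) I I (ltW l20).
  have d2i : (`[0, l / 2]).-int (fun x => dsol p M x ^+ 2) by exact: int_ray_itv i2.
  have := cauchy_schwarz_itv (ltW l20) di d2i.
  rewrite -E sol0 subr0 => CS.
  rewrite -(pmulr_rgt0 _ l20); apply: lt_le_trans CS.
  by rewrite exprn_even_gt0//= subr_eq0 sol_lt.
rewrite /gE /soliton_energy.
have aux (K P K' P' a b i : R) : K = 2 * a - 3 / 2 * i -> P = b -> K' = 2 * a -> P' = b -> 0 < i ->
    K / 2 - p^-1 * P < K' / 2 - p^-1 * P'.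
  by move=> -> -> -> ->; lra.
exact: (aux _ _ _ _ _ _ _ E1 E2 E3 E4 I0).
Qed.

End graph_competitor.

(** * Compactness along an ultrafilter *)

Section ultralimits.
Context {R : realType}.
Implicit Types (D A B : set R) (f g u v w z : R -> R) (a b c x y r : R).

Definition ulim (F : set_system nat) (s : nat -> R) x :=
  forall e, 0 < e -> F [set n | `|s n - x| <= e].

(** Compactness of a segment gives a cluster point, and for an ultrafilter a cluster point is a
    limit. *)
Lemma ultra_ulim (F : set_system nat) (s : nat -> R) x : UltraFilter F ->
  (forall n, `|s n| <= x) -> exists y, ulim F s y.
Proof.
move=> FU sx.
have FF : ProperFilter (s @ F) by apply: fmap_proper_filter.
have [|y [_ cl]] := @segment_compact _ (- x) x (s @ F) FF.
  have : F [set n | `[- x, x]%classic (s n)] by apply: filterE => n; rewrite /= in_itv/= -ler_norml.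
  exact.
exists y => e e0.
have [//|FC] := in_ultra_setVsetC [set n | `|s n - y| <= e] FU.
have H : (s @ F) (s @` ~` [set n | `|s n - y| <= e]).
  suff : F [set n | (s @` ~` [set n | `|s n - y| <= e]) (s n)] by exact.
  by apply: filterS FC => n Hn; exists n.
have [_ [[n nC <-]]] := cl _ _ H (nbhsx_ballx y e e0).
by rewrite /ball/= distrC => /ltW.
Qed.

Lemma ulim_le (F : set_system nat) (s t : nat -> R) x y : ProperFilter F ->
  ulim F s x -> ulim F t y -> F [set n | s n <= t n] -> x <= y.
Proof.
move=> FF sx ty st; rewrite leNgt; apply/negP => yx.
have e0 : 0 < (x - y) / 3 by rewrite divr_gt0 ?subr_gt0.
have [n /= [[H1 H2] H3]] := filter_ex (filterI (filterI (sx _ e0) (ty _ e0)) st).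
move: H1 H2; rewrite !ler_norml => /andP[h1 _] /andP[_ h2].
lra.
Qed.

Lemma ulim_cst (F : set_system nat) x : Filter F -> ulim F (fun=> x) x.
Proof. by move=> FF e e0; apply: filterE => n /=; rewrite subrr normr0 ltW. Qed.

Lemma ulimD (F : set_system nat) (s t : nat -> R) x y : Filter F ->
  ulim F s x -> ulim F t y -> ulim F (fun n => s n + t n) (x + y).
Proof.
move=> FF sx ty e e0; have e20 : 0 < e / 2 by rewrite divr_gt0.
apply: filterS (filterI (sx _ e20) (ty _ e20)) => n /= [h1 h2].
have -> : s n + t n - (x + y) = (s n - x) + (t n - y) by ring.
by apply: le_trans (ler_normD _ _) _; rewrite (splitr e) lerD.
Qed.

Lemma ulimZ (F : set_system nat) (s : nat -> R) c x : Filter F ->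
  ulim F s x -> ulim F (fun n => c * s n) (c * x).
Proof.
move=> FF sx e e0; have c0 : 0 < `|c| + 1 by rewrite ltr_wpDl.
have d0 : 0 < e / (`|c| + 1) by rewrite divr_gt0.
apply: filterS (sx _ d0) => n /= h; rewrite -mulrBr normrM.
apply: le_trans (ler_wpM2l (normr_ge0 c) h) _.
by rewrite mulrA ler_pdivrMr// mulrC ler_wpM2l ?(ltW e0)// lerDl.
Qed.

Lemma filter_forall_lt (F : set_system nat) (Q : nat -> nat -> Prop) k : Filter F ->
  (forall i, F [set n | Q i n]) -> F [set n | forall i, (i < k)%N -> Q i n].
Proof.
move=> FF FQ; elim: k => [|k IH]; first by apply: filterE.
apply: filterS (filterI IH (FQ k)) => n /= [h1 h2] i.
by rewrite ltnS leq_eqVlt => /orP[/eqP->//|/h1].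
Qed.

(* Arzela-Ascoli for functions that are equi-Hoelder of exponent 1/2. *)
Lemma holder_ulim_unif (F : set_system nat) D (un : nat -> R -> R) u K X e :
  ProperFilter F -> is_interval D -> D 0 -> (forall x, D x -> 0 <= x) -> 0 < K ->
  (forall n x y, D x -> D y -> x <= y -> (un n y - un n x) ^+ 2 <= K * (y - x)) ->
  (forall x, D x -> ulim F (un ^~ x) (u x)) -> 0 < e ->
  F [set n | forall x, D x -> x <= X -> `|un n x - u x| <= e].
Proof.
move=> FF iD D0 Dp K0 hun limu e0.
have e30 : 0 < e / 4 by rewrite divr_gt0.
have half n x y : D x -> D y -> x <= y -> K * (y - x) <= (e / 4) ^+ 2 ->
    `|un n y - un n x| <= e / 4.
  move=> Dx Dy xy h; rewrite -(@ler_pXn2r _ 2)// ?nnegrE ?(ltW e30)//.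
  by rewrite real_normK ?num_real//; exact: le_trans (hun n x y Dx Dy xy) h.
have halfu x y : D x -> D y -> x <= y -> K * (y - x) <= (e / 4) ^+ 2 ->
    `|u y - u x| <= e / 4.
  move=> Dx Dy xy h.
  have L : ulim F (fun n => un n y + -1 * un n x) (u y + -1 * u x).
    by apply: ulimD; [exact: limu|apply: ulimZ; exact: limu].
  have hn n : - (e / 4) <= un n y + -1 * un n x <= e / 4.
    by rewrite mulN1r -ler_norml; exact: half.
  rewrite ler_norml; apply/andP; split.
    rewrite -(mulN1r (u x)); apply: ulim_le (@ulim_cst F _ _) L _.
    by apply: filterE => n /=; have /andP[] := hn n.
  rewrite -(mulN1r (u x)); apply: ulim_le L (@ulim_cst F _ _) _.
  by apply: filterE => n /=; have /andP[] := hn n.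
(* On a cell of length [h] the Hoelder bound limits the oscillation to e / 4, for [un n] and in the
   limit for [u]. Pointwise convergence is then needed only at the finitely many grid points [i * h]
   up to [X]. *)
pose h := (e / 4) ^+ 2 / K; have h0 : 0 < h by rewrite divr_gt0 ?exprn_gt0.
have [X0|X0] := ltP X 0.
  by apply: filterE => n x /Dp x0 xX; have := le_lt_trans (le_trans x0 xX) X0; rewrite ltxx.
pose k := (Num.truncn (X / h)).+1.
pose Q i n := D (i%:R * h) -> `|un n (i%:R * h) - u (i%:R * h)| <= e / 4.
have FQ i : F [set n | Q i n].
  have [Di|Di] := pselect (D (i%:R * h)); last by apply: filterE => n /= /Di.
  by apply: filterS (limu _ Di _ e30) => n /= H _.
apply: filterS (filter_forall_lt k FF FQ) => n /= Hn x Dx xX.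
have x0 := Dp _ Dx.
pose i := Num.truncn (x / h).
have /andP[i1 i2] : i%:R <= x / h < i.+1%:R by apply: truncn_itv; rewrite divr_ge0// ltW.
have ih : i%:R * h <= x by rewrite -ler_pdivlMr.
have ih' : K * (x - i%:R * h) <= (e / 4) ^+ 2.
  have -> : (e / 4) ^+ 2 = K * h by rewrite /h mulrCA divff ?mulr1// gt_eqF.
  rewrite ler_pM2l//; move: i2; rewrite ltr_pdivrMr// -natr1 mulrDl mul1r; lra.
have ik : (i < k)%N.
  by rewrite /k ltnS; apply: le_truncn; rewrite ler_pM2r ?invr_gt0.
have Di : D (i%:R * h).
  by apply: (iD _ _ D0 Dx); rewrite ih mulr_ge0// ltW.
have A1 := half n _ _ Di Dx ih ih'; have A2 := halfu _ _ Di Dx ih ih'.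
have A3 := Hn i ik Di.
move: A1 A2 A3; rewrite !ler_norml => /andP[? ?] /andP[? ?] /andP[? ?].
apply/andP; split; lra.
Qed.

Lemma unif_continuous_itv f a b e : continuous f -> 0 < e ->
  exists2 d, 0 < d & forall x y, a <= x <= b -> `|x - y| <= d -> `|f x - f y| <= e.
Proof.
move=> cf e0.
have /compact_near_coveringP cov := @segment_compact R a b.
have [d [d0 Hd]] : exists d, 0 < d /\ `[a, b] `<=` (fun x => forall y, `|x - y| <= d -> `|f x - f y| <= e).
  apply/(filter_ex (F := 0^'+)); near=> d; split => //.
  near: d; apply: cov => x0 _.
  have e20 : 0 < e / 2 by rewrite divr_gt0.
  have [r r0 Hr] := continuous_econt (D := setT) cf I e20 (t := x0).
  have r20 : 0 < r / 2 by rewrite divr_gt0.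
  near=> x d => y xyd.
  have x1 : `|x - x0| < r / 2 by rewrite distrC; near: x; exact: nbhsx_ballx.
  have d1 : d < r / 2 by near: d; exact: nbhs_right_lt.
  have y1 : `|y - x0| < r.
    rewrite (splitr r); have -> : y - x0 = - (x - y) + (x - x0) by ring.
    by apply: le_lt_trans (ler_normD _ _) _; rewrite normrN ltrD// (le_lt_trans xyd).
  have x2 : `|x - x0| < r by apply: lt_trans x1 _; rewrite ltr_pdivrMr// ltr_pMr// ltrDl.
  have -> : f x - f y = (f x - f x0) - (f y - f x0) by ring.
  by apply: le_trans (ler_normB _ _) _; rewrite (splitr e) lerD// Hr.
exists d => // x y xab; apply: Hd; by rewrite /= in_itv.
Unshelve. all: by end_near. Qed.

Lemma ulim_Rint (F : set_system nat) D (un : nat -> R -> R) u (G : R -> R) K X :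
  ProperFilter F -> `[0, X] `<=` D -> 0 <= X -> continuous G ->
  (forall n x, D x -> `|un n x| <= K) ->
  (forall n, econt `[0, X] (un n)) -> econt `[0, X] u ->
  (forall e, 0 < e -> F [set n | forall x, D x -> x <= X -> `|un n x - u x| <= e]) ->
  ulim F (fun n => \int[leb]_(x in `[0, X]) G (un n x)) (\int[leb]_(x in `[0, X]) G (u x)).
Proof.
move=> FF sD X0 cG unK cun cu lim e e0.
have ei0 : 0 < e / (X + 1) by rewrite divr_gt0// ltr_wpDl.
have [d d0 Hd] := unif_continuous_itv (- K) K cG ei0.
have iG w : econt `[0, X] w -> (`[0, X]).-int (fun x => G (w x)).
  move=> cw; apply: econt_integrable => x Dx e' e'0.
  have [r r0 Hr] := continuous_econt (D := setT) cG I e'0 (t := w x).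
  have r20 : 0 < r / 2 by rewrite divr_gt0.
  have [r' r'0 Hr'] := cw _ Dx _ r20.
  exists r' => // y Dy yx; apply: Hr => //.
  by apply: le_lt_trans (Hr' _ Dy yx) _; rewrite ltr_pdivrMr// ltr_pMr// ltrDl.
apply: filterS (lim _ d0) => n /= Hn.
rewrite -RintegralB//; [|exact: iG|exact: iG].
apply: le_trans (_ : _ <= e / (X + 1) * \int[leb]_(x in `[0, X]) 1) _.
  apply: le_Rint_norm; [exact: measurable_itv| |exact: integrable_cst_itv|].
    by apply: intB; [exact: measurable_itv|exact: iG|exact: iG].
  move=> x Dx; rewrite mulr1; apply: Hd.
  - by rewrite -ler_norml; apply: unK; exact: sD.
  - by apply: Hn; [exact: sD|move: Dx; rewrite /= in_itv/= => /andP[]].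
rewrite Rintegral_itv_cst// mul1r subr0 -mulrA ler_piMr ?(ltW e0)//.
by rewrite mulrC ler_pdivrMr ?mul1r ?lerDl// ltr_wpDl.
Qed.

(* The L2 functions whose primitive is within 1 / (k + 1) of u - u 0 on [0, k]
   form a decreasing sequence of convex sets. *)
Lemma weak_limit (F : set_system nat) D (un vn : nat -> R -> R) u (T : R) :
  ProperFilter F -> measurable D -> is_interval D -> D 0 -> (forall x, D x -> 0 <= x) ->
  (forall n, primitive_on D (un n) (vn n)) -> (forall n, measurable_fun D (vn n)) ->
  (forall n, D.-int (fun x => vn n x ^+ 2)) ->
  ulim F (fun n => \int[leb]_(x in D) vn n x ^+ 2) T ->
  (forall X e, 0 < e -> F [set n | forall x, D x -> x <= X -> `|un n x - u x| <= e]) ->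
  exists v, [/\ primitive_on D u v, measurable_fun D v, D.-int (fun x => v x ^+ 2) &
    \int[leb]_(x in D) v x ^+ 2 <= T].
Proof.
move=> FF mD iD D0 Dp pn mn in2 limT limu.
pose C (k : nat) := [set w : R -> R | [/\ measurable_fun D w, D.-int (fun x => w x ^+ 2) &
  forall x, D x -> x <= k%:R -> `|\int[leb]_(t in `[0, x]) w t - (u x - u 0)| <= k.+1%:R^-1]].
have sI x : D x -> `[0, x] `<=` D by move=> Dx; exact: is_interval_sub_itv.
have sqS w x : D x -> D.-int (fun x => w x ^+ 2) -> (`[0, x]).-int (fun x => w x ^+ 2).
  by move=> Dx; apply: integrableS; [exact: mD|exact: measurable_itv|exact: sI].
have iw w x : measurable_fun D w -> D.-int (fun x => w x ^+ 2) -> D x -> (`[0, x]).-int w.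
  move=> mw w2 Dx; apply: int_sq_itv; last exact: sqS.
  by apply: measurable_funS mw; [exact: mD|exact: sI].
have Cw n w : C n w -> measurable_fun D w /\ D.-int (fun x => w x ^+ 2) by case.
have Cmono n m : (n <= m)%N -> C m `<=` C n.
  move=> nm w [mw w2 Hw]; split => // x Dx xn.
  apply: le_trans (Hw x Dx _) _; first by apply: le_trans xn _; rewrite ler_nat.
  by rewrite lef_pV2 ?posrE// ler_nat.
have Cconv n w z : C n w -> C n z -> C n (fun x => (w x + z x) / 2).
  move=> [mw w2 Hw] [mz z2 Hz].
  have E : (fun x => (w x + z x) / 2) = (fun x => 2^-1 * w x + 2^-1 * z x).
    by apply/funext => x; field.
  have mwz : measurable_fun D (fun x => (w x + z x) / 2).
    by apply: measurable_funM; [exact: measurable_funD|exact: measurable_cst].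
  split => //.
    apply: (@int_le R D _ (fun x => w x ^+ 2 + z x ^+ 2)) => //; last exact: intD.
      exact: measurable_funX.
    move=> x _; rewrite ger0_norm ?sqr_ge0//.
    have := sqr_ge0 (w x - z x); have := sqr_ge0 (w x + z x); move: (w x) (z x) => s t.
    by nra.
  move=> x Dx xn; rewrite E.
  rewrite RintegralD//; [|by apply: intZ => //; exact: iw|by apply: intZ => //; exact: iw].
  rewrite !RintegralZl//; [|exact: iw|exact: iw].
  move: (Hw x Dx xn) (Hz x Dx xn); move: (\int[leb]_(t in `[0, x]) w t) (\int[leb]_(t in `[0, x]) z t) => s t.
  move: (n.+1%:R^-1) => k; rewrite !ler_norml => /andP[? ?] /andP[? ?]; apply/andP; split; lra.
have CT n e : 0 < e -> exists2 w, C n w & \int[leb]_(x in D) w x ^+ 2 <= T + e.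
  (* Half of 1 / (n + 1), as the deviation occurs both at [x] and at 0. *)
  move=> e0; have k0 : 0 < (2 * n.+1%:R)^-1 :> R by rewrite invr_gt0 mulr_gt0.
  have [m /= [H1 H2]] := filter_ex (filterI (limT _ e0) (limu n%:R _ k0)).
  exists (vn m); last by move: H1; rewrite ler_norml => /andP[_]; rewrite lerBlDl.
  split => // x Dx xn; have [_ <-] := pn m 0 x D0 Dx (Dp _ Dx).
  have -> : un m x - un m 0 - (u x - u 0) = (un m x - u x) - (un m 0 - u 0) by ring.
  apply: le_trans (ler_normB _ _) _.
  have -> : n.+1%:R^-1 = (2 * n.+1%:R)^-1 + (2 * n.+1%:R)^-1 :> R.
    by rewrite invfM; move: (n.+1%:R^-1) => k; lra.
  by rewrite lerD// H2.
have [v [mv v2 vT Hv]] := nested_convex_L2 mD Cw Cmono Cconv CT.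
have main x : D x -> \int[leb]_(t in `[0, x]) v t = u x - u 0.
  move=> Dx; have x0 := Dp _ Dx; apply/eqP; rewrite -subr_eq0 -normr_le0.
  apply/ler_addgt0Pr => e e0; rewrite add0r.
  have e20 : 0 < e / 2 by rewrite divr_gt0.
  pose k := Num.truncn (x + (e / 2)^-1).
  have xk : x + (e / 2)^-1 < k.+1%:R by rewrite /k truncnS_gt// addr_ge0// invr_ge0 ltW.
  have kx : x <= k.+1%:R by apply/ltW; apply: le_lt_trans xk; rewrite lerDl invr_ge0 ltW.
  have ke : k.+2%:R^-1 <= e / 2.
    rewrite -[e / 2]invrK lef_pV2 ?posrE ?invr_gt0//.
    apply: le_trans (_ : k.+1%:R <= _); last by rewrite ler_nat.
    by apply/ltW; apply: le_lt_trans xk; rewrite lerDr.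
  (* At this distance in L2, Cauchy-Schwarz on [0, x] bounds the difference of the primitives by e /
     2. *)
  have h0 : 0 < (e / 2) ^+ 2 / (x + 1) by rewrite divr_gt0 ?exprn_gt0// ltr_wpDl.
  have [w [mw w2 Hw] [d2 dle]] := Hv k.+1 _ h0.
  have md : measurable_fun D (fun x => v x - w x) by exact: measurable_funB.
  have cs := cauchy_schwarz_itv x0 (iw _ _ md d2 Dx) (sqS _ _ Dx d2).
  have B1 : `|\int[leb]_(t in `[0, x]) (v t - w t)| <= e / 2.
    rewrite -(@ler_pXn2r _ 2)// ?nnegrE ?(ltW e20)// real_normK ?num_real//.
    apply: le_trans cs _; rewrite subr0.
    have B2 : \int[leb]_(t in `[0, x]) (v t - w t) ^+ 2 <= (e / 2) ^+ 2 / (x + 1).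
      apply: le_trans dle; apply: le_Rint_sub => //; first exact: sI.
      by move=> t _; exact: sqr_ge0.
    apply: le_trans (ler_wpM2l x0 B2) _.
    rewrite mulrCA ler_piMr ?sqr_ge0// ler_pdivrMr ?mul1r ?lerDl//.
    by rewrite ltr_wpDl.
  have B3 := le_trans (Hw x Dx kx) ke.
  have E : \int[leb]_(t in `[0, x]) (v t - w t) =
      \int[leb]_(t in `[0, x]) v t - \int[leb]_(t in `[0, x]) w t.
    by rewrite RintegralB//; exact: iw.
  move: B1 B3; rewrite E; move: (\int[leb]_(t in `[0, x]) v t) (\int[leb]_(t in `[0, x]) w t) => s t.
  rewrite !ler_norml => /andP[? ?] /andP[? ?]; apply/andP; split; lra.
exists v; split => // a b Da Db ab; have a0 := Dp _ Da.
split.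
  by apply: integrable_itv_sub a0 (lexx b) _; exact: iw.
have [Ea Eb] := (main a Da, main b Db).
have := Rintegral_itv_cat a0 ab (iw _ _ mv v2 Db); rewrite Ea Eb => h; lra.
Qed.

End ultralimits.

(** * Compactness of bounded sequences in H1 *)

Section weak_compactness.
Context {R : realType}.
Implicit Types (D A B : set R) (f g u v w z : R -> R) (a b c x y r : R).

Lemma primitive_on_holder D u v K x y : measurable D -> is_interval D -> primitive_on D u v ->
  D.-int (fun x => v x ^+ 2) -> \int[leb]_(x in D) v x ^+ 2 <= K ->
  D x -> D y -> x <= y -> (u y - u x) ^+ 2 <= K * (y - x).
Proof.
move=> mD iD pu v2 vK Dx Dy xy; have [vi ->] := pu x y Dx Dy xy.
have sD := is_interval_sub_itv iD Dx Dy.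
have v2' : (`[x, y]).-int (fun x => v x ^+ 2).
  by apply: integrableS v2; [exact: mD|exact: measurable_itv|exact: sD].
apply: le_trans (cauchy_schwarz_itv xy vi v2') _.
rewrite [leRHS]mulrC; apply: ler_wpM2l; first by rewrite subr_ge0.
apply: le_trans vK; apply: (@le_Rint_sub R) => //.
by move=> t _; exact: sqr_ge0.
Qed.

Lemma holder_econt D u K : 0 < K ->
  (forall x y, D x -> D y -> x <= y -> (u y - u x) ^+ 2 <= K * (y - x)) -> econt D u.
Proof.
move=> K0 hu t Dt e e0; exists (e ^+ 2 / K); first by rewrite divr_gt0 ?exprn_gt0.
move=> y Dy yt; rewrite -(@ler_pXn2r _ 2)// ?nnegrE ?(ltW e0)// real_normK ?num_real//.
have H : K * `|y - t| <= e ^+ 2 by move: yt; rewrite ltr_pdivlMr// mulrC => /ltW.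
apply: le_trans H; have [h|/ltW h] := leP t y.
  by rewrite ger0_norm ?subr_ge0//; exact: hu.
by rewrite -sqrrN opprB distrC ger0_norm ?subr_ge0//; exact: hu.
Qed.

(** Lower semicontinuity of the kinetic term is stated on every [0, X], because the half-lines are
    truncated before the limit is taken. *)
Lemma weak_compact (F : set_system nat) D (un vn : nat -> R -> R) (C M K : R) :
  UltraFilter F -> measurable D -> is_interval D -> exhausted D ->
  D 0 -> (forall x, D x -> 0 <= x) -> 0 < K ->
  (forall n, sobolev D (un n) (vn n)) -> (forall n x, D x -> `|un n x| <= C) ->
  (forall n, \int[leb]_(x in D) un n x ^+ 2 <= M) ->
  (forall n, \int[leb]_(x in D) vn n x ^+ 2 <= K) ->
  exists u v, [/\ sobolev D u v,
    forall x, D x -> ulim F (un ^~ x) (u x),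
    forall X e, 0 < e -> F [set n | forall x, D x -> x <= X -> `|un n x - u x| <= e],
    forall X, D X -> exists2 T, ulim F (fun n => \int[leb]_(x in `[0, X]) vn n x ^+ 2) T &
      \int[leb]_(x in `[0, X]) v x ^+ 2 <= T
  & forall X (G : R -> R), D X -> continuous G ->
      ulim F (fun n => \int[leb]_(x in `[0, X]) G (un n x)) (\int[leb]_(x in `[0, X]) G (u x))].
Proof.
move=> FU mD iD eD D0 Dp K0 sn unC unM vnK.
have FF : ProperFilter F by exact: ultra_proper.
have hn n x y : D x -> D y -> x <= y -> (un n y - un n x) ^+ 2 <= K * (y - x).
  by have [pu _ _ _ v2] := sn n; exact: (primitive_on_holder mD iD pu v2 (vnK n)).
have [u limu] : exists u, forall x, D x -> ulim F (un ^~ x) (u x).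
  suff /choice[u Hu] : forall x, exists y, D x -> ulim F (un ^~ x) y by exists u.
  move=> x; have [Dx|Dx] := pselect (D x); last by exists 0.
  by have [y Hy] := ultra_ulim (x := C) FU (fun n => unC n x Dx); exists y.
have unif X e : 0 < e -> F [set n | forall x, D x -> x <= X -> `|un n x - u x| <= e].
  by move=> e0; exact: (holder_ulim_unif X FF iD D0 Dp K0 hn limu e0).
have sq0 (t : R) : 0 <= t ^+ 2 by exact: sqr_ge0.
have limT A : measurable A -> A `<=` D -> exists T, ulim F (fun n => \int[leb]_(x in A) vn n x ^+ 2) T.
  move=> mA AD; apply: (@ultra_ulim R F _ K FU) => n; have [_ _ _ _ v2] := sn n.
  rewrite ger0_norm; last by apply: Rintegral_ge0 => x _.
  by apply: le_trans (vnK n); apply: le_Rint_sub.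
have [T HT] := limT D mD (@subset_refl R D).
have [v [pv mv v2 vT]] : exists v, [/\ primitive_on D u v, measurable_fun D v,
    D.-int (fun x => v x ^+ 2) & \int[leb]_(x in D) v x ^+ 2 <= T].
  apply: (weak_limit FF mD iD D0 Dp _ _ _ HT unif) => n; by have [] := sn n.
have hu x y : D x -> D y -> x <= y -> (u y - u x) ^+ 2 <= (Num.max 1 T) * (y - x).
  by apply: (primitive_on_holder mD iD pv v2); rewrite le_max vT orbT.
have cu : econt D u by apply: holder_econt hu; rewrite lt_max ltr01.
have sI X : D X -> `[0, X] `<=` D by move=> DX; exact: is_interval_sub_itv.
have limG X (G : R -> R) : D X -> continuous G ->
    ulim F (fun n => \int[leb]_(x in `[0, X]) G (un n x)) (\int[leb]_(x in `[0, X]) G (u x)).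
  move=> DX cG; apply: (ulim_Rint FF (sI X DX) (Dp X DX) cG unC).
  - by move=> n; apply: econtS (sI X DX) _; exact: holder_econt (hn n).
  - exact: econtS (sI X DX) cu.
  - by move=> e e0; exact: unif.
have cu2 a b : D a -> D b -> (`[a, b]).-int (fun x => u x ^+ 2).
  move=> Da Db.
  have cu' : econt `[a, b] u by apply: econtS cu; exact: is_interval_sub_itv.
  exact: int_econtM cu' (econt_integrable cu').
have [u2 _] : D.-int (fun x => u x ^+ 2) /\ \int[leb]_(x in D) u x ^+ 2 <= M.
  apply: int_exhausted => //.
    by apply: measurable_funX; exact: econt_measurable.
  move=> a b Da Db ab; split; first exact: cu2.
  have b0 := Dp _ Db; apply: le_trans (_ : \int[leb]_(x in `[0, b]) u x ^+ 2 <= _).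
    apply: le_Rint_sub => //; last exact: cu2.
    by apply: subset_itv; rewrite bnd_simp// Dp.
  apply: ulim_le (limG b (fun t => t ^+ 2) Db (@exprn_continuous _ 2)) (@ulim_cst R F _ _) _ => //.
  apply: filterE => n /=; apply: le_trans (unM n); have [_ _ _ un2 _] := sn n.
  by apply: le_Rint_sub => //; exact: sI.
exists u, v; split => //; first by split => //; exact: econt_measurable.
move=> X DX; have X0 := Dp _ DX.
have mI : measurable `[0, X] by exact: measurable_itv.
have iI : is_interval `[0, X] by exact: interval_is_interval.
have [TX HTX] := limT _ mI (sI X DX).
exists TX => //.
(* The weak limit taken on [0, X] alone gives a derivative [w] of the same [u] bounded by [TX]; by
   uniqueness its square integral there controls that of the global [v]. *)
have [w [pw mw w2 wT]] : exists w, [/\ primitive_on `[0, X] u w, measurable_fun `[0, X] w,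
    (`[0, X]).-int (fun x => w x ^+ 2) & \int[leb]_(x in `[0, X]) w x ^+ 2 <= TX].
  apply: (weak_limit FF mI iI _ _ _ _ _ HTX).
  - by rewrite /= in_itv/= lexx.
  - by move=> x; rewrite /= in_itv/= => /andP[].
  - by move=> n; have [pn _ _ _ _] := sn n; exact: primitive_onS (sI X DX) pn.
  - by move=> n; have [_ _ mn _ _] := sn n; apply: measurable_funS mn => //; exact: sI.
  - by move=> n; have [_ _ _ _ n2] := sn n; apply: integrableS n2 => //; exact: sI.
  - move=> Y e /(unif Y); apply: filterS => n /= H x Ix; apply: H; exact: (sI X DX).
apply: le_trans wT; apply: le_sobolev_deriv iI (itv_exhausted X0) _ _.
  split.
  - exact: primitive_onS (sI X DX) pv.
  - by apply: econt_measurable; [exact: interval_is_interval|exact: econtS (sI X DX) cu].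
  - by apply: measurable_funS mv => //; exact: sI.
  - exact: cu2.
  - by apply: integrableS v2 => //; exact: sI.
split => //.
- by apply: econt_measurable; [exact: interval_is_interval|exact: econtS (sI X DX) cu].
- exact: cu2.
Qed.

End weak_compactness.

(** * Existence of a minimizer *)

Section tails.
Context {R : realType}.
Implicit Types (D A B : set R) (f g u v w z : R -> R) (a b c x y r : R).

Lemma sobolevS D A u v : measurable D -> measurable A -> A `<=` D -> sobolev D u v -> sobolev A u v.
Proof.
move=> mD mA AD [pu mu mv u2 v2]; split.
- exact: primitive_onS pu.
- exact: measurable_funS mu.
- exact: measurable_funS mv.
- exact: integrableS u2.
- exact: integrableS v2.
Qed.

Lemma Rint_ray_split f x : 0 <= x -> ray.-int f ->
  \int[leb]_(t in ray) f t = \int[leb]_(t in `[0, x]) f t + \int[leb]_(t in `[x, +oo[) f t.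
Proof.
move=> x0 fi; rewrite -(Rintegral_itv_obnd_cbnd (r := x)); last first.
  by apply: integrableS fi => //; apply: subset_itv; rewrite bnd_simp.
by rewrite -(Rintegral_itvB (a := BLeft 0) (b := +oo%O) fi) ?bnd_simp// addrC subrK.
Qed.

Section tail.
Variable p : R.
Hypothesis p2 : 2 < p.
Let p_gt0 : 0 < p. Proof. by apply: lt_trans p2. Qed.

Lemma le_calib c M N : 0 <= c -> 0 <= M -> M <= N -> calib p c M <= calib p c N.
Proof.
move=> c0 M0 MN; have N0 := le_trans M0 MN; rewrite /calib; apply: ler_pM.
- exact: sqrtr_ge0.
- exact: sqr_ge0.
- apply: ler_wsqrtr; apply: ler_wpM2l; first by rewrite divr_ge0 ?mulr_ge0// ltW.
  by apply: ge0_ler_powR; rewrite ?nnegrE// subr_ge0 ltW.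
- by rewrite ler_pXn2r.
Qed.

(* The contribution of A to E + k mass. *)
Definition jint k A u v := (\int[leb]_(x in A) v x ^+ 2) / 2 +
  (k * \int[leb]_(x in A) u x ^+ 2 - p^-1 * \int[leb]_(x in A) `|u x| `^ p).

(** Rising from [x0] to a near-maximum contributes almost [action 1 - h], and coming down again
    almost [action 1]. *)
Lemma tail_path_bound x0 N h u v : 0 <= x0 -> 0 < N -> sobolev ray u v ->
  (forall x, x0 <= x -> `|u x| <= N) ->
  (forall d, 0 < d -> exists2 x, x0 <= x & N - d < `|u x|) ->
  `|action p2 (u x0 / N)| <= h ->
  calib p 1 N * (2 * action p2 1 - h) <= \int[leb]_(x in `[x0, +oo[) density p 1 N u v x.
Proof.
move=> x00 N0 sr uN Nsup hle; pose D : set R := `[x0, +oo[.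
have mD : measurable D by exact: measurable_itv.
have iD : is_interval D by exact: interval_is_interval.
have DP x : D x <-> x0 <= x by rewrite /D /= in_itv/= andbT.
have Dr : D `<=` ray by move=> x /DP h0; apply/rayP; exact: le_trans h0.
have sD : sobolev D u v by exact: (sobolevS (@measurable_ray R) mD Dr sr).
have uD x : D x -> `|u x| <= N by move=> /DP; exact: uN.
have c0 := calib_ge0 p 1 N.
apply: le_of_eps_mul => // e e0; have e20 : 0 < e / 2 by rewrite divr_gt0.
have [d d0 Hd] := action_gap p2 N0 e20.
have [x1 x01 Nx1] := Nsup d d0.
have [x2 x12 ux2] := ray_small sr d0 (le_trans x00 x01).
have D0 : D x0 by apply/DP.
have D1 : D x1 by apply/DP.
have D2 : D x2 by apply/DP; exact: le_trans x12.
have B1 := path_bound p2 iD N0 ler01 sD uD D0 D1 x01.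
have B2 := path_bound p2 iD N0 ler01 sD uD D1 D2 x12.
have G1 := Hd (u x1) (u x2) (uN _ x01) Nx1 ux2.
have G2 := Hd (u x1) 0 (uN _ x01) Nx1; rewrite normr0 mul0r action0 subr0 in G2.
have {}G2 := G2 d0.
have iden a b : `[a, b] `<=` D -> (`[a, b]).-int (density p 1 N u v).
  by move=> abD; apply: integrableS (int_density p2 1 mD sD uD) => //; exact: measurable_itv.
have D02 : `[x0, x2] `<=` D by exact: is_interval_sub_itv.
have E := Rintegral_itv_cat x01 x12 (iden _ _ D02).
have L : \int[leb]_(x in `[x0, x2]) density p 1 N u v x <= \int[leb]_(x in D) density p 1 N u v x.
  apply: le_Rint_sub => //; first exact: int_density.
  by move=> x /uD h0; exact: density_ge0.
apply: le_trans L; rewrite E.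
move: B1 B2 G1 G2 hle; clear E Hd.
move: (\int[leb]_(x in `[x0, x1]) _) (\int[leb]_(x in `[x1, x2]) _) => I1 I2.
move: (action p2 (u x1 / N)) (action p2 (u x2 / N)) (action p2 (u x0 / N)) => a1 a2 a0.
move: (action p2 1) => A1 B1 B2 G1 G2 hle.
have T1 : `|a1| <= `|a1 - a0| + `|a0|.
  by apply: le_trans (_ : `|a1 - a0 + a0| <= _); [rewrite subrK|exact: ler_normD].
apply: le_trans (lerD B1 B2); rewrite -mulrDr; apply: ler_wpM2l => //.
rewrite distrC in G1; lra.
Qed.

(* If N is the supremum of |u| on the tail, the integrand is nonnegative when
   N^(p-2) / p <= k; otherwise the calibrated lower bound decreases with the
   mass, so that it is enough to know it at mass mu. *)
Lemma tail_jint_ge0 (k mu g K : R) : 0 < k -> 0 < g -> 0 <= K ->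
  (forall N, 0 < N -> g - k * mu <= lower p2 mu N) ->
  exists2 c0, 0 < c0 & forall x0 u v, 0 <= x0 -> sobolev ray u v ->
    (forall x, 0 <= x -> `|u x| <= K) -> `|u x0| <= c0 ->
    \int[leb]_(x in ray) u x ^+ 2 <= mu -> 0 <= jint k `[x0, +oo[ u v.
Proof.
move=> k0 g0 K0 Hlow.
have p20 : 0 < p - 2 by rewrite subr_gt0.
(* The threshold at which N^(p - 2) / p equals [k]. *)
pose N0 := (k * p) `^ (p - 2)^-1.
have kp0 : 0 < k * p by exact: mulr_gt0.
have N00 : 0 < N0 by rewrite powR_gt0.
have N0E : N0 `^ (p - 2) = k * p by rewrite -powRrM mulVf ?gt_eqF// powRr1// ltW.
(* Makes the loss [calib p 1 N * h] at most [g] for every [N <= K]. *)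
pose h := g / (calib p 1 K + 1).
have cK1 : 0 < calib p 1 K + 1 by rewrite ltr_wpDl// calib_ge0.
have h0 : 0 < h by rewrite divr_gt0.
have [d d0 Hd] := primitive_on_econt (action_primitive p2) I h0 (t := 0).
(* Ensures [|u x0| / N < d] for all suprema [N] above the threshold [N0]. *)
exists (d * N0 / 2); first by rewrite divr_gt0// mulr_gt0.
move=> x0 u v x00 sr uK ux0 umu; pose D : set R := `[x0, +oo[.
have mD : measurable D by exact: measurable_itv.
have DP x : D x <-> x0 <= x by rewrite /D /= in_itv/= andbT.
have Dr : D `<=` ray by move=> x /DP h1; apply/rayP; exact: le_trans h1.
have sD : sobolev D u v by exact: (sobolevS (@measurable_ray R) mD Dr sr).
have D0 : D x0 by apply/DP.
have DN0 : D !=set0 by exists x0.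
have uKD x : D x -> `|u x| <= K by move=> /Dr /rayP; exact: uK.
have [N [uN Nsup]] := norm_sup DN0 uKD.
have mle : \int[leb]_(x in D) u x ^+ 2 <= mu.
  apply: le_trans umu; apply: (@le_Rint_sub R) => //; first by have [] := sr.
  by move=> x _; exact: sqr_ge0.
have dens := Rint_density p2 1 mD sD uN.
have Nge : 0 <= N by apply: le_trans (uN _ D0).
have pi0 : 0 < p^-1 by rewrite invr_gt0.
have T0 : 0 <= \int[leb]_(x in D) v x ^+ 2 by apply: Rintegral_ge0 => x _; exact: sqr_ge0.
have m0 : 0 <= \int[leb]_(x in D) u x ^+ 2 by apply: Rintegral_ge0 => x _; exact: sqr_ge0.
rewrite /jint -/D.
have [small|big] := leP (N `^ (p - 2)) (k * p).
  have B : \int[leb]_(x in D) `|u x| `^ p <= N `^ (p - 2) * \int[leb]_(x in D) u x ^+ 2.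
    have [_ mu' _ u2 _] := sD; rewrite -RintegralZl//.
    apply: le_Rintegral => //; first exact: (int_powR p2 mD mu' u2 uKD).
      exact: intZ.
    by move=> x /uN; exact: powR_norm_le.
  have B' : p^-1 * \int[leb]_(x in D) `|u x| `^ p <= k * \int[leb]_(x in D) u x ^+ 2.
    have -> : k = p^-1 * (k * p) by field; rewrite gt_eqF.
    rewrite -mulrA; apply: ler_wpM2l; first exact: ltW.
    by apply: le_trans B _; exact: ler_wpM2r.
  by rewrite addr_ge0 ?subr_ge0// divr_ge0.
have N0N : N0 < N.
  rewrite ltNge; apply/negP => NN0; move: big; rewrite ltNge => /negP; apply.
  by rewrite -N0E; apply: ge0_ler_powR; rewrite ?nnegrE//; exact: ltW.
have Ngt : 0 < N by exact: lt_trans N0N.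
have hle : `|action p2 (u x0 / N)| <= h.
  have := Hd (u x0 / N) I; rewrite action0 !subr0; apply.
  rewrite normrM normfV (gtr0_norm Ngt) ltr_pdivrMr//.
  apply: le_lt_trans ux0 _; rewrite -mulrA ltr_pM2l// ltr_pdivrMr//.
  by apply: lt_le_trans N0N _; rewrite ler_pMr// ler1n.
have NK : N <= K.
  apply/ler_addgt0Pr => e e0; have [x Dx Nx] := Nsup e e0.
  by rewrite -lerBlDr; apply: ltW; apply: lt_le_trans Nx (uKD x Dx).
have Nsup' e : 0 < e -> exists2 x, x0 <= x & N - e < `|u x|.
  by move=> /Nsup[x /DP ? ?]; exists x.
have uN' x : x0 <= x -> `|u x| <= N by move=> /DP; exact: uN.
have := tail_path_bound x00 Ngt sr uN' Nsup' hle; rewrite -/D dens => P1.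
have P2 := Hlow N Ngt.
have P3 : calib p 1 N * h <= g.
  apply: le_trans (_ : calib p 1 K * h <= _).
    by apply: ler_wpM2r; [exact: ltW|exact: le_calib].
  by rewrite /h mulrCA ler_piMr ?(ltW g0)// ler_pdivrMr// mul1r lerDl.
(* Above the threshold, replacing [mu] by the smaller mass of the tail only improves the bound. *)
have P4 : 0 <= (N `^ (p - 2) / p - k) * (mu - \int[leb]_(x in D) u x ^+ 2).
  by rewrite mulr_ge0// subr_ge0// ler_pdivlMr// ltW.
move: P1 P2 P3 P4; rewrite /lower.
have -> : N `^ (p - 2) * mu / p = N `^ (p - 2) / p * mu by ring.
have -> (m B : R) : 1 / p * (N `^ (p - 2) * m - B) = N `^ (p - 2) / p * m - p^-1 * B by ring.
move: (calib p 1 N) (action p2 1) (N `^ (p - 2) / p) => c A P.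
move: (\int[leb]_(x in D) v x ^+ 2) (\int[leb]_(x in D) u x ^+ 2) (p^-1 * _) => T m B.
rewrite mulrBr; have -> : c * (2 * A) = 2 * c * A by ring.
rewrite !mulrBr !mulrBl; move: (c * h) (2 * c * A) (P * m) (P * mu) (k * mu) (k * m).
by clear; move=> *; lra.
Qed.

End tail.

End tails.

(** * Truncation of half-lines and scaling of the mass *)

Section scaling.
Context {R : realType}.
Implicit Types (D A B : set R) (f g u v w z : R -> R) (a b c x y r : R).

Section existence.
Variables p l : R.
Hypotheses (p2 : 2 < p) (p6 : p < 6) (l0 : 0 < l).
Let p_gt0 : 0 < p. Proof. by apply: lt_trans p2. Qed.
Local Notation dom := (edge_set l).
Implicit Types (U V : edge -> R -> R) (e : edge).

Lemma jint_split k x u v : 0 <= x -> sobolev ray u v -> ray.-int (fun x => `|u x| `^ p) ->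
  jint p k ray u v = jint p k `[0, x] u v + jint p k `[x, +oo[ u v.
Proof.
move=> x0 [_ _ _ u2 v2] up; rewrite /jint.
rewrite (Rint_ray_split x0 u2) (Rint_ray_split x0 v2) (Rint_ray_split x0 up).
by ring.
Qed.

(** Only the nonnegative kinetic and mass parts have to be almost exhausted by [0, x]; the potential
    enters with a minus sign, so truncating it errs in the right direction. *)
Lemma jint_approx k c d u v : 0 < k -> 0 < c -> 0 < d -> sobolev ray u v ->
  ray.-int (fun x => `|u x| `^ p) -> exists x, [/\ 0 <= x, `|u x| < c,
    jint p k ray u v <= jint p k `[0, x] u v + d &
    \int[leb]_(x in ray) u x ^+ 2 <= \int[leb]_(t in `[0, x]) u t ^+ 2 + d].
Proof.
move=> k0 c0 d0 sr up; have [_ _ _ u2 v2] := sr.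
have sq0 (f : R -> R) x : 0 <= x -> 0 <= f x ^+ 2 by move=> _; exact: sqr_ge0.
(* The mass error is multiplied by [k] and the kinetic one by 1 / 2, so their sum is at most [d]. *)
have dk0 : 0 < d / (k + 1) by rewrite divr_gt0// ltr_wpDl// ltW.
have [B1 B10 H1] := ray_approx u2 (sq0 u) dk0.
have [B2 B20 H2] := ray_approx v2 (sq0 v) dk0.
have mB : 0 <= Num.max B1 B2 by rewrite le_max B10.
have [x Bx ux] := ray_small sr c0 mB.
move: Bx; rewrite ge_max => /andP[Bx1 Bx2].
have x0 := le_trans B10 Bx1.
have {}H1 := H1 x Bx1; have {}H2 := H2 x Bx2.
have H3 : \int[leb]_(t in `[0, x]) `|u t| `^ p <= \int[leb]_(t in ray) `|u t| `^ p.
  by apply: le_Rint_sub => //; apply: subset_itv; rewrite bnd_simp.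
have pi0 : 0 < p^-1 by rewrite invr_gt0.
have K1 := ler_wpM2l (ltW k0) H1.
have K3 := ler_wpM2l (ltW pi0) H3.
have dE : d = k * (d / (k + 1)) + d / (k + 1).
  by field; rewrite gt_eqF// ltr_wpDl// ltW.
exists x; split => //.
  rewrite /jint; move: H2 K1 K3; rewrite [X in _ -> _ -> _ -> _ <= _ + X]dE mulrDr.
  move: (p^-1 * _) (p^-1 * _) (k * _) (k * _) (k * _) => P1 P2 P3 P4 P5.
  move: (\int[leb]_(x in ray) _) (\int[leb]_(x in `[0, x]) _) (d / (k + 1)) dk0 => X Y Z.
  by move=> *; lra.
apply: le_trans H1 _; rewrite lerD2l ler_pdivrMr; last by rewrite ltr_wpDl// ltW.
by rewrite ler_pMr// lerDr ltW.
Qed.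

Lemma sum_jint k U V :
  \sum_(e : edge) jint p k (dom e) (U e) (V e) = gE p l U V + k * gmass l U.
Proof.
rewrite /gE /gmass /gpot !sum_edge /jint.
move: (\int[leb]_(x in dom None) V _ _ ^+ 2) (\int[leb]_(x in dom (Some true)) V _ _ ^+ 2)
  (\int[leb]_(x in dom (Some false)) V _ _ ^+ 2) => a b c.
move: (\int[leb]_(x in dom None) U _ _ ^+ 2) (\int[leb]_(x in dom (Some true)) U _ _ ^+ 2)
  (\int[leb]_(x in dom (Some false)) U _ _ ^+ 2) => a' b' c'.
move: (\int[leb]_(x in dom None) _) (\int[leb]_(x in dom (Some true)) _)
  (\int[leb]_(x in dom (Some false)) _) => a'' b'' c''.
ring.
Qed.

(* The energy scales at least quadratically, so a function of mass at most mu
   with energy at most (m0 / mu) times its mass can be improved by scaling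
   unless its mass is mu. *)
Lemma mass_full (mu m0 : R) U V : 0 < mu -> m0 < 0 ->
  (forall U V, gsob l U V -> gmass l U = mu -> m0 <= gE p l U V) ->
  gsob l U V -> 0 < gmass l U -> gmass l U <= mu ->
  gE p l U V <= m0 / mu * gmass l U -> gmass l U = mu.
Proof.
move=> mu0 m00 Hm sUV t0 tmu EUV; apply/eqP; rewrite eq_le tmu /= leNgt; apply/negP => tlt.
(* Multiplication by [s], which exceeds 1, raises the mass to [mu], so that [Hm] applies to
   [s U]. *)
pose s := Num.sqrt (mu / gmass l U).
have q0 : 0 < mu / gmass l U by rewrite divr_gt0.
have s2 : s ^+ 2 = mu / gmass l U by rewrite sqr_sqrtr// ltW.
have s0 : 0 < s by rewrite sqrtr_gt0.
have s1 : 1 < s ^+ 2 by rewrite s2 ltr_pdivlMr// mul1r.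
have s1' : 1 < s by rewrite -(@ltr_pXn2r _ 2)// ?nnegrE ?ltW// expr1n.
pose sU e x := s * U e x; pose sV e x := s * V e x.
have sq (D : set R) (f : R -> R) : measurable D -> D.-int (fun x => f x ^+ 2) ->
    D.-int (fun x => (s * f x) ^+ 2) /\
    \int[leb]_(x in D) (s * f x) ^+ 2 = s ^+ 2 * \int[leb]_(x in D) f x ^+ 2.
  move=> mD f2; have E : (fun x => (s * f x) ^+ 2) = (fun x => s ^+ 2 * f x ^+ 2).
    by apply/funext => x; rewrite exprMn.
  by rewrite E; split; [exact: intZ|rewrite RintegralZl].
have ssob : gsob l sU sV.
  split => [e|e e']; last by rewrite /sU (sUV.2 e e').
  have [pu mu' mv u2 v2] := sUV.1 e; have mD := measurable_edge l e; split.
  - exact: primitive_onZ.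
  - by apply: measurable_funM => //; exact: measurable_cst.
  - by apply: measurable_funM => //; exact: measurable_cst.
  - by have [] := sq _ _ mD u2.
  - by have [] := sq _ _ mD v2.
have massE : gmass l sU = s ^+ 2 * gmass l U.
  rewrite /gmass mulr_sumr; apply: eq_bigr => e _; have [_ _ _ u2 _] := sUV.1 e.
  exact: (sq _ _ (measurable_edge l e) u2).2.
have kinE : gmass l sV = s ^+ 2 * gmass l V.
  rewrite /gmass mulr_sumr; apply: eq_bigr => e _; have [_ _ _ _ v2] := sUV.1 e.
  exact: (sq _ _ (measurable_edge l e) v2).2.
have potE : gpot p l sU = s `^ p * gpot p l U.
  rewrite /gpot mulr_sumr; apply: eq_bigr => e _.
  have E : (fun x => `|sU e x| `^ p) = (fun x => s `^ p * `|U e x| `^ p).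
    by apply/funext => x; rewrite /sU normrM (gtr0_norm s0) powRM// ltW.
  rewrite E RintegralZl//; [exact: measurable_edge|exact: (gsob_int_pot p2 l0 e sUV)].
have := Hm _ _ ssob; rewrite massE s2 divfK ?gt_eqF// => /(_ erefl).
rewrite /gE kinE potE => H.
have B0 : 0 <= gpot p l U.
  by apply: sumr_ge0 => e _; apply: Rintegral_ge0 => x _; exact: powR_ge0.
have spgt : s ^+ 2 < s `^ p.
  have /= := powR_norm_split p2 s; rewrite (gtr0_norm s0) => ->.
  rewrite ltr_pMl ?exprn_gt0//.
  have := @gt0_ltr_powR R (p - 2); rewrite subr_gt0 => /(_ p2 1 s).
  by rewrite powR1 !nnegrE ler01 (ltW s0) => /(_ isT isT s1').
have V0 := gmass_ge0 l V.
have pi0 : 0 < p^-1 by rewrite invr_gt0.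
have E2 : s ^+ 2 * gE p l U V <= m0.
  have := ler_wpM2l (sqr_ge0 s) EUV; rewrite {2}s2.
  by have -> : mu / gmass l U * (m0 / mu * gmass l U) = m0 by field; rewrite !gt_eqF.
(* Since s^2 E(U) <= m0 <= E(s U) and s^p > s^2, the potential cannot be positive; but then E(U) >=
   0, against the bound [m0 / mu * gmass l U], which is negative. *)
have BP : p^-1 * gpot p l U <= 0.
  rewrite -(@pmulr_rle0 _ (s `^ p - s ^+ 2)) ?subr_gt0// mulrBl.
  move: H E2; rewrite /gE mulrBr.
  have -> : p^-1 * (s `^ p * gpot p l U) = s `^ p * (p^-1 * gpot p l U) by ring.
  have -> : s ^+ 2 * (gmass l V / 2) = s ^+ 2 * gmass l V / 2 by ring.
  by move: (s `^ p * _) (s ^+ 2 * (p^-1 * _)) (s ^+ 2 * gmass l V / 2) => ? ? ?; lra.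
have : 0 <= gE p l U V by rewrite /gE subr_ge0 (le_trans BP)// divr_ge0.
have : m0 / mu * gmass l U < 0 by rewrite pmulr_llt0// pmulr_llt0// invr_gt0.
by rewrite ltNge => /negP h /le_trans/(_ EUV).
Qed.

End existence.

End scaling.

(** * Minimizing sequences and their uniform bounds *)

Section minimizing_sequences.
Context {R : realType}.
Implicit Types (D A B : set R) (f g u v w z : R -> R) (a b c x y r : R).

(** Every subinterval of positive length contains points where [u] is small; taking it close to [x],
    on the side that stays inside [[a, b]], continuity transfers this to [x]. *)
Lemma Rint_sqr_eq0 a b u x : a < b -> econt `[a, b] u ->
  \int[leb]_(t in `[a, b]) u t ^+ 2 <= 0 -> a <= x <= b -> u x = 0.
Proof.
move=> ab cu u0 /andP[ax xb].
have Dx : `[a, b] x by rewrite /= in_itv/= ax.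
apply/eqP; rewrite -normr_le0; apply/ler_addgt0Pr => e e0; rewrite add0r.
have e20 : 0 < e / 2 by rewrite divr_gt0.
have [d d0 Hd] := cu x Dx _ e20.
have [c [c' [ac cc' cb Hc]]] : exists c c', [/\ a <= c, c < c', c' <= b &
    forall y, c <= y <= c' -> `|y - x| < d].
  have [xlb|bx] := ltP x b.
    exists x, (Num.min b (x + d / 2)); split => //; rewrite ?lt_min ?ge_min ?lexx//.
      by rewrite xlb ltrDl divr_gt0.
    move=> y /andP[xy]; rewrite le_min => /andP[_ yd].
    by rewrite ger0_norm ?subr_ge0//; lra.
  exists (Num.max a (x - d / 2)), x; split => //; rewrite ?gt_max ?le_max ?lexx//.
    by rewrite (lt_le_trans ab bx) ltrBlDr ltrDl divr_gt0.
  move=> y /andP[]; rewrite ge_max => /andP[_ yd] yx.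
  by rewrite ler0_norm ?subr_le0//; lra.
have sub : `[c, c'] `<=` `[a, b] by apply: subset_itv; rewrite bnd_simp.
have u2 : (`[a, b]).-int (fun x => u x ^+ 2) by exact: int_econtM cu (econt_integrable cu).
have [y /andP[cy yc'] uy] : exists2 y, c <= y <= c' & u y ^+ 2 < (e / 2) ^+ 2.
  apply: (small_on_long (measurable_itv _) sub u2 _ (ltW cc')).
    by move=> t _; exact: sqr_ge0.
  by apply: le_lt_trans u0 _; rewrite mulr_gt0 ?exprn_gt0 ?subr_gt0.
have Dy : `[a, b] y by apply: sub; rewrite /= in_itv/= cy.
have uy' : `|u y| <= e / 2.
  rewrite -(@ler_pXn2r _ 2)// ?nnegrE ?(ltW e20)//.
  by rewrite real_normK ?num_real//; exact: ltW.
have H1 : `|u y - u x| <= e / 2 by apply: Hd => //; apply: Hc; rewrite cy.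
have -> : u x = u y - (u y - u x) by ring.
by apply: le_trans (ler_normB _ _) _; rewrite (splitr e) lerD.
Qed.

Section existence.
Variables p l mu : R.
Hypotheses (p2 : 2 < p) (p6 : p < 6) (l0 : 0 < l) (mu0 : 0 < mu).
Let p_gt0 : 0 < p. Proof. by apply: lt_trans p2. Qed.
Local Notation dom := (edge_set l).
Implicit Types (U V : edge -> R -> R) (e : edge).

Lemma energy_infimum : (exists U V, gsob l U V /\ gmass l U = mu) ->
  exists m0, (forall U V, gsob l U V -> gmass l U = mu -> m0 <= gE p l U V) /\
  exists K C (u v : nat -> edge -> R -> R), [/\ 0 < K,
    forall n, gsob l (u n) (v n),
    forall n, gmass l (u n) = mu /\ gE p l (u n) (v n) < m0 + n.+1%:R^-1,
    forall n e, \int[leb]_(x in dom e) v n e x ^+ 2 <= K &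
    forall n e x, dom e x -> `|u n e x| <= C].
Proof.
move=> [U1 [V1 [s1 mass1]]].
have [K0 HK0] := graph_coercive p2 p6 l0 mu0.
pose S := [set r : R | exists U V, [/\ gsob l U V, gmass l U = mu & r = gE p l U V]].
have S0 : S !=set0 by exists (gE p l U1 V1), U1, V1.
have lbS : lbound S (- K0).
  move=> _ [U [V [sUV mE ->]]]; have := HK0 _ _ sUV mE; have := gmass_ge0 l V.
  by move: (gmass l V) (gE p l U V) => *; lra.
have hiS : has_inf S by split => //; exists (- K0).
exists (inf S); split.
  by move=> U V sUV mE; apply: ge_inf; [exists (- K0)|exists U, V].
have adh (n : nat) : exists UV : (edge -> R -> R) * (edge -> R -> R),
    [/\ gsob l UV.1 UV.2, gmass l UV.1 = mu & gE p l UV.1 UV.2 < inf S + n.+1%:R^-1].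
  have [|r [U [V [sUV mE ->]]] rlt] := @inf_adherent _ S (n.+1%:R^-1) _ hiS.
    by rewrite invr_gt0.
  by exists (U, V).
have /choice[f Hf] := adh.
(* Coercivity bounds [gmass V] by 4 (E + K0), and the energies of the sequence are below
   [inf S + 1]; the maximum with 1 keeps [K] positive. *)
pose K := Num.max 1 (4 * (K0 + inf S + 1)).
have K_gt0 : 0 < K by rewrite lt_max ltr01.
have kin n e : \int[leb]_(x in dom e) (f n).2 e x ^+ 2 <= K.
  have [sf mf Ef] := Hf n; have := HK0 _ _ sf mf => H.
  have n1 : n.+1%:R^-1 <= 1 :> R by rewrite invf_le1// ler1n.
  apply: le_trans (_ : gmass l (f n).2 <= _).
    rewrite /gmass sum_edge; apply: (@edge_le_sum R (fun e => \int[leb]_(x in dom e) (f n).2 e x ^+ 2)).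
    by move=> e'; apply: Rintegral_ge0 => x _; exact: sqr_ge0.
  rewrite /K le_max; apply/orP; right; move: H Ef n1.
  by move: (gmass l (f n).2) (gE p l _ _) (inf S) (n.+1%:R^-1) => *; lra.
(* [C] is the bound of [sobolev_bounded] on the half-lines. On the pendant the Hoelder estimate from
   the vertex adds at most the square root of [K * l], which is below [K * l + 1]. *)
pose C := 2 * mu + 2 * K + 1; exists K, (C + (K * l + 1)), (fun n => (f n).1), (fun n => (f n).2).
split => //; [by move=> n; have [] := Hf n|by move=> n; have [] := Hf n|].
move=> n e; have [[sf f0] mf _] := Hf n.
have ray_bound (b : bool) x : ray x -> `|(f n).1 (Some b) x| <= C.
  move=> rx; have sr y : ray y -> `[y, y + 1] `<=` ray.
    move=> /rayP y0 z /=; rewrite in_itv/= => /andP[yz _].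
    by apply/rayP; exact: le_trans y0 yz.
  apply: le_trans (sobolev_bounded (@measurable_ray R) sr (sf (Some b)) rx) _.
  have m1 : \int[leb]_(x in ray) (f n).1 (Some b) x ^+ 2 <= mu.
    rewrite -mf /gmass sum_edge.
    apply: (@edge_le_sum R (fun e => \int[leb]_(x in dom e) (f n).1 e x ^+ 2) (Some b)).
    by move=> e'; apply: Rintegral_ge0 => y _; exact: sqr_ge0.
  by rewrite /C lerD2r; apply: lerD; rewrite ler_pM2l// (kin n (Some b)).
have Kl : 0 <= K * l + 1 by rewrite addr_ge0// mulr_ge0// ltW.
case: e => [b x rx|x Dx]; first by apply: le_trans (ray_bound b x rx) _; rewrite lerDl.
have B0 : `|(f n).1 None 0| <= C by rewrite (f0 None (Some true)); apply: ray_bound; apply/rayP.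
have D0 : dom None 0 by exact: edge0.
move: (Dx); rewrite /= in_itv/= => /andP[x0 xl].
have [pu _ _ _ v2] := sf None.
have hh := primitive_on_holder (measurable_edge l None) (@edge_interval R l None) pu v2 (kin n None) D0 Dx x0.
have hh' : `|(f n).1 None x - (f n).1 None 0| <= K * l + 1.
  rewrite -(@ler_pXn2r _ 2)// ?nnegrE// real_normK ?num_real//.
  apply: le_trans hh _; rewrite subr0; apply: le_trans (_ : K * l <= _).
    by rewrite ler_pM2l.
  have Kl0 : 0 <= K * l by rewrite mulr_ge0// ltW.
  by move: Kl0; move: (K * l) => t ?; nra.
have -> : (f n).1 None x = (f n).1 None 0 + ((f n).1 None x - (f n).1 None 0) by ring.
by apply: le_trans (ler_normD _ _) _; exact: lerD.
Qed.

End existence.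

End minimizing_sequences.

(** * Passage to the limit *)

Section existence_of_minimizers.
Context {R : realType}.
Implicit Types (D A B : set R) (f g u v w z : R -> R) (a b c x y r : R).

Lemma ulim_sum (F : set_system nat) (s : nat -> edge -> R) (x : edge -> R) : Filter F ->
  (forall e, ulim F (s ^~ e) (x e)) -> ulim F (fun n => \sum_(e : edge) s n e) (\sum_(e : edge) x e).
Proof.
move=> FF sx; rewrite sum_edge; under eq_fun do rewrite sum_edge.
by apply: ulimD; [exact: sx|apply: ulimD; exact: sx].
Qed.

Let le_add_truncated (a b c b' c' m d : R) : b <= b' + d -> c <= c' + d ->
  a + (b' + c') <= m -> a + (b + c) <= m + 2 * d.
Proof. by move=> *; lra. Qed.

Let near_inf_absurd (m t y z : R) : t < y - m -> y <= z -> z < m + t -> False.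
Proof. by move=> *; lra. Qed.

Section existence.
Variables p l mu E0 : R.
Hypotheses (p2 : 2 < p) (p6 : p < 6) (l0 : 0 < l) (mu0 : 0 < mu).
Hypotheses (E00 : E0 < 0) (E0low : forall N, 0 < N -> E0 <= lower p2 mu N).
Let p_gt0 : 0 < p. Proof. by apply: lt_trans p2. Qed.
Local Notation dom := (edge_set l).
Implicit Types (U V : edge -> R -> R) (e : edge).

(** The soliton enters only through its energy [E0]: negative, a lower bound for [lower mu], and
    strictly above the energy of some competitor. *)
Lemma minimizer_exists :
  (exists U V, [/\ gsob l U V, gmass l U = mu & gE p l U V < E0]) ->
  exists U V, [/\ gsob l U V, gmass l U = mu &
    forall U' V', gsob l U' V' -> gmass l U' = mu -> gE p l U V <= gE p l U' V'].
Proof.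
move=> [Uc [Vc [sc massc Ec]]].
have [m0 [Hm [K [C [u [v [K0 sn mE vK uC]]]]]]] :=
  energy_infimum p2 p6 l0 mu0 (ex_intro _ Uc (ex_intro _ Vc (conj sc massc))).
have m0E : m0 < E0 by exact: le_lt_trans (Hm _ _ sc massc) Ec.
have m00 : m0 < 0 by exact: lt_trans E00.
(* Makes E + k mass equal to E - m0 at mass [mu], so that it tends to 0 along the minimizing
   sequence. *)
pose k := - m0 / mu; have k0 : 0 < k by rewrite divr_gt0// oppr_gt0.
have kmu : k * mu = - m0 by rewrite /k divfK// gt_eqF.
have [F [FU Foo]] := ultraFilterLemma (eventually_filter : ProperFilter \oo).
have FF : ProperFilter F by exact: ultra_proper.
have small_n (d : R) : 0 < d -> F [set n | n.+1%:R^-1 < d].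
  move=> d0; apply: Foo; exists (Num.truncn d^-1) => // n /= Nn.
  rewrite -[d]invrK ltf_pV2 ?posrE ?invr_gt0//.
  by apply: lt_le_trans (truncnS_gt _) _; rewrite ler_nat.
have sq0 (f : R -> R) (D : set R) : 0 <= \int[leb]_(x in D) f x ^+ 2.
  by apply: Rintegral_ge0 => x _; exact: sqr_ge0.
have mle n e : \int[leb]_(x in dom e) u n e x ^+ 2 <= mu.
  rewrite -(mE n).1 /gmass sum_edge.
  by apply: (@edge_le_sum R (fun e => \int[leb]_(x in dom e) u n e x ^+ 2)) => e'; exact: sq0.
have domp e x : dom e x -> 0 <= x.
  by case: e => [b|] /=; rewrite in_itv/= => /andP[].
have /choice[ue Hue] e := weak_compact FU (measurable_edge l e) (@edge_interval R l e)
  (edge_exhausted l0 e) (edge0 l0 e) (@domp e) K0 (fun n => (sn n).1 e)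
  (fun n => uC n e) (fun n => mle n e) (fun n => vK n e).
have /choice[ve Hve] := Hue.
have lim0 e e' : ue e 0 = ue e' 0.
  have [_ L _ _ _] := Hve e; have [_ L' _ _ _] := Hve e'.
  have {}L := L 0 (edge0 l0 e); have {}L' := L' 0 (edge0 l0 e').
  by apply/eqP; rewrite eq_le; apply/andP; split;
    [apply: ulim_le L L' _|apply: ulim_le L' L _];
    apply: filterE => n /=; rewrite ((sn n).2 e e').
have sU : gsob l ue ve by split => // e; have [] := Hve e.
have upi e : (dom e).-int (fun x => `|ue e x| `^ p) by exact: (gsob_int_pot p2 l0 e sU).
have C0 : 0 <= C by apply: le_trans (uC 0%N None 0 (edge0 l0 None)).
(* Truncating the half-lines at points where the limit is small discards only
   tails with nonnegative contribution, so the truncated functional is lower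
   semicontinuous along the sequence. *)
have gap0 : 0 < E0 - m0 by rewrite subr_gt0.
have low' N : 0 < N -> (E0 - m0) - k * mu <= lower p2 mu N.
  by move=> N0; rewrite kmu opprK subrK; exact: E0low.
have [c0 c00 Htail] := tail_jint_ge0 k0 gap0 C0 low'.
pose G t := k * t ^+ 2 - p^-1 * `|t| `^ p.
have cG : continuous G.
  move=> t; apply: (@cvgB _ _ _ _ (nbhs_filter t) (fun t => k * t ^+ 2) (fun t => p^-1 * `|t| `^ p)).
    by apply: cvgM; [exact: cvg_cst|exact: exprn_continuous].
  by apply: cvgM; [exact: cvg_cst|exact: continuous_norm_powR].
have trunc (X : edge -> R) : X None = l -> (forall b : bool, 0 <= X (Some b)) ->
    (forall b : bool, `|ue (Some b) (X (Some b))| < c0) ->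
    \sum_(e : edge) jint p k `[0, X e] (ue e) (ve e) <= 0 /\
    \sum_(e : edge) \int[leb]_(x in `[0, X e]) ue e x ^+ 2 <= mu.
  move=> XN X0 Xc.
  have DX e : dom e (X e).
    by case: e => [b|] /=; [apply/rayP|rewrite XN in_itv/= lexx ltW].
  have sX e : `[0, X e] `<=` dom e.
    by apply: is_interval_sub_itv; [exact: edge_interval|exact: edge0|exact: DX].
  have /choice[T HT] e : exists T, ulim F (fun n => \int[leb]_(x in `[0, X e]) v n e x ^+ 2) T /\
      \int[leb]_(x in `[0, X e]) ve e x ^+ 2 <= T.
    by have [_ _ _ /(_ _ (DX e))[T T1 T2] _] := Hve e; exists T.
  have intG w e : (dom e).-int (fun x => w x ^+ 2) -> (dom e).-int (fun x => `|w x| `^ p) ->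
      \int[leb]_(x in `[0, X e]) G (w x) =
      k * \int[leb]_(x in `[0, X e]) w x ^+ 2 - p^-1 * \int[leb]_(x in `[0, X e]) `|w x| `^ p.
    move=> w2 wp; have mD := measurable_edge l e.
    have w2' : (`[0, X e]).-int (fun x => w x ^+ 2).
      by apply: integrableS w2; [exact: mD|exact: measurable_itv|exact: sX].
    have wp' : (`[0, X e]).-int (fun x => `|w x| `^ p).
      by apply: integrableS wp; [exact: mD|exact: measurable_itv|exact: sX].
    rewrite /G RintegralB//; [|by apply: intZ|by apply: intZ].
    by rewrite RintegralZl// RintegralZl.
  split; last first.
    have L : ulim F (fun n => \sum_(e : edge) \int[leb]_(x in `[0, X e]) u n e x ^+ 2)
        (\sum_(e : edge) \int[leb]_(x in `[0, X e]) ue e x ^+ 2).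
      apply: ulim_sum => e; have [_ _ _ _ H] := Hve e.
      exact: (H (X e) (fun t => t ^+ 2) (DX e) (@exprn_continuous _ 2)).
    apply: ulim_le L (@ulim_cst R F mu _) _; apply: filterE => n /=.
    rewrite -(mE n).1; apply: ler_sum => e _; apply: le_Rint_sub.
    - exact: measurable_itv.
    - exact: measurable_edge.
    - exact: sX.
    - by have [_ _ _ u2 _] := (sn n).1 e.
    - by move=> x _; exact: sqr_ge0.
  have L : ulim F (fun n => \sum_(e : edge) jint p k `[0, X e] (u n e) (v n e))
      (\sum_(e : edge) (2^-1 * T e + \int[leb]_(x in `[0, X e]) G (ue e x))).
    apply: ulim_sum => e; have [_ _ _ _ H] := Hve e.
    have E : (fun n => jint p k `[0, X e] (u n e) (v n e)) =
        (fun n => 2^-1 * (\int[leb]_(x in `[0, X e]) v n e x ^+ 2) + \int[leb]_(x in `[0, X e]) G (u n e x)).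
      apply/funext => n; have [_ _ _ u2 _] := (sn n).1 e.
      by rewrite (intG _ _ u2 (gsob_int_pot p2 l0 e (sn n))) /jint mulrC.
    rewrite E; apply: ulimD; last exact: H.
    by apply: ulimZ; exact: (HT e).1.
  apply: le_trans (_ : \sum_(e : edge) (2^-1 * T e + \int[leb]_(x in `[0, X e]) G (ue e x)) <= 0).
    apply: ler_sum => e _; have [_ _ _ u2 _] := sU.1 e.
    rewrite (intG _ _ u2 (upi e)) /jint mulrC lerD2r ler_pM2l// ?invr_gt0//.
    exact: (HT e).2.
  apply/ler_addgt0Pr => d d0; rewrite add0r.
  apply: ulim_le L (@ulim_cst R F d _) _.
  (* The strict inequality [Xc] for the limit leaves room for the sequence to satisfy the smallness
     condition of [Htail] at the same points. *)
  have near_c (b : bool) : F [set n | `|u n (Some b) (X (Some b))| <= c0].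
    have [_ H _ _ _] := Hve (Some b).
    have d1 : 0 < c0 - `|ue (Some b) (X (Some b))| by rewrite subr_gt0.
    apply: filterS (H _ (DX (Some b)) _ d1) => n /= Hn.
    have -> : u n (Some b) (X (Some b)) = ue (Some b) (X (Some b)) +
      (u n (Some b) (X (Some b)) - ue (Some b) (X (Some b))) by ring.
    by apply: le_trans (ler_normD _ _) _; rewrite addrC -lerBrDr.
  apply: filterS (filterI (small_n d d0) (filterI (near_c true) (near_c false))) => n /= [nd [c1 c2]].
  apply: le_trans (_ : gE p l (u n) (v n) + k * gmass l (u n) <= _); last first.
    rewrite (mE n).1 kmu; have := (mE n).2; move: nd.
    by move: (n.+1%:R^-1) (gE p l _ _) => *; lra.
  rewrite -sum_jint; apply: ler_sum => e _.
  case: e => [b|]; last by rewrite XN.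
  have cb : `|u n (Some b) (X (Some b))| <= c0 by case: b.
  rewrite /= (jint_split k (X0 b) ((sn n).1 (Some b)) (gsob_int_pot p2 l0 (Some b) (sn n))).
  rewrite lerDl; apply: (Htail _ _ _ (X0 b) ((sn n).1 (Some b)) _ cb (mle n (Some b))).
  by move=> x x0; apply: uC; apply/rayP.
have full d : 0 < d -> gE p l ue ve + k * gmass l ue <= 0 + 2 * d /\ gmass l ue <= mu + 2 * d.
  move=> d0.
  have /choice[X HX] (b : bool) := jint_approx p2 k0 c00 d0 (sU.1 (Some b)) (upi (Some b)).
  pose Xe e := if e is Some b then X b else l.
  have [||b|H1 H2] := trunc Xe.
  - by [].
  - by move=> b; have [] := HX b.
  - by have [] := HX b.
  rewrite !sum_edge /= in H1 H2.
  have [_ _ j1 q1] := HX true; have [_ _ j2 q2] := HX false.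
  split; first by rewrite -sum_jint !sum_edge; exact: le_add_truncated j1 j2 H1.
  by rewrite /gmass !sum_edge; exact: le_add_truncated q1 q2 H2.
have eps_le (a b : R) : (forall d, 0 < d -> a <= b + 2 * d) -> a <= b.
  move=> H; apply/ler_addgt0Pr => d d0; have d20 : 0 < d / 2 by rewrite divr_gt0.
  by have := H _ d20; rewrite mulrC divfK.
have JU : gE p l ue ve + k * gmass l ue <= 0 by apply: eps_le => d /full[].
have massU : gmass l ue <= mu by apply: eps_le => d /full[].
have mass_gt0 : 0 < gmass l ue.
  rewrite lt_neqAle gmass_ge0 andbT eq_sym; apply/eqP => mass0.
  have uN0 x : 0 <= x <= l -> ue None x = 0.
    move=> xl; have [pu _ _ _ _] := sU.1 None.
    apply: (Rint_sqr_eq0 l0 (primitive_on_itv_econt pu) _ xl).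
    have : gmass l ue <= 0 by rewrite mass0.
    apply: le_trans; rewrite /gmass sum_edge.
    by apply: (@edge_le_sum R (fun e => \int[leb]_(x in dom e) ue e x ^+ 2) None) => e'; exact: sq0.
  have p20 : 0 < p - 2 by rewrite subr_gt0.
  (* Chosen so that the lower bound -m^(p - 2) mu / p of [pendant_small] is [m0 / 2], halfway
     between the infimum and 0. *)
  pose q := - m0 / 2 * p / mu.
  have q0 : 0 < q by rewrite divr_gt0// mulr_gt0// divr_gt0// oppr_gt0.
  pose m := q `^ (p - 2)^-1; have m_gt0 : 0 < m by rewrite powR_gt0.
  have mpow : m `^ (p - 2) * mu / p = - m0 / 2.
    rewrite -powRrM mulVf ?gt_eqF// powRr1; last exact: ltW.
    by rewrite /q; field; rewrite !gt_eqF.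
  (* The two alternatives of [pendant_small] keep the energy above [m0] by [E0 - m0] or by
     [- m0 / 2], whereas the sequence comes arbitrarily close to [m0]. *)
  have d0 : 0 < Num.min (E0 - m0) (- m0 / 2) by rewrite lt_min gap0 divr_gt0// oppr_gt0.
  have [_ _ unif _ _] := Hve None.
  have [n /= [n1 n2]] := filter_ex (filterI (small_n _ d0) (unif l m m_gt0)).
  have um x : 0 <= x <= l -> `|u n None x| <= m.
    move=> xl; have := n2 x; rewrite uN0// subr0; apply; last by case/andP: xl.
    by rewrite /= in_itv.
  have := (mE n).2; move: n1; rewrite lt_min => /andP[n3 n4].
  have [[N N0 Nle]|] := pendant_small p2 l0 mu0 m_gt0 (sn n) (mE n).1 um.
    exact: near_inf_absurd n3 (le_trans (E0low N0) Nle).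
  have half : - m0 / 2 = - (- m0 / 2) - m0 by field.
  by rewrite mpow; apply: near_inf_absurd; rewrite -half.
have gEle : gE p l ue ve <= m0 / mu * gmass l ue.
  have -> : m0 / mu = - k by rewrite /k mulNr opprK.
  by rewrite mulNr -subr_le0 opprK.
have massE := mass_full p2 l0 mu0 m00 Hm sU mass_gt0 massU gEle.
exists ue, ve; split; [exact: sU|exact: massE|].
move=> U' V' sU' mE'; apply: le_trans (Hm _ _ sU' mE').
by move: gEle; rewrite massE divfK ?gt_eqF.
Qed.

End existence.

End existence_of_minimizers.

Theorem theorem2p6 (R : realType) (mu p l : R)
    (mu_gt0 : 0 < mu) (p_gt2 : 2 < p) (p_lt6 : p < 6) (l_gt0 : 0 < l) :
  let inf_graph :=
    ereal_inf [set energy_graph p l u | u in H1mu_graph l mu] in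
  (exists phi : R -> R,
     [/\ soliton p mu phi,
         (ereal_inf [set energy_line p u | u in H1mu_line mu]
            = energy_line p phi)%E
       & (inf_graph < energy_line p phi)%E]) /\
  (exists u : edge -> R -> R,
     H1mu_graph l mu u /\ energy_graph p l u = inf_graph).
Proof.
move=> inf_graph; have [M M0 mE] := sol_mass_exists p_gt2 p_lt6 mu_gt0.
have [solM solE lineE] := soliton_exists p_gt2 p_lt6 mu_gt0 M0 mE.
have [Uc [Vc [sc mc Ec]]] := graph_competitor p_gt2 l_gt0 M0 mE.
have E0 : soliton_energy p M < 0.
  (* [N = 1] is a dummy value: the negativity obtained here does not involve [N]. *)
  by have [_ H] := sol_energy_le_lower p_gt2 p_lt6 M0 ltr01 mE; exact: H mu_gt0.
have Elow N : 0 < N -> soliton_energy p M <= lower p_gt2 mu N.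
  by move=> N0; have [H _] := sol_energy_le_lower p_gt2 p_lt6 M0 N0 mE; exact: H.
have [U [V [sU mU minU]]] := minimizer_exists p_lt6 l_gt0 mu_gt0 E0 Elow
  (ex_intro _ Uc (ex_intro _ Vc (And3 sc mc Ec))).
have [hU EU] := gsob_energy p_gt2 l_gt0 sU mU.
have infE : inf_graph = (gE p l U V)%:E.
  apply/eqP; rewrite eq_le; apply/andP; split.
    by rewrite -EU; apply: ereal_inf_lbound; exists U.
  apply: le_ereal_inf_tmp => _ [W hW <-].
  have [sW mW] := H1mu_graph_gsob hW.
  have [_ ->] := gsob_energy p_gt2 l_gt0 sW mW.
  by rewrite lee_fin; exact: minU.
split; last by exists U; split => //; rewrite EU infE.
exists (sol p M); split => //.
by rewrite solE infE lte_fin; apply: le_lt_trans Ec; exact: minU.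
Qed.
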